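(* For each of the 54 families of data in Lists 1–5 of the context, let $G$, $V$ and the $G$-set $\mathcal S$ of ordered pairs $(Q_1,Q_2)$ of complementary subspaces of $V$ be as defined there (so $\mathcal S=\mathcal S(B,J),\ \mathcal S(B),\ \mathcal S(J),\ \mathcal S_m(D),\ \mathcal S_p$ for Lists 1, 2, 3, 4, 5 respectively). Then $G$ is isomorphic to the classical group named in the corresponding row, and: (i) for every family not marked by $\star$, the group $G$ acts transitively on $\mathcal S$, and the stabilizer of a point is isomorphic to the group $H$ named in the row, so $\mathcal S\simeq G/H$; (ii) for every family marked by $\star$, $\mathcal S$ is the disjoint union of finitely many $G$-orbits, indexed as stated in the row, the orbit with a given index being isomorphic, as a $G$-homogeneous space, to $G/H_i$ with $H_i$ the group named in the row for that index; (iii) in all cases each orbit is a symmetric space, i.e. the stabilizer of each point of $\mathcal S$ is the set of fixed points of an automorphism $\sigma$ of $G$ with $\sigma^2=1$.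
   Context: **Forms and groups.** $\mathbb K$ is $\mathbb R$, $\mathbb C$ or $\mathbb H$; linear spaces over $\mathbb H$ are right modules, and all spaces are finite-dimensional. A map $B:V\times V\to\mathbb K$ is sesquilinear if it is biadditive and $B(v\lambda,w)=B(v,w)\lambda$, $B(v,w\lambda)=\overline\lambda B(v,w)$. It is hermitian if moreover $B(v,w)=\overline{B(w,v)}$, antihermitian if $B(v,w)=-\overline{B(w,v)}$. A *form* is a nondegenerate form of one of the types: bilinear symmetric or skew-symmetric over $\mathbb R$ or $\mathbb C$; hermitian or antihermitian over $\mathbb C$ or $\mathbb H$. $\mathcal U(B)$ is the group of invertible $\mathbb K$-linear operators preserving $B$. Notation: $\mathrm{Sp}(2n,\mathbb R),\mathrm{Sp}(2n,\mathbb C)$ (skew-symmetric bilinear forms on $\mathbb R^{2n},\mathbb C^{2n}$), $\mathrm O(n,\mathbb C)$ (symmetric bilinear form on $\mathbb C^n$), $\mathrm O(p,q),\mathrm U(p,q),\mathrm{Sp}(p,q)$ (hermitian forms with inertia indices $(p,q)$ on $\mathbb R^{p+q},\mathbb C^{p+q},\mathbb H^{p+q}$; over $\mathbb R$ hermitian means symmetric), $\mathrm{SO}^*(2n)$ (antihermitian form on $\mathbb H^n$). A subspace is $B$-isotropic if $B$ vanishes identically on it. $B$ is *split* if there is a $B$-isotropic subspace of dimension $\frac12\dim V$. **Semiinvolutions.** A semiinvolution is an operator $J:V\to V$, linear or (only if $\mathbb K=\mathbb C$) antilinear, with $J^2=\pm1$. $J$ is split if $V=Q\oplus JQ$ for some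 subspace $Q$. $J$ is consistent with $B$ if, with $\mu=\pm1$, $B(Jv,Jw)=\mu B(v,w)$ ($J$ linear) or $B(Jv,Jw)=\mu\overline{B(v,w)}$ ($J$ antilinear). In that case the *managing form* is $D(v,w)=B(v,Jw)$. The pair $(B,J)$ is *split* if $V=Q\oplus JQ$ for some $B$-isotropic subspace $Q$. **List 1.** $(B,J)$ is a split pair on $V$ of the type given in the row; in the rows with parameters $(p,q)$ it is moreover required that $D$ (symmetric over $\mathbb R$, hermitian otherwise) has inertia indices $(2p,2q)$. $G=\{g\in\mathcal U(B): gJ=Jg\}$. $\mathcal S(B,J)$ is the set of ordered pairs $(Q_1,Q_2)$ of maximal $B$-isotropic subspaces with $V=Q_1\oplus Q_2$, $JQ_1=Q_2$. Each row reads: $G/H$; $V$; type of $B$; type of $J$ (for $\mathbb K=\mathbb C$); $(J^2,\mu)$. In $\star$ rows the orbits are indexed by $p=0,1,\dots,n$. 1. $\mathrm O(p,q)\times\mathrm O(p,q)/\mathrm O(p,q)$; $\mathbb R^{2(p+q)}$; symmetric; $(1,1)$. 2. $\mathrm{Sp}(2n,\mathbb R)\times\mathrm{Sp}(2n,\mathbb R)/\mathrm{Sp}(2n,\mathbb R)$; $\mathbb R^{4n}$; skew-symmetric; $(1,1)$. 3$\star$. $\mathrm{GL}(n,\mathbb R)/\mathrm O(p,n-p)$; $\mathbb R^{2n}$; skew-symmetric; $(1,-1)$. 4. $\mathrm{GL}(2n,\mathbb R)/\mathrm{Sp}(2n,\mathbb R)$; $\mathbb R^{4n}$; symmetric; $(1,-1)$.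 5$\star$. $\mathrm O(n,\mathbb C)/\mathrm O(p,n-p)$; $\mathbb R^{2n}$; symmetric; $(-1,-1)$. 6. $\mathrm{Sp}(2n,\mathbb C)/\mathrm{Sp}(2n,\mathbb R)$; $\mathbb R^{4n}$; skew-symmetric; $(-1,-1)$. 7. $\mathrm U(n,n)/\mathrm{Sp}(2n,\mathbb R)$; $\mathbb R^{4n}$; symmetric; $(-1,1)$. 8. $\mathrm U(p,q)/\mathrm O(p,q)$; $\mathbb R^{2(p+q)}$; skew-symmetric; $(-1,1)$. 9. $\mathrm O(n,\mathbb C)\times\mathrm O(n,\mathbb C)/\mathrm O(n,\mathbb C)$; $\mathbb C^{2n}$; symmetric; linear; $(1,1)$. 10. $\mathrm{Sp}(2n,\mathbb C)\times\mathrm{Sp}(2n,\mathbb C)/\mathrm{Sp}(2n,\mathbb C)$; $\mathbb C^{4n}$; skew-symmetric; linear; $(1,1)$. 11. $\mathrm U(p,q)\times\mathrm U(p,q)/\mathrm U(p,q)$; $\mathbb C^{2(p+q)}$; hermitian; linear; $(1,1)$. 12. $\mathrm{GL}(2n,\mathbb C)/\mathrm{Sp}(2n,\mathbb C)$; $\mathbb C^{4n}$; symmetric; linear; $(1,-1)$. 13. $\mathrm{GL}(n,\mathbb C)/\mathrm O(n,\mathbb C)$; $\mathbb C^{2n}$; skew-symmetric; linear; $(1,-1)$. 14$\star$. $\mathrm{GL}(n,\mathbb C)/\mathrm U(p,n-p)$; $\mathbb C^{2n}$; hermitian; linear; $(1,-1)$. 15$\star$. $\mathrm{Sp}(2n,\mathbb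 R)/\mathrm U(p,n-p)$; $\mathbb C^{2n}$; skew-symmetric; antilinear; $(1,1)$. 16. $\mathrm O(2p,2q)/\mathrm U(p,q)$; $\mathbb C^{2(p+q)}$; symmetric; antilinear; $(1,1)$. 17. $\mathrm O(n,n)/\mathrm O(n,\mathbb C)$; $\mathbb C^{2n}$; hermitian; antilinear; $(1,1)$. 18. $\mathrm{Sp}(4n,\mathbb R)/\mathrm{Sp}(2n,\mathbb C)$; $\mathbb C^{4n}$; hermitian; antilinear; $(1,-1)$. 19. $\mathrm{Sp}(p,q)/\mathrm U(p,q)$; $\mathbb C^{2(p+q)}$; skew-symmetric; antilinear; $(-1,1)$. 20$\star$. $\mathrm{SO}^*(2n)/\mathrm U(p,n-p)$; $\mathbb C^{2n}$; symmetric; antilinear; $(-1,1)$. 21. $\mathrm{Sp}(n,n)/\mathrm{Sp}(2n,\mathbb C)$; $\mathbb C^{4n}$; hermitian; antilinear; $(-1,1)$. 22. $\mathrm{SO}^*(2n)/\mathrm O(n,\mathbb C)$; $\mathbb C^{2n}$; hermitian; antilinear; $(-1,-1)$. 23. $\mathrm{Sp}(p,q)\times\mathrm{Sp}(p,q)/\mathrm{Sp}(p,q)$; $\mathbb H^{2(p+q)}$; hermitian; $(1,1)$. 24. $\mathrm{SO}^*(2n)\times\mathrm{SO}^*(2n)/\mathrm{SO}^*(2n)$; $\mathbb H^{2n}$; antihermitian; $(1,1)$. 25. $\mathrm{GL}(n,\mathbb H)/\mathrm{SO}^*(2n)$; $\mathbb H^{2n}$; hermitian; $(1,-1)$. 26$\star$.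 $\mathrm{GL}(n,\mathbb H)/\mathrm{Sp}(p,n-p)$; $\mathbb H^{2n}$; antihermitian; $(1,-1)$. 27. $\mathrm U(2p,2q)/\mathrm{Sp}(p,q)$; $\mathbb H^{2(p+q)}$; antihermitian; $(-1,1)$. 28. $\mathrm U(n,n)/\mathrm{SO}^*(2n)$; $\mathbb H^{2n}$; hermitian; $(-1,1)$. 29. $\mathrm O(2n,\mathbb C)/\mathrm{SO}^*(2n)$; $\mathbb H^{2n}$; antihermitian; $(-1,-1)$. 30$\star$. $\mathrm{Sp}(2n,\mathbb C)/\mathrm{Sp}(p,n-p)$; $\mathbb H^{2n}$; hermitian; $(-1,-1)$. **List 2.** $B$ is a split form on $V=\mathbb K^{2n}$, $G=\mathcal U(B)$, $H=\mathrm{GL}(n,\mathbb K)$. $\mathcal S(B)$ is the set of ordered pairs $(Q_1,Q_2)$ of maximal $B$-isotropic subspaces with $V=Q_1\oplus Q_2$. Families: 31. $\mathrm O(n,n)/\mathrm{GL}(n,\mathbb R)$; 32. $\mathrm{Sp}(2n,\mathbb R)/\mathrm{GL}(n,\mathbb R)$; 33. $\mathrm O(2n,\mathbb C)/\mathrm{GL}(n,\mathbb C)$; 34. $\mathrm{Sp}(2n,\mathbb C)/\mathrm{GL}(n,\mathbb C)$; 35. $\mathrm U(n,n)/\mathrm{GL}(n,\mathbb C)$; 36. $\mathrm{Sp}(n,n)/\mathrm{GL}(n,\mathbb H)$; 37. $\mathrm{SO}^*(4n)/\mathrm{GL}(n,\mathbb H)$. **List 3.** $J$ is a split semiinvolution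 on $V$, $G$ is the centralizer of $J$ in $\mathrm{GL}(V)$. $\mathcal S(J)$ is the set of ordered pairs $(Q_1,Q_2)$ of subspaces with $V=Q_1\oplus Q_2$, $JQ_1=Q_2$. Families: 38. $\mathrm{GL}(n,\mathbb R)\times\mathrm{GL}(n,\mathbb R)/\mathrm{GL}(n,\mathbb R)$ ($V=\mathbb R^{2n}$, $J^2=1$); 39. $\mathrm{GL}(n,\mathbb C)/\mathrm{GL}(n,\mathbb R)$ ($\mathbb R^{2n}$, $J^2=-1$); 40. $\mathrm{GL}(n,\mathbb C)\times\mathrm{GL}(n,\mathbb C)/\mathrm{GL}(n,\mathbb C)$ ($\mathbb C^{2n}$, $J$ linear, $J^2=1$); 41. $\mathrm{GL}(2n,\mathbb R)/\mathrm{GL}(n,\mathbb C)$ ($\mathbb C^{2n}$, $J$ antilinear, $J^2=1$); 42. $\mathrm{GL}(n,\mathbb H)/\mathrm{GL}(n,\mathbb C)$ ($\mathbb C^{2n}$, $J$ antilinear, $J^2=-1$); 43. $\mathrm{GL}(n,\mathbb H)\times\mathrm{GL}(n,\mathbb H)/\mathrm{GL}(n,\mathbb H)$ ($\mathbb H^{2n}$, $J^2=1$); 44. $\mathrm{GL}(2n,\mathbb C)/\mathrm{GL}(n,\mathbb H)$ ($\mathbb H^{2n}$, $J^2=-1$). **List 4.** $D$ is a form on $V$, $G=\mathcal U(D)$. $\mathcal S_m(D)$ is the set of pairs $(Q_1,Q_2)$ with $\dim Q_1=m$, $V=Q_1\oplus Q_2$, $Q_2$ the $D$-orthogonal complement of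 $Q_1$ (equivalently, $m$-dimensional $Q_1$ on which $D$ is nondegenerate). Families: 45$\star$. $\mathrm O(p,q)/\mathrm O(r,s)\times\mathrm O(p-r,q-s)$; 46. $\mathrm{Sp}(2(k+l),\mathbb R)/\mathrm{Sp}(2k,\mathbb R)\times\mathrm{Sp}(2l,\mathbb R)$ (with $m=2k$); 47. $\mathrm O(n+m,\mathbb C)/\mathrm O(n,\mathbb C)\times\mathrm O(m,\mathbb C)$; 48. $\mathrm{Sp}(2(k+l),\mathbb C)/\mathrm{Sp}(2k,\mathbb C)\times\mathrm{Sp}(2l,\mathbb C)$ (with $m=2k$); 49$\star$. $\mathrm U(p,q)/\mathrm U(r,s)\times\mathrm U(p-r,q-s)$; 50$\star$. $\mathrm{Sp}(p,q)/\mathrm{Sp}(r,s)\times\mathrm{Sp}(p-r,q-s)$; 51. $\mathrm{SO}^*(2(m+n))/\mathrm{SO}^*(2m)\times\mathrm{SO}^*(2n)$. In rows 45, 49, 50 the orbits are indexed by all $(r,s)$ with $r+s=m$, $0\le r\le p$, $0\le s\le q$. **List 5.** $V=\mathbb K^{p+q}$, $G=\mathrm{GL}(p+q,\mathbb K)$. $\mathcal S_p$ is the set of pairs $(Q_1,Q_2)$ of subspaces with $\dim Q_1=p$, $\dim Q_2=q$, $V=Q_1\oplus Q_2$. Families: 52, 53, 54. $\mathrm{GL}(p+q,\mathbb K)/\mathrm{GL}(p,\mathbb K)\times\mathrm{GL}(q,\mathbb K)$ for $\mathbb K=\mathbb R,\mathbb C,\mathbb H$. In the source, ''all classical pseudoriemannian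 symmetric spaces'' refers to these 54 series. *)

(* Defs.v *)
From HB Require Import structures.
From mathcomp Require Import all_boot all_order all_algebra.
From mathcomp Require Import complex.
From mathcomp Require Import boolp classical_sets functions reals.
From mathcomp Require Import ring.

Set Implicit Arguments.
Unset Strict Implicit.
Unset Printing Implicit Defensive.

Import Order.TTheory GRing.Theory Num.Theory.

Local Open Scope classical_set_scope.
Local Open Scope ring_scope.

(* Quat a b c d stands for a + b i + c j + d k. *)
Record quat (R : Type) := Quat { qre : R; qi : R; qj : R; qk : R }.

Section QuatCombinatorial.
Variable R : Type.
Definition quat_to (x : quat R) := (qre x, qi x, qj x, qk x).
Definition quat_of (x : R * R * R * R) : quat R :=
  let: (a, b, c, d) := x in Quat a b c d.
Lemma quat_toK : cancel quat_to quat_of. Proof. by case. Qed.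
End QuatCombinatorial.

HB.instance Definition _ (R : choiceType) :=
  Choice.copy (quat R) (can_type (@quat_toK R)).

Section QuatRing.
Variable R : comNzRingType.
Implicit Types x y z : quat R.

Definition addq x y :=
  Quat (qre x + qre y) (qi x + qi y) (qj x + qj y) (qk x + qk y).
Definition oppq x := Quat (- qre x) (- qi x) (- qj x) (- qk x).
Definition mulq x y :=
  let: Quat a1 b1 c1 d1 := x in let: Quat a2 b2 c2 d2 := y in
  Quat (a1 * a2 - b1 * b2 - c1 * c2 - d1 * d2)
       (a1 * b2 + b1 * a2 + c1 * d2 - d1 * c2)
       (a1 * c2 - b1 * d2 + c1 * a2 + d1 * b2)
       (a1 * d2 + b1 * c2 - c1 * b2 + d1 * a2).
Definition oneq : quat R := Quat 1 0 0 0.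
Definition conjq x := Quat (qre x) (- qi x) (- qj x) (- qk x).
Definition quat_i : quat R := Quat 0 1 0 0.

Lemma addqA : associative addq.
Proof. by move=> [????] [????] [????]; rewrite /addq /= !addrA. Qed.
Lemma addqC : commutative addq.
Proof. by move=> [????] [????]; congr Quat; rewrite addrC. Qed.
Lemma add0q : left_id (Quat 0 0 0 0) addq.
Proof. by move=> [????]; rewrite /addq /= !add0r. Qed.
Lemma addNq : left_inverse (Quat 0 0 0 0) oppq addq.
Proof. by move=> [????]; rewrite /addq /= !addNr. Qed.
HB.instance Definition _ :=
  GRing.isZmodule.Build (quat R) addqA addqC add0q addNq.

Lemma mulqA : associative mulq.
Proof. by move=> [????] [????] [????] /=; congr Quat; ring. Qed.
Lemma mul1q : left_id oneq mulq.
Proof. by move=> [????] /=; congr Quat; ring. Qed.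
Lemma mulq1 : right_id oneq mulq.
Proof. by move=> [????] /=; congr Quat; ring. Qed.
Lemma mulqDl : left_distributive mulq addq.
Proof. by move=> [????] [????] [????]; rewrite /addq /=; congr Quat; ring. Qed.
Lemma mulqDr : right_distributive mulq addq.
Proof. by move=> [????] [????] [????]; rewrite /addq /=; congr Quat; ring. Qed.
Lemma oneq_neq0 : oneq != 0.
Proof. by apply/eqP => -[] /eqP; rewrite oner_eq0. Qed.
HB.instance Definition _ := GRing.Zmodule_isNzRing.Build (quat R)
  mulqA mul1q mulq1 mulqDl mulqDr oneq_neq0.

End QuatRing.

(* Every group below is a group of invertible square matrices, or a direct
   product of two such groups, hence is carried by a subset of the monoid
   ('M[K]_n, *m), resp. of a product of two of them. *)
Definition is_ugroup (R : pzRingType) (G : set R) :=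
  [/\ G 1, forall x y, G x -> G y -> G (x * y) &
      forall x, G x -> exists2 y, G y & x * y = 1 /\ y * x = 1].

Record ugroup (R : pzRingType) := UGroup {
  ug_set :> set R;
  ug_groupP : is_ugroup ug_set
}.

Lemma ug1 (R : pzRingType) (G : ugroup R) : ug_set G 1.
Proof. by case: (ug_groupP G). Qed.

Lemma ugM (R : pzRingType) (G : ugroup R) x y :
  ug_set G x -> ug_set G y -> ug_set G (x * y).
Proof. by case: (ug_groupP G) => _ + _; apply. Qed.

Lemma ugV (R : pzRingType) (G : ugroup R) x :
  ug_set G x -> exists2 y, ug_set G y & x * y = 1 /\ y * x = 1.
Proof. by case: (ug_groupP G) => _ _; apply. Qed.

Definition isomorphic (R1 R2 : pzRingType) (A : set R1) (B : set R2) :=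
  exists2 f : R1 -> R2, set_bij A B f &
    forall x y, A x -> A y -> f (x * y) = f x * f y.

Definition involutive_automorphism (R : pzRingType) (A : set R) (s : R -> R) :=
  [/\ set_bij A A s,
      forall x y, A x -> A y -> s (x * y) = s x * s y &
      forall x, A x -> s (s x) = x].

Lemma ug_prod_group (R1 R2 : pzRingType) (A : ugroup R1) (B : ugroup R2) :
  is_ugroup (A `*` B : set (R1 * R2)%type).
Proof.
split.
- by split; exact: ug1.
- by move=> x y [? ?] [? ?]; split; exact: ugM.
- move=> [x1 x2] [/= /ugV[y1 ? [e1 e1']] /ugV[y2 ? [e2 e2']]].
  exists (y1, y2); first by split.
  by split; congr pair.
Qed.

Definition ug_prod (R1 R2 : pzRingType) (A : ugroup R1) (B : ugroup R2) :
    ugroup (R1 * R2)%type :=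
  UGroup (ug_prod_group A B).

Notation "A '\xG' B" := (ug_prod A B) (at level 40, left associativity).

Section Spaces.
Variables (K : nzRingType) (N : nat).
Local Notation V := 'cV[K]_N.
Implicit Types (Q : set V) (B : V -> V -> K) (J : V -> V) (c t : K -> K).

Definition rscale (v : V) (a : K) : V := v *m (a%:M : 'M_1).

Definition subspace Q :=
  [/\ Q 0, forall v w, Q v -> Q w -> Q (v + w) &
      forall v a, Q v -> Q (rscale v a)].

(* The columns of A form a basis of Q. *)
Definition has_dim m Q := exists2 A : 'M[K]_(N, m),
  (forall x : 'cV_m, A *m x = 0 -> x = 0) & Q = [set A *m x | x in setT].

Definition direct_decomp Q1 Q2 :=
  [/\ subspace Q1, subspace Q2, Q1 `&` Q2 = [set 0] &
      forall v, exists v1 v2, [/\ Q1 v1, Q2 v2 & v = v1 + v2]].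

(* c is the identity for the bilinear types and the conjugation of K for the
   sesquilinear ones; the sign is +1 (symmetric, hermitian) or -1
   (skew-symmetric, antihermitian). *)
Record form_type := FormType { ft_conj : K -> K; ft_sign : int }.
Implicit Type F : form_type.

Definition is_form F B :=
  [/\ forall u v w, B (u + v) w = B u w + B v w /\ B w (u + v) = B w u + B w v,
      forall v w a, B (rscale v a) w = B v w * a /\
                    B v (rscale w a) = ft_conj F a * B v w,
      forall v w, B v w = ft_conj F (B w v) *~ ft_sign F &
      forall v, (forall w, B v w = 0) -> v = 0].

Definition isotropic B Q := forall v w, Q v -> Q w -> B v w = 0.

Definition max_isotropic B Q :=
  [/\ subspace Q, isotropic B Q &
      forall Q', subspace Q' -> isotropic B Q' -> Q `<=` Q' -> Q' = Q].

Definition split_form B :=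
  exists Q m, [/\ has_dim m Q, isotropic B Q & (2 * m)%N = N].

Definition orthogonal_complement B Q := [set w | forall v, Q v -> B v w = 0].

(* t is the identity for a linear J and the conjugation for an antilinear J. *)
Definition semiinvolution t (e : int) J :=
  [/\ forall v w, J (v + w) = J v + J w,
      forall v a, J (rscale v a) = rscale (J v) (t a) &
      forall v, J (J v) = v *~ e].

Definition split_semiinvolution J := exists Q, direct_decomp Q (J @` Q).

Definition consistent t (mu : int) B J :=
  forall v w, B (J v) (J w) = t (B v w) *~ mu.

Definition managing_form B J v w := B v (J w).

Definition split_pair B J :=
  exists2 Q, isotropic B Q & direct_decomp Q (J @` Q).

Definition GL_set := [set g : 'M[K]_N | exists h, g * h = 1 /\ h * g = 1].

Lemma GL_group : is_ugroup GL_set.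
Proof.
split.
- by exists 1; rewrite mulr1.
- move=> x y [x' [xx' x'x]] [y' [yy' y'y]]; exists (y' * x').
  split; first by rewrite -mulrA (mulrA y) yy' mul1r.
  by rewrite -mulrA (mulrA x') x'x mul1r.
- by move=> x [y [xy yx]]; exists y => //; exists x.
Qed.

Definition GL : ugroup 'M[K]_N := UGroup GL_group.

Definition U_set B :=
  [set g : 'M[K]_N | ug_set GL g /\ forall v w, B (g *m v) (g *m w) = B v w].

Lemma U_group B : is_ugroup (U_set B).
Proof.
split.
- by split=> [|v w]; [exact: ug1|rewrite !mul1mx].
- move=> x y [xG xB] [yG yB]; split=> [|v w]; first exact: ugM.
  by rewrite -!mulmxA xB yB.
- move=> x [/ugV[y yG [xy yx]] xB]; exists y => //; split=> // v w.
  by rewrite -xB !mulmxA (_ : x *m y = 1%:M) // !mul1mx.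
Qed.

Definition Ugroup B : ugroup 'M[K]_N := UGroup (U_group B).

Definition centralizer_set (G : ugroup 'M[K]_N) J :=
  [set g | ug_set G g /\ forall v, g *m J v = J (g *m v)].

Lemma centralizer_group (G : ugroup 'M[K]_N) J :
  is_ugroup (centralizer_set G J).
Proof.
split.
- by split=> [|v]; [exact: ug1|rewrite !mul1mx].
- move=> x y [xG xJ] [yG yJ]; split=> [|v]; first exact: ugM.
  by rewrite -!mulmxA yJ xJ.
- move=> x [/ugV[y yG [xy yx]] xJ]; exists y => //; split=> // v.
  have xyE : x *m y = 1%:M by [].
  have yxE : y *m x = 1%:M by [].
  by rewrite -{1}[v]mul1mx -xyE -mulmxA -xJ mulmxA yxE mul1mx.
Qed.

Definition centralizer (G : ugroup 'M[K]_N) J : ugroup 'M[K]_N :=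
  UGroup (centralizer_group G J).

Definition act (g : 'M[K]_N) (x : set V * set V) : set V * set V :=
  ([set g *m v | v in x.1], [set g *m v | v in x.2]).

Implicit Types (G : ugroup 'M[K]_N) (S : set (set V * set V)).

Definition orbit G x := [set act g x | g in G].

Definition stabilizer G x := [set g | ug_set G g /\ act g x = x].

Definition left_cosets G (H : set 'M[K]_N) : set (set 'M[K]_N) :=
  [set [set g * h | h in H] | g in G].

Definition homogeneous_quotient G S (R2 : pzRingType) (H : ugroup R2) :=
  exists H' : ugroup 'M[K]_N, [/\ H' `<=` G, isomorphic H' H &
    exists2 f : set 'M[K]_N -> set V * set V, set_bij (left_cosets G H') S f &
      forall g C, ug_set G g -> left_cosets G H' C ->
        f [set g * h | h in C] = act g (f C)].

Definition symmetric_space G S := forall x, S x ->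
  exists2 s, involutive_automorphism G s &
    stabilizer G x = [set g | ug_set G g /\ s g = g].

Definition transitive_family G S
    (R1 R2 : pzRingType) (G0 : ugroup R1) (H : ugroup R2) :=
  [/\ isomorphic G G0,
      exists2 x, S x & S = orbit G x,
      forall x, S x -> isomorphic (stabilizer G x) H,
      homogeneous_quotient G S H &
      symmetric_space G S].

Definition orbits_family G S
    (I : finType) (R1 : pzRingType) (R2 : I -> pzRingType)
    (G0 : ugroup R1) (H : forall i, ugroup (R2 i)) :=
  [/\ isomorphic G G0,
      exists O : I -> set (set V * set V),
        [/\ forall i, exists x, O i = orbit G x,
            trivIset setT O,
            S = \bigcup_i O i &
            forall i, homogeneous_quotient G (O i) (H i)] &
      symmetric_space G S].

Definition S_BJ B J : set (set V * set V) :=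
  [set x | [/\ max_isotropic B x.1, max_isotropic B x.2,
               direct_decomp x.1 x.2 & J @` x.1 = x.2]].

Definition S_B B : set (set V * set V) :=
  [set x | [/\ max_isotropic B x.1, max_isotropic B x.2 &
               direct_decomp x.1 x.2]].

Definition S_J J : set (set V * set V) :=
  [set x | direct_decomp x.1 x.2 /\ J @` x.1 = x.2].

Definition S_D (D : V -> V -> K) m : set (set V * set V) :=
  [set x | [/\ has_dim m x.1, direct_decomp x.1 x.2 &
               x.2 = orthogonal_complement D x.1]].

Definition S_dims p q : set (set V * set V) :=
  [set x | [/\ has_dim p x.1, has_dim q x.2 & direct_decomp x.1 x.2]].

End Spaces.

Arguments FormType {K}.

Definition gram_form (K : nzRingType) N (c : K -> K) (M : 'M[K]_N)
    (v w : 'cV[K]_N) : K := ((map_mx c w)^T *m M *m v) 0 0.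

Definition Ipq (K : nzRingType) p q : 'M[K]_(p + q) :=
  block_mx 1%:M 0 0 (- 1%:M).

(* V has a basis in which the matrix of D is diagonal with p entries 1 and
   q entries -1. *)
Definition has_inertia (K : nzRingType) N (c : K -> K)
    (D : 'cV[K]_N -> 'cV[K]_N -> K) p q :=
  exists2 A : 'M[K]_(N, p + q), bijective (fun x : 'cV_(p + q) => A *m x) &
    forall x y, D (A *m x) (A *m y) = gram_form c (Ipq K p q) x y.

(* Sp K n is the symplectic group Sp(2n, K). *)
Definition Sp (K : nzRingType) n :=
  Ugroup (gram_form id (block_mx 0 (- 1%:M) 1%:M 0 : 'M[K]_(n + n))).

Section Classical.
Variable R : realType.

Definition Opq p q := Ugroup (gram_form id (Ipq R p q)).
Definition OC n := Ugroup (gram_form id (1%:M : 'M[R[i]]_n)).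
Definition Upq p q := Ugroup (gram_form (@conjc R) (Ipq R[i] p q)).
Definition Sppq p q := Ugroup (gram_form (@conjq R) (Ipq (quat R) p q)).
(* SOstar n is SO^*(2n), acting on H^n. *)
Definition SOstar n :=
  Ugroup (gram_form (@conjq R) ((quat_i R)%:M : 'M[quat R]_n)).

End Classical.

Definition sym_form (K : nzRingType) : form_type K := FormType id 1.
Definition skew_form (K : nzRingType) : form_type K := FormType id (-1).
Definition herm_formC (R : realType) : form_type R[i] :=
  FormType (@conjc R) 1.
Definition herm_formH (R : realType) : form_type (quat R) :=
  FormType (@conjq R) 1.
Definition antiherm_formH (R : realType) : form_type (quat R) :=
  FormType (@conjq R) (-1).

Section Lists.
Variables (K : nzRingType) (N : nat).
Local Notation V := 'cV[K]_N.
Implicit Types (F : form_type K) (t c : K -> K) (e mu : int).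
Implicit Types (B D : V -> V -> K) (J : V -> V).

Definition pair_of_type F t e mu B J :=
  [/\ is_form F B, semiinvolution t e J, consistent t mu B J &
      split_pair B J].

Definition list1 F t e mu
    (R1 R2 : pzRingType) (G : ugroup R1) (H : ugroup R2) :=
  forall B J, pair_of_type F t e mu B J ->
  transitive_family (centralizer (Ugroup B) J) (S_BJ B J) G H.

(* c is the conjugation for which the managing form is symmetric or
   hermitian; it may differ from the one attached to B. *)
Definition list1_inertia F t e mu c p q
    (R1 R2 : pzRingType) (G : ugroup R1) (H : ugroup R2) :=
  forall B J, pair_of_type F t e mu B J ->
  has_inertia c (managing_form B J) (2 * p) (2 * q) ->
  transitive_family (centralizer (Ugroup B) J) (S_BJ B J) G H.

Definition list1_star F t e mu
    (R1 : pzRingType) (I : finType) (R2 : I -> pzRingType)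
    (G : ugroup R1) (H : forall i, ugroup (R2 i)) :=
  forall B J, pair_of_type F t e mu B J ->
  orbits_family (centralizer (Ugroup B) J) (S_BJ B J) G H.

Definition list2 F (R1 R2 : pzRingType) (G : ugroup R1) (H : ugroup R2) :=
  forall B, is_form F B -> split_form B ->
  transitive_family (Ugroup B) (S_B B) G H.

Definition list3 t e
    (R1 R2 : pzRingType) (G : ugroup R1) (H : ugroup R2) :=
  forall J, semiinvolution t e J -> split_semiinvolution J ->
  transitive_family (centralizer (GL K N) J) (S_J J) G H.

Definition list4 F m (R1 R2 : pzRingType) (G : ugroup R1) (H : ugroup R2) :=
  forall D, is_form F D -> transitive_family (Ugroup D) (S_D D m) G H.

Definition list4_star F p q m
    (R1 : pzRingType) (I : finType) (R2 : I -> pzRingType)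
    (G : ugroup R1) (H : forall i, ugroup (R2 i)) :=
  forall D, is_form F D -> has_inertia (ft_conj F) D p q ->
  orbits_family (Ugroup D) (S_D D m) G H.

Definition list5 p q
    (R1 R2 : pzRingType) (G : ugroup R1) (H : ugroup R2) :=
  transitive_family (GL K N) (S_dims p q) G H.

End Lists.

Arguments list1 {K} N F t e mu {R1 R2} G H.
Arguments list1_inertia {K} N F t e mu c p q {R1 R2} G H.
Arguments list1_star {K} N F t e mu {R1 I R2} G H.
Arguments list2 {K} N F {R1 R2} G H.
Arguments list3 K N t e {R1 R2} G H.
Arguments list4 {K} N F m {R1 R2} G H.
Arguments list4_star {K} N F p q m {R1 I R2} G H.
Arguments list5 K N p q {R1 R2} G H.

(* The pairs (r, s) with r <= p, s <= q and r + s = m. *)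
Definition inertia_index p q m :=
  {x : 'I_p.+1 * 'I_q.+1 | (x.1 + x.2 == m)%N}.
Definition ii_r p q m (x : inertia_index p q m) : nat := (val x).1.
Definition ii_s p q m (x : inertia_index p q m) : nat := (val x).2.

(* Main.v *)
Require Import Defs.
From mathcomp Require Import all_boot all_order all_algebra.
From mathcomp Require Import complex.
From mathcomp Require Import boolp classical_sets functions reals.
From mathcomp Require Import ring lra zify.

(* Encode a pair (Q1, Q2) by a frame: an invertible matrix P = (A, B) whose two blocks of
   columns span Q1 and Q2. Pulling the form and the semiinvolution back along P gives a Gram
   matrix S and a matrix Z, and G acts simply transitively on the frames with prescribed
   (S, Z). Orbits are thus the possible (S, Z) up to block-diagonal changes of basis, the
   stabilizer is the block-diagonal automorphism group of (S, Z), and sigma is conjugation by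
   the operator equal to 1 on Q1 and -1 on Q2, which changes B and J at most by a sign.
   In List 1 a frame is (A, J A) with A a basis of an isotropic Q, and S, Z depend only on
   the Gram matrix M0 of the managing form D on Q, a form of type (c t, eps e mu): transitivity
   is the classification of such forms over the division rings R, C, H, and in the starred
   rows replacing a column a of A by J a flips the sign of D(a, a), so all signatures occur.
   The group G is identified by its ring of operators commuting with J, which is
   K * K, or a matrix ring over a quadratic extension of K (real matrices embed in complex
   ones, complex in quaternionic), or the fixed matrix ring of a real structure. *)

Set Implicit Arguments.
Unset Strict Implicit.
Unset Printing Implicit Defensive.

Import Order.TTheory GRing.Theory Num.Theory.

Local Open Scope classical_set_scope.
Local Open Scope ring_scope.

(** Over H there is no determinant, so every dimension count rests on one elimination fact: a matrix
    with more columns than rows kills a nonzero vector. An absent form is encoded as M = 0 and an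
    absent semiinvolution as J = 1, which lets a single notion of frame serve every list. The rows
    of List 1 are separated by the sign that J induces on D: if D has Gram matrix M0 on Q, it has
    [map_mx t M0 *~ mu] on J Q. Where this is -M0 for diagonal M0 (starred rows), D is balanced on V
    whatever its signature on Q, so D cannot tell the orbits apart. Where it is +M0 (rows with (p,
    q)), inertia (2p, 2q) on V forces (p, q) on every admissible Q, hence transitivity. In the other
    rows D is skew-symmetric, complex symmetric or quaternionic antihermitian, and such forms are
    all equivalent in a given dimension. G is determined by (B, J) and not by the frame, so it is
    identified in the frame with the simplest M0 only. *)

Definition skewfield (K : nzRingType) :=
  forall x : K, x != 0 -> exists y, y * x = 1 /\ x * y = 1.

Definition no_2torsion (K : nzRingType) := forall x : K, x + x = 0 -> x = 0.

(** * Linear algebra of columns over a division ring that need not commute *)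

Section LinearAlgebra.
Variable K : nzRingType.

Definition injmx m n (A : 'M[K]_(m, n)) := forall x : 'cV_n, A *m x = 0 -> x = 0.

Definition is_iso m n (A : 'M[K]_(m, n)) :=
  exists A' : 'M[K]_(n, m), A' *m A = 1%:M /\ A *m A' = 1%:M.

Definition range_mx m n (A : 'M[K]_(m, n)) : set 'cV[K]_m :=
  [set A *m x | x in setT].

Lemma mem_range_mx m n (A : 'M[K]_(m, n)) x : range_mx A (A *m x).
Proof. by exists x. Qed.

Lemma is_iso1 n : is_iso (1%:M : 'M[K]_n).
Proof. by exists 1%:M; rewrite !mulmx1. Qed.

Lemma is_isoM m n p (A : 'M[K]_(m, n)) (B : 'M[K]_(n, p)) :
  is_iso A -> is_iso B -> is_iso (A *m B).
Proof.
move=> [A' [A'A AA']] [B' [B'B BB']]; exists (B' *m A'); split.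
  by rewrite mulmxA -(mulmxA B') A'A mulmx1.
by rewrite mulmxA -(mulmxA A) BB' mulmx1.
Qed.

Lemma is_iso_inj m n (A : 'M[K]_(m, n)) : is_iso A -> injmx A.
Proof.
by move=> [A' [A'A _]] x Ax0; rewrite -(mul1mx x) -A'A -mulmxA Ax0 mulmx0.
Qed.

Lemma injmx_mull m n p (A : 'M[K]_(m, n)) (B : 'M[K]_(p, m)) :
  injmx (B *m A) -> injmx A.
Proof. by move=> BA x Ax0; apply: BA; rewrite -mulmxA Ax0 mulmx0. Qed.

Lemma injmxM m n p (A : 'M[K]_(m, n)) (B : 'M[K]_(n, p)) :
  injmx A -> injmx B -> injmx (A *m B).
Proof. by move=> iA iB x; rewrite -mulmxA => /iA/iB. Qed.

Lemma injmx_mx m n p (A : 'M[K]_(m, n)) (X : 'M[K]_(n, p)) :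
  injmx A -> A *m X = 0 -> X = 0.
Proof.
move=> iA AX0; apply/matrixP => i j; rewrite !mxE.
have /matrixP/(_ i 0) : col j X = 0 by apply: iA; rewrite colE mulmxA AX0 mul0mx.
by rewrite !mxE.
Qed.

Lemma col_mx_eq (m n : nat) (A B : 'M[K]_(m, n)) :
  (forall j, col j A = col j B) -> A = B.
Proof. by move=> h; apply/matrixP => i j; move/matrixP/(_ i 0): (h j); rewrite !mxE. Qed.

Lemma mulmx_ext m n (A B : 'M[K]_(m, n)) :
  (forall x : 'cV_n, A *m x = B *m x) -> A = B.
Proof. by move=> h; apply: col_mx_eq => j; rewrite !colE h. Qed.

Lemma range_factor m n p (A : 'M[K]_(m, n)) (X : 'M[K]_(m, p)) :
  (forall j, range_mx A (col j X)) -> exists U, X = A *m U.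
Proof.
move=> h.
have /choice [u Hu] : forall j, exists x, A *m x = col j X.
  by move=> j; have [x _ e] := h j; exists x.
exists (\matrix_(i, j) u j i 0); apply: col_mx_eq => j.
rewrite -Hu !colE -mulmxA; congr (_ *m _); rewrite -colE.
by apply/colP => i; rewrite !mxE.
Qed.

Lemma range_mul_sub m n p (A : 'M[K]_(m, n)) (U : 'M[K]_(n, p)) :
  range_mx (A *m U) `<=` range_mx A.
Proof. by move=> _ [x _ <-]; exists (U *m x) => //; rewrite mulmxA. Qed.

Lemma range_mul_iso m n p (A : 'M[K]_(m, n)) (U : 'M[K]_(n, p)) :
  is_iso U -> range_mx (A *m U) = range_mx A.
Proof.
move=> [U' [U'U UU']]; apply/seteqP; split; first exact: range_mul_sub.
by rewrite -{1}(mulmx1 A) -UU' mulmxA; exact: range_mul_sub.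
Qed.

Lemma range_eq_factor m n p (A : 'M[K]_(m, n)) (B : 'M[K]_(m, p)) :
  injmx A -> injmx B -> range_mx A = range_mx B ->
  exists2 U, B = A *m U & is_iso U.
Proof.
move=> iA iB AB.
have [j|U BU] := @range_factor _ _ _ A B.
  by rewrite AB; exists (delta_mx j 0) => //; rewrite colE.
have [j|W AW] := @range_factor _ _ _ B A.
  by rewrite -AB; exists (delta_mx j 0) => //; rewrite colE.
exists U => //; exists W; split.
  apply/eqP; rewrite -subr_eq0; apply/eqP; apply: (injmx_mx iB).
  by rewrite mulmxBr mulmxA -AW -BU mulmx1 subrr.
apply/eqP; rewrite -subr_eq0; apply/eqP; apply: (injmx_mx iA).
by rewrite mulmxBr mulmxA -BU -AW mulmx1 subrr.
Qed.

Lemma rscaleE N (v : 'cV[K]_N) a i : rscale v a i 0 = v i 0 * a.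
Proof. by rewrite /rscale mxE big_ord1 !mxE eqxx mulr1n. Qed.

Lemma subspace_range m n (A : 'M[K]_(m, n)) : subspace (range_mx A).
Proof.
split; first by exists 0 => //; rewrite mulmx0.
  by move=> _ _ [x _ <-] [y _ <-]; exists (x + y); rewrite // mulmxDr.
by move=> _ a [x _ <-]; exists (rscale x a); rewrite // /rscale mulmxA.
Qed.

Lemma subspace_mul N n (A : 'M[K]_(N, n)) (Q : set 'cV[K]_N) (x : 'cV_n) :
  subspace Q -> (forall j, Q (col j A)) -> Q (A *m x).
Proof.
move=> [Q0 QD QZ] QA.
have -> : A *m x = \sum_j rscale (col j A) (x j 0).
  apply/colP => i; rewrite summxE mxE; apply: eq_bigr => j _.
  by rewrite rscaleE mxE.
by elim/big_ind: _ => // j _; exact: QZ.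
Qed.

Lemma range_mx_sub N n (A : 'M[K]_(N, n)) (Q : set 'cV[K]_N) :
  subspace Q -> (forall j, Q (col j A)) -> range_mx A `<=` Q.
Proof. by move=> sQ QA _ [x _ <-]; exact: subspace_mul. Qed.

Lemma subspaceN N (Q : set 'cV[K]_N) v : subspace Q -> Q v -> Q (- v).
Proof.
move=> [_ _ QZ] /(QZ _ (-1)); congr (Q _).
by apply/colP => i; rewrite rscaleE mxE mulrN1.
Qed.

Lemma direct_decomp_rangeP N a b (A : 'M[K]_(N, a)) (B : 'M[K]_(N, b)) :
  injmx A -> injmx B -> direct_decomp (range_mx A) (range_mx B) ->
  is_iso (row_mx A B).
Proof.
move=> iA iB [_ _ AB sp].
have inj : injmx (row_mx A B).
  move=> x; rewrite -(vsubmxK x) mul_row_col => e.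
  have e' : A *m usubmx x = B *m (- dsubmx x).
    by rewrite mulmxN; apply/eqP; rewrite -subr_eq0 opprK e.
  have : (range_mx A `&` range_mx B) (A *m usubmx x).
    by split; [exists (usubmx x)|exists (- dsubmx x)].
  rewrite AB /= => Ax0; rewrite (iA _ Ax0).
  move: e'; rewrite Ax0 => /esym/iB/eqP; rewrite oppr_eq0 => /eqP ->.
  by rewrite col_mx0.
have [j|U e] := @range_factor _ _ _ (row_mx A B) 1%:M.
  have [v1 [v2 [[x _ <-] [y _ <-] ->]]] := sp (col j 1%:M).
  by exists (col_mx x y) => //; rewrite mul_row_col.
exists U; split=> //.
apply/eqP; rewrite -subr_eq0; apply/eqP; apply: (injmx_mx inj).
by rewrite mulmxBr mulmxA -e mulmx1 mul1mx subrr.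
Qed.

Lemma range_direct_decomp N a b (P : 'M[K]_(N, a + b)) :
  is_iso P -> direct_decomp (range_mx (lsubmx P)) (range_mx (rsubmx P)).
Proof.
move=> isoP; have := is_iso_inj isoP; rewrite -{1}(hsubmxK P) => inj.
have [P' [P'P PP']] := isoP.
split; try exact: subspace_range.
  apply/seteqP; split; last first.
    by move=> _ ->; split; exists 0 => //; rewrite mulmx0.
  move=> _ [[x _ <-] [y _ e]] /=.
  have : row_mx (lsubmx P) (rsubmx P) *m col_mx x (- y) = 0.
    by rewrite mul_row_col mulmxN e subrr.
  by move/inj/eqP; rewrite col_mx_eq0 => /andP[/eqP -> _]; rewrite mulmx0.
move=> v; exists (lsubmx P *m usubmx (P' *m v)), (rsubmx P *m dsubmx (P' *m v)).
split; [by eexists|by eexists|].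
by rewrite -mul_row_col hsubmxK vsubmxK mulmxA PP' mul1mx.
Qed.

Lemma injmx_lsub N a b (P : 'M[K]_(N, a + b)) : injmx P -> injmx (lsubmx P).
Proof.
move=> iP x Ax0; have : P *m col_mx x 0 = 0.
  by rewrite -(hsubmxK P) mul_row_col Ax0 mulmx0 addr0.
by move/iP/eqP; rewrite col_mx_eq0 => /andP[/eqP].
Qed.

Lemma injmx_rsub N a b (P : 'M[K]_(N, a + b)) : injmx P -> injmx (rsubmx P).
Proof.
move=> iP x Ax0; have : P *m col_mx 0 x = 0.
  by rewrite -(hsubmxK P) mul_row_col Ax0 mulmx0 addr0.
by move/iP/eqP; rewrite col_mx_eq0 => /andP[_ /eqP].
Qed.

Lemma is_iso_block_diag a a' b b' (u : 'M[K]_(a, a')) (v : 'M[K]_(b, b')) :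
  is_iso (block_mx u 0 0 v) <-> is_iso u /\ is_iso v.
Proof.
split=> [[D [DE ED]]|[[u' [u'u uu']] [v' [v'v vv']]]]; last first.
  exists (block_mx u' 0 0 v'); rewrite !mulmx_block !(mul0mx, mulmx0, addr0, add0r).
  by rewrite u'u uu' v'v vv' -!scalar_mx_block.
move: DE ED; rewrite -(submxK D) !mulmx_block !(mul0mx, mulmx0, addr0, add0r).
rewrite !scalar_mx_block => /eq_block_mx [e1 _ _ e2] /eq_block_mx [e3 _ _ e4].
by split; eexists; split; eassumption.
Qed.

Hypothesis Kdiv : skewfield K.

(** Solves one linear equation: if [r 0 j * b = 1], the columns e_k - e_j (b r_k) for k different
    from j are killed by r, and their coordinates away from j show that they are independent. For r
    = 0 the choice b = 0 gives plain basis vectors. *)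
Lemma ex_annihilator n (r : 'rV[K]_n.+1) :
  exists2 P : 'M[K]_(n.+1, n), injmx P & r *m P = 0.
Proof.
have [j [b rb]] : exists j b, r = 0 \/ r 0 j * b = 1.
  have [->|r0] := eqVneq r 0; first by exists ord0, 0; left.
  have [j rj] : exists j, r 0 j != 0.
    apply/existsP; apply: contraNT r0; rewrite negb_exists => /forallP h.
    by apply/eqP/rowP => j; rewrite mxE; apply/eqP; move: (h j); rewrite negbK.
  by have [b [_ rb]] := Kdiv rj; exists j, b; right.
pose P : 'M[K]_(n.+1, n) := \matrix_(i, k)
   if i == lift j k then 1 else if i == j then - (b * r 0 (lift j k)) else 0.
have PE k l : P (lift j k) l = (k == l)%:R.
  by rewrite mxE (inj_eq lift_inj) [_ == j]eq_sym (negPf (neq_lift j k)); case: eqP.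
exists P.
  move=> x Px0; apply/colP => k; rewrite mxE.
  move/colP/(_ (lift j k)): Px0; rewrite !mxE => <-.
  rewrite (bigD1 k) //= PE eqxx mul1r big1 ?addr0 // => l lk.
  by rewrite PE eq_sym (negPf lk) mul0r.
case: rb => [->|rb]; first by rewrite mul0mx.
apply/rowP => k; rewrite !mxE (bigD1_ord j) //= {1}/P mxE.
rewrite (negPf (neq_lift j k)) eqxx mulrN mulrA rb mul1r.
rewrite (bigD1 k) //= PE eqxx mulr1 big1 ?addr0 ?addNr // => l lk.
by rewrite PE (negPf lk) mulr0.
Qed.

(** Elimination by induction on the rows: restricting to the annihilator of the first row removes
    one row and one column. All later dimension arguments come from here. *)
Lemma wide_kernel m n (A : 'M[K]_(m, n)) :
  (m < n)%N -> exists2 x : 'cV[K]_n, x != 0 & A *m x = 0.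
Proof.
elim: m n A => [|m IH] [|n] A // mn.
  exists (const_mx 1); last by apply/colP => -[].
  by apply/eqP => /colP/(_ ord0)/eqP; rewrite !mxE oner_eq0.
pose A1 : 'M_(1 + m, n.+1) := A.
have [P iP AP] := ex_annihilator (usubmx A1).
have [y y0 Ay] := IH n (dsubmx A1 *m P) mn.
exists (P *m y); first by apply: contra_neq y0 => /iP.
suff: A1 *m (P *m y) = 0 by [].
by rewrite -(vsubmxK A1) mul_col_mx !mulmxA AP Ay mul0mx col_mx0.
Qed.

Lemma injmx_leq m n (A : 'M[K]_(m, n)) : injmx A -> (n <= m)%N.
Proof.
move=> iA; rewrite leqNgt; apply/negP => /(wide_kernel A)[x x0 /iA xe].
by rewrite xe eqxx in x0.
Qed.

Lemma is_iso_dim m n (A : 'M[K]_(m, n)) : is_iso A -> m = n.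
Proof.
move=> isoA; apply/eqP; rewrite eqn_leq (injmx_leq (is_iso_inj isoA)) andbT.
by have [A' [? ?]] := isoA; apply: (@injmx_leq _ _ A'); apply: is_iso_inj; exists A.
Qed.

Lemma injmx_row N n (A : 'M[K]_(N, n)) (v : 'cV_N) :
  injmx A -> ~ range_mx A v -> injmx (row_mx A v).
Proof.
move=> iA nv x; rewrite -(vsubmxK x) mul_row_col.
set y := dsubmx x; rewrite (mx11_scalar y) => e.
have [y0|y0] := eqVneq (y 0 0) 0.
  by move: e; rewrite y0 raddf0 mulmx0 addr0 => /iA ->; rewrite col_mx0.
case: nv; have [b [_ yb]] := Kdiv y0.
exists (- (usubmx x *m b%:M)) => //.
rewrite mulmxN mulmxA; apply/eqP; rewrite eq_sym -subr_eq0 opprK addrC.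
have -> : v = v *m (y 0 0)%:M *m b%:M.
  by rewrite -mulmxA -scalar_mxM yb mulmx1.
by rewrite -mulmxDl e mul0mx.
Qed.

(** A vector outside the range could be adjoined as a further independent column, giving n + 1
    independent columns of height m <= n. *)
Lemma injmx_iso m n (A : 'M[K]_(m, n)) : injmx A -> (m <= n)%N -> is_iso A.
Proof.
move=> iA mn.
have surj v : range_mx A v.
  apply: contrapT => /(injmx_row iA)/injmx_leq.
  by rewrite addn1 => /leq_trans/(_ mn); rewrite ltnn.
have [j|U e] := @range_factor _ _ _ A 1%:M; first exact: surj.
exists U; split=> //.
apply/eqP; rewrite -subr_eq0; apply/eqP; apply: (injmx_mx iA).
by rewrite mulmxBr mulmxA -e mulmx1 mul1mx subrr.
Qed.

Lemma subspace_basis N (Q : set 'cV[K]_N) : subspace Q ->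
  exists m (A : 'M[K]_(N, m)), injmx A /\ Q = range_mx A.
Proof.
move=> sQ.
(* [d] counts the columns that can still be adjoined; at d = 0 the independent system is square,
   hence already spans everything. *)
have ext d m (A : 'M[K]_(N, m)) : N = (m + d)%N -> injmx A ->
    (forall j, Q (col j A)) -> exists m (A : 'M[K]_(N, m)), injmx A /\ Q = range_mx A.
  elim: d m A => [|d IH] m A Nm iA QA.
    exists m, A; split=> //; apply/seteqP; split=> [v _|]; last exact: range_mx_sub.
    have [|A' [_ AA']] := injmx_iso iA; first by rewrite Nm addn0.
    by exists (A' *m v) => //; rewrite mulmxA AA' mul1mx.
  have [e|] := pselect (Q `<=` range_mx A).
    by exists m, A; split=> //; apply/seteqP; split=> //; exact: range_mx_sub.
  move=> /existsNP [v /not_implyP [Qv nv]].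
  apply: (IH _ (row_mx A v)); first by rewrite Nm addn1 addSnnS.
    exact: injmx_row.
  move=> j; case: (splitP j) => k jk.
    rewrite (_ : j = lshift _ k); last exact: val_inj.
    have -> : col (lshift _ k) (row_mx A v) = col k A; last exact: QA.
    by apply/colP => i; rewrite mxE row_mxEl mxE.
  rewrite (_ : j = rshift _ k); last exact: val_inj.
  have -> // : col (rshift _ k) (row_mx A v) = v.
  by apply/colP => i; rewrite mxE row_mxEr ord1.
by apply: (@ext N 0 (0 : 'M_(N, 0))) => // [x _|[]//]; exact: flatmx0.
Qed.

Lemma direct_decomp_basis N (Q1 Q2 : set 'cV[K]_N) : direct_decomp Q1 Q2 ->
  exists a b (A : 'M[K]_(N, a)) (B : 'M[K]_(N, b)),
    [/\ Q1 = range_mx A, Q2 = range_mx B & is_iso (row_mx A B)].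
Proof.
move=> dd; have [s1 s2 _ _] := dd.
have [a [A [iA eA]]] := subspace_basis s1.
have [b [B [iB eB]]] := subspace_basis s2.
exists a, b, A, B; split=> //.
by apply: direct_decomp_rangeP => //; rewrite -eA -eB.
Qed.

End LinearAlgebra.

(** * Isomorphisms and homogeneous spaces *)

Lemma isomorphicP (R1 R2 : pzRingType) (A : set R1) (B : set R2) :
  isomorphic A B <-> exists f : R1 -> R2,
    [/\ forall x, A x -> B (f x),
        forall x y, A x -> A y -> f x = f y -> x = y,
        forall y, B y -> exists2 x, A x & f x = y &
        forall x y, A x -> A y -> f (x * y) = f x * f y].
Proof.
split=> [[f [f1 f2 f3] fM]|[f [f1 f2 f3 fM]]]; exists f => //.
  by split=> // x y Ax Ay; apply: f2; rewrite inE.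
split=> [x Ax|x y|y By]; [exact: f1| |by have [x] := f3 y By; exists x].
by rewrite !inE => *; exact: f2.
Qed.

Lemma isomorphic_refl (R : pzRingType) (A : set R) : isomorphic A A.
Proof. by apply/isomorphicP; exists id; split=> // y Ay; exists y. Qed.

Lemma isomorphic_sym (R1 R2 : pzRingType) (A : set R1) (B : set R2) :
  (forall x y, A x -> A y -> A (x * y)) -> isomorphic A B -> isomorphic B A.
Proof.
move=> AM /isomorphicP[f [f1 f2 f3 fM]]; apply/isomorphicP.
pose g y := xget 0 [set x | A x /\ f x = y].
have gP y : B y -> A (g y) /\ f (g y) = y.
  by move=> /f3[x Ax fx]; apply: (@xgetPex _ 0 [set x | A x /\ f x = y]); exists x.
exists g; split=> [y /gP[]//|x y /gP[_ ex] /gP[_ ey]|x Ax|x y Bx By].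
- by move=> e; rewrite -ex e ey.
- by exists (f x); [exact: f1|have [? ?] := gP _ (f1 _ Ax); exact: f2].
- have [? ex] := gP _ Bx; have [? ey] := gP _ By.
  have Bxy : B (x * y) by rewrite -ex -ey -fM //; apply/f1/AM.
  have [? exy] := gP _ Bxy; apply: f2 => //; first exact: AM.
  by rewrite exy fM // ex ey.
Qed.

Lemma isomorphic_trans (R1 R2 R3 : pzRingType)
    (A : set R1) (B : set R2) (C : set R3) :
  isomorphic A B -> isomorphic B C -> isomorphic A C.
Proof.
move=> /isomorphicP[f [f1 f2 f3 fM]] /isomorphicP[g [g1 g2 g3 gM]].
apply/isomorphicP; exists (g \o f); split=> [x /f1/g1//|x y Ax Ay e|z Cz|x y Ax Ay].
- by apply: f2 => //; apply: g2 => //; exact: f1.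
- have [y By <-] := g3 z Cz; have [x Ax <-] := f3 y By; by exists x.
- by rewrite /= fM // gM //; exact: f1.
Qed.

Lemma ugroup_eq (R : pzRingType) (G H : ugroup R) :
  ug_set G = ug_set H -> G = H.
Proof.
by case: G H => [G g] [H h] /= e; case: _ / e h => h; rewrite (Prop_irrelevance g h).
Qed.

Section Actions.
Variables (K : nzRingType) (N : nat) (G : ugroup 'M[K]_N).
Implicit Types (x : set 'cV[K]_N * set 'cV[K]_N).

Lemma act1 x : act 1 x = x.
Proof.
case: x => Q1 Q2; congr pair; apply/seteqP; split=> [_ [v Qv <-]|v Qv].
all: by [rewrite mul1mx | exists v => //; rewrite mul1mx].
Qed.

Lemma actM (g h : 'M[K]_N) x : act (g * h) x = act g (act h x).
Proof.
case: x => Q1 Q2; congr pair; apply/seteqP; split=> [_ [v Qv <-]|_ [_ [v Qv <-] <-]].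
all: by [exists (h *m v); [exists v|rewrite mulmxA] | exists v => //; rewrite mulmxA].
Qed.

Lemma stabilizer_is_ugroup x : is_ugroup (stabilizer G x).
Proof.
split; first by split; [exact: ug1|exact: act1].
  by move=> g h [Gg gx] [Gh hx]; split; [exact: ugM|rewrite actM hx gx].
move=> g [Gg gx]; have [h Gh [gh hg]] := ugV Gg.
by exists h => //; split=> //; rewrite -{1}gx -actM hg act1.
Qed.

Lemma orbit_homogeneous x (R2 : pzRingType) (H : ugroup R2) :
  isomorphic (stabilizer G x) H -> homogeneous_quotient G (Defs.orbit G x) H.
Proof.
set St := stabilizer G x => isoSt.
exists (UGroup (stabilizer_is_ugroup x)); split=> [g []//|//|].
(* A coset moves x by any of its elements; [xget] picks one and [fP] shows that the choice does not
   matter. *)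
pose f C := act (xget 1 C) x.
have fP g : f [set g * h | h in St] = act g x.
  have /(xgetPex 1) [h [_ hx] e] : exists y, [set g * h | h in St] y.
    by exists (g * 1), 1 => //; split; [exact: ug1|exact: act1].
  by rewrite /f -e actM hx.
exists f; last first.
  move=> g _ Gg [g' Gg' <-]; rewrite fP -actM -fP; congr f.
  apply/seteqP; split=> [_ [_ [h Sh <-] <-]|_ [h Sh <-]].
    by exists h; rewrite // mulrA.
  by exists (g' * h); [exists h|rewrite mulrA].
split=> [_ [g Gg <-]|C1 C2|_ [g Gg <-]].
- by rewrite fP; exists g.
- rewrite !inE => -[g1 G1 <-] [g2 G2 <-]; rewrite !fP => e.
  have [h2 H2 [gh hg]] := ugV G2.
  have S1 : St (h2 * g1).
    by split; [exact: ugM|rewrite actM e -actM hg act1].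
  have [k [Sk kx] [k1 k2]] := @ugV _ (UGroup (stabilizer_is_ugroup x)) _ S1.
  apply/seteqP; split=> _ [h [Gh hx] <-].
    exists (h2 * g1 * h); last by rewrite !mulrA gh mul1r.
    by split; [apply: ugM => //; case: S1|rewrite actM hx; case: S1].
  exists (k * h); first by split; [exact: ugM|rewrite actM hx].
  have -> : g1 = g2 * (h2 * g1) by rewrite mulrA gh mul1r.
  by rewrite -mulrA (mulrA _ k) k1 mul1r.
- by exists [set g * h | h in St]; [exists g|rewrite fP].
Qed.

End Actions.

(** * Frames *)

(** Products are reversed, as conjugation of H requires. Over a commutative ring the identity
    qualifies, so bilinear and sesquilinear forms are treated at once. *)
Record is_conj (K : nzRingType) (c : K -> K) : Prop := IsConj {
  conjD : {morph c : x y / x + y};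
  conjM : forall x y, c (x * y) = c y * c x;
  conjI : involutive c }.

Record is_aut (K : nzRingType) (t : K -> K) : Prop := IsAut {
  autD : {morph t : x y / x + y};
  autM : {morph t : x y / x * y};
  autI : involutive t }.

Section Additive.
Variables (K L : nzRingType) (f : K -> L).
Hypothesis fD : {morph f : x y / x + y}.

Lemma add0 : f 0 = 0.
Proof. by apply: (addrI (f 0)); rewrite -fD !addr0. Qed.

Lemma addN x : f (- x) = - f x.
Proof. by apply: (addrI (f x)); rewrite -fD !subrr add0. Qed.

Lemma addMz x (n : int) : f (x *~ n) = f x *~ n.
Proof.
have addn y m : f (y *+ m) = f y *+ m.
  by elim: m => [|m IH]; rewrite ?mulr0n ?add0 // !mulrS fD IH.
by case: n => n; rewrite ?NegzE ?mulrNz ?addN -!pmulrn addn.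
Qed.

Lemma add_sum I (r : seq I) (P : pred I) F :
  f (\sum_(i <- r | P i) F i) = \sum_(i <- r | P i) f (F i).
Proof. exact: (big_morph f fD add0). Qed.

Lemma map_mxDf m n (A B : 'M_(m, n)) : map_mx f (A + B) = map_mx f A + map_mx f B.
Proof. by apply/matrixP => i j; rewrite !mxE fD. Qed.

Lemma map_mxNf m n (A : 'M_(m, n)) : map_mx f (- A) = - map_mx f A.
Proof. by apply/matrixP => i j; rewrite !mxE addN. Qed.

Lemma map_mx0f m n : map_mx f (0 : 'M_(m, n)) = 0.
Proof. by apply/matrixP => i j; rewrite !mxE add0. Qed.

Lemma map_mxMzf m n (A : 'M_(m, n)) (e : int) : map_mx f (A *~ e) = map_mx f A *~ e.
Proof.
case: e => e; rewrite ?NegzE ?mulrNz ?map_mxNf -!pmulrn; first by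
  elim: e => [|e IH]; rewrite ?map_mx0f // !mulrS map_mxDf IH.
by congr (- _); elim: e.+1 => [|k IH]; rewrite ?map_mx0f // !mulrS map_mxDf IH.
Qed.
End Additive.

Section Multiplicative.
Variables (K L : nzRingType) (f : K -> L).
Hypothesis fD : {morph f : x y / x + y}.
Hypothesis fM : {morph f : x y / x * y}.
Hypothesis f1 : f 1 = 1.

Lemma map_mxMf m n p (A : 'M_(m, n)) (B : 'M_(n, p)) :
  map_mx f (A *m B) = map_mx f A *m map_mx f B.
Proof.
apply/matrixP => i j; rewrite !mxE (add_sum fD); apply: eq_bigr => k _.
by rewrite fM !mxE.
Qed.

Lemma map_mx_scalarf n a : map_mx f (a%:M : 'M_n) = (f a)%:M.
Proof.
by apply/matrixP => i j; rewrite !mxE; case: (i == j); rewrite ?mulr1n // !mulr0n (add0 fD).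
Qed.

Lemma map_mx1f n : map_mx f (1%:M : 'M_n) = 1%:M.
Proof. by rewrite map_mx_scalarf f1. Qed.

Lemma map_mx_iso m n (A : 'M_(m, n)) : is_iso A -> is_iso (map_mx f A).
Proof.
move=> [A' [A'A AA']]; exists (map_mx f A').
by rewrite -!map_mxMf A'A AA' !map_mx1f.
Qed.
End Multiplicative.

Section ConjAut.
Variables (K : nzRingType) (c t : K -> K).
Hypotheses (cP : is_conj c) (tP : is_aut t).

Lemma conj1 : c 1 = 1.
Proof. by rewrite -[LHS]mulr1 -{2}(conjI cP 1) -(conjM cP) mulr1 (conjI cP). Qed.

Lemma aut1 : t 1 = 1.
Proof. by rewrite -[LHS]mulr1 -{2}(autI tP 1) -(autM tP) mul1r (autI tP). Qed.

Definition adj m n (A : 'M[K]_(m, n)) : 'M[K]_(n, m) := (map_mx c A)^T.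

Lemma adjM m n p (A : 'M_(m, n)) (B : 'M_(n, p)) : adj (A *m B) = adj B *m adj A.
Proof.
apply/matrixP => i j; rewrite !mxE (add_sum (conjD cP)); apply: eq_bigr => k _.
by rewrite (conjM cP) !mxE.
Qed.

Lemma adjD m n (A B : 'M_(m, n)) : adj (A + B) = adj A + adj B.
Proof. by rewrite /adj (map_mxDf (conjD cP)) linearD. Qed.

Lemma adjN m n (A : 'M_(m, n)) : adj (- A) = - adj A.
Proof. by rewrite /adj (map_mxNf (conjD cP)) linearN. Qed.

Lemma adj0 m n : adj (0 : 'M_(m, n)) = 0.
Proof. by rewrite /adj (map_mx0f (conjD cP)) trmx0. Qed.

Lemma adjMz m n (A : 'M_(m, n)) (e : int) : adj (A *~ e) = adj A *~ e.
Proof. by rewrite /adj (map_mxMzf (conjD cP)) raddfMz. Qed.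

Lemma adjK m n (A : 'M_(m, n)) : adj (adj A) = A.
Proof. by apply/matrixP => i j; rewrite !mxE (conjI cP). Qed.

Lemma adj_scalar n a : adj (a%:M : 'M_n) = (c a)%:M.
Proof. by rewrite /adj (map_mx_scalarf (conjD cP)) tr_scalar_mx. Qed.

Lemma adj1 n : adj (1%:M : 'M_n) = 1%:M.
Proof. by rewrite adj_scalar conj1. Qed.

Lemma adj_row m n p (A : 'M_(m, n)) (B : 'M_(m, p)) :
  adj (row_mx A B) = col_mx (adj A) (adj B).
Proof. by rewrite /adj map_row_mx tr_row_mx. Qed.

Lemma adj_col m n p (A : 'M_(m, n)) (B : 'M_(p, n)) :
  adj (col_mx A B) = row_mx (adj A) (adj B).
Proof. by rewrite /adj map_col_mx tr_col_mx. Qed.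

Lemma adj_block m1 m2 n1 n2 (A : 'M_(m1, n1)) (B : 'M_(m1, n2))
    (C : 'M_(m2, n1)) (D : 'M_(m2, n2)) :
  adj (block_mx A B C D) = block_mx (adj A) (adj C) (adj B) (adj D).
Proof. by rewrite /adj map_block_mx tr_block_mx. Qed.

Lemma adj_iso m n (A : 'M_(m, n)) : is_iso A -> is_iso (adj A).
Proof.
by move=> [A' [A'A AA']]; exists (adj A'); rewrite -!adjM A'A AA' !adj1.
Qed.

(** Isomorphisms from the coordinate space with form S and semiinvolution x |-> Z t(x) to the one
    with M and v |-> J t(v). They compose and invert like a groupoid, and the group G is the set of
    automorphisms of (M, J). *)
Definition frames N n (M J : 'M[K]_N) (S Z : 'M[K]_n) : set 'M[K]_(N, n) :=
  [set P | [/\ is_iso P, adj P *m M *m P = S & J *m map_mx t P = P *m Z]].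

Lemma frames1 N (M J : 'M[K]_N) : frames M J M J 1%:M.
Proof.
split; first exact: is_iso1.
  by rewrite adj1 mul1mx mulmx1.
by rewrite (map_mx1f (autD tP) aut1) mul1mx mulmx1.
Qed.

Lemma framesM N n m (M J : 'M[K]_N) (S Z : 'M[K]_n) (S' Z' : 'M[K]_m)
    (P : 'M_(N, n)) (Q : 'M_(n, m)) :
  frames M J S Z P -> frames S Z S' Z' Q -> frames M J S' Z' (P *m Q).
Proof.
move=> [iP PS PZ] [iQ QS QZ]; split; first exact: is_isoM.
  by rewrite adjM -!mulmxA (mulmxA M) (mulmxA (adj P)) (mulmxA (adj P)) PS mulmxA.
by rewrite (map_mxMf (autD tP) (autM tP)) mulmxA PZ -mulmxA QZ mulmxA.
Qed.

Lemma framesV N n (M J : 'M[K]_N) (S Z : 'M[K]_n) (P : 'M_(N, n)) :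
  frames M J S Z P -> exists P', [/\ frames S Z M J P', P' *m P = 1%:M & P *m P' = 1%:M].
Proof.
move=> [[P' [P'P PP']] PS PZ]; exists P'; split=> //; split; first by exists P.
  by rewrite -PS -!mulmxA PP' mulmx1 mulmxA -adjM PP' adj1 mul1mx.
rewrite -[LHS]mul1mx -P'P -mulmxA (mulmxA P) -PZ -mulmxA.
by rewrite -(map_mxMf (autD tP) (autM tP)) PP' (map_mx1f (autD tP) aut1) mulmx1.
Qed.

Lemma frames_conj_isomorphic N n (M J : 'M[K]_N) (S Z : 'M[K]_n) (P : 'M_(N, n)) :
  frames M J S Z P -> isomorphic (frames M J M J) (frames S Z S Z).
Proof.
move=> fP; have [P' [fP' P'P PP']] := framesV fP.
apply/isomorphicP; exists (fun g => P' *m g *m P); split.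
- by move=> g fg; apply: framesM fP; exact: framesM fg.
- have E x : x = P *m (P' *m x *m P) *m P'.
    by rewrite !mulmxA PP' mul1mx -mulmxA PP' mulmx1.
  by move=> g h _ _ e; rewrite (E g) (E h) e.
- move=> g fg; exists (P *m g *m P').
    by apply: framesM fP'; exact: framesM fg.
  by rewrite !mulmxA P'P mul1mx -mulmxA P'P mulmx1.
- move=> g h _ _; rewrite -[(g * h)%R]/(g *m h) -[RHS]/(P' *m g *m P *m (P' *m h *m P)).
  by rewrite !mulmxA -(mulmxA _ P P') PP' mulmx1.
Qed.

End ConjAut.

(** * Orbits, stabilizers and involutions read off from frames *)

Section FrameOrbits.
Variables (K : nzRingType) (c t : K -> K).
Hypotheses (cP : is_conj c) (tP : is_aut t) (K2 : no_2torsion K).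

Definition span_pair N a b (P : 'M[K]_(N, a + b)) : set 'cV[K]_N * set 'cV[K]_N :=
  (range_mx (lsubmx P), range_mx (rsubmx P)).

Lemma act_range N n (g : 'M[K]_N) (A : 'M_(N, n)) :
  [set g *m v | v in range_mx A] = range_mx (g *m A).
Proof.
apply/seteqP; split=> [_ [_ [x _ <-] <-]|_ [x _ <-]].
  by exists x => //; rewrite mulmxA.
by exists (A *m x); [exists x|rewrite mulmxA].
Qed.

Lemma act_span N a b (g : 'M[K]_N) (P : 'M_(N, a + b)) :
  act g (span_pair P) = span_pair (g *m P).
Proof. by rewrite /act /span_pair /= !act_range mulmx_lsub mulmx_rsub. Qed.

Lemma span_mul_diag N a b a' b' (P : 'M[K]_(N, a + b)) (u : 'M_(a, a')) (v : 'M_(b, b')) :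
  is_iso u -> is_iso v -> span_pair (P *m block_mx u 0 0 v) = span_pair P.
Proof.
move=> iu iv; rewrite -{1}(hsubmxK P) mul_row_block !mulmx0 addr0 add0r.
by rewrite /span_pair row_mxKl row_mxKr !range_mul_iso.
Qed.

Lemma span_eq_diag N a b a' b' (P : 'M[K]_(N, a + b)) (P' : 'M_(N, a' + b')) :
  is_iso P -> is_iso P' -> span_pair P = span_pair P' ->
  exists u v, [/\ is_iso u, is_iso v & P' = P *m block_mx u 0 0 v].
Proof.
move=> /is_iso_inj iP /is_iso_inj iP' [e1 e2].
have [u eu iu] := range_eq_factor (injmx_lsub iP) (injmx_lsub iP') e1.
have [v ev iv] := range_eq_factor (injmx_rsub iP) (injmx_rsub iP') e2.
exists u, v; split=> //.
by rewrite -{1}(hsubmxK P) mul_row_block !mulmx0 addr0 add0r -eu -ev hsubmxK.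
Qed.

(** The stabilizer of the two coordinate subspaces inside the automorphism group of (S, Z), recorded
    by its diagonal blocks. *)
Definition blocks a b (S Z : 'M[K]_(a + b)) : set ('M[K]_a * 'M[K]_b)%type :=
  [set uv | frames c t S Z S Z (block_mx uv.1 0 0 uv.2)].

(** Signs are harmless: preserving S is preserving -S, and commuting with Z is commuting with -Z.
    Both occur, S being negated when the two halves are isotropic and Z when J exchanges them. *)
Definition sgn_adapted a b (S Z : 'M[K]_(a + b)) :=
  (Ipq K a b *m S *m Ipq K a b = S \/ Ipq K a b *m S *m Ipq K a b = - S) /\
  (Z *m Ipq K a b = Ipq K a b *m Z \/ Z *m Ipq K a b = - (Ipq K a b *m Z)).

Lemma IpqK a b : Ipq K a b *m Ipq K a b = 1%:M.
Proof.
rewrite /Ipq mulmx_block !(mulmx0, mul0mx, addr0, add0r) mulmx1 mulmxN mulmx1 opprK.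
by rewrite -scalar_mx_block.
Qed.

Lemma Ipq_iso a b : is_iso (Ipq K a b).
Proof. by exists (Ipq K a b); rewrite IpqK. Qed.

Lemma adj_Ipq a b : adj c (Ipq K a b) = Ipq K a b.
Proof. by rewrite /Ipq adj_block !(adj0 cP) (adjN cP) !(adj1 cP). Qed.

Lemma map_Ipq a b : map_mx t (Ipq K a b) = Ipq K a b.
Proof.
by rewrite /Ipq map_block_mx !(map_mx0f (autD tP)) (map_mxNf (autD tP))
  !(map_mx1f (autD tP) (aut1 tP)).
Qed.

Lemma frames_sgn a b (S Z h : 'M[K]_(a + b)) : sgn_adapted S Z ->
  frames c t S Z S Z h -> frames c t S Z S Z (Ipq K a b *m h *m Ipq K a b).
Proof.
set s := Ipq K a b => -[sS sZ] [ih hS hZ].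
have ss X : s *m (s *m X) = X :> 'M_(a + b) by rewrite mulmxA IpqK mul1mx.
split; first by apply: is_isoM (Ipq_iso _ _); apply: is_isoM => //; exact: Ipq_iso.
  rewrite !(adjM cP) adj_Ipq.
  have -> : s *m (adj c h *m s) *m S *m (s *m h *m s) =
            s *m (adj c h *m (s *m S *m s) *m h) *m s by rewrite !mulmxA.
  case: sS => e; rewrite e ?mulmxN ?mulNmx hS ?mulmxN ?mulNmx e //.
  by rewrite opprK.
rewrite !(map_mxMf (autD tP) (autM tP)) map_Ipq !mulmxA.
case: sZ => e; rewrite e.
  by rewrite -(mulmxA s Z) hZ -!mulmxA e.
by rewrite !mulNmx -(mulmxA s Z) hZ -!mulmxA e !mulmxN opprK.
Qed.

Variables (N : nat) (M J : 'M[K]_N) (G : ugroup 'M[K]_N).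
Hypothesis GE : ug_set G = frames c t M J M J.

Section OneOrbit.
Variables (a b : nat) (S Z : 'M[K]_(a + b)) (P : 'M[K]_(N, a + b)).
Hypothesis fP : frames c t M J S Z P.

Lemma orbit_span : [set span_pair Q | Q in frames c t M J S Z] =
  Defs.orbit G (span_pair P).
Proof.
have [P' [fP' P'P PP']] := framesV cP tP fP.
apply/seteqP; split=> [_ [Q fQ <-]|_ [g Gg <-]].
  exists (Q *m P'); first by rewrite GE; exact: framesM fP'.
  by rewrite act_span -mulmxA P'P mulmx1.
rewrite act_span; exists (g *m P) => //.
by apply: framesM fP => //; rewrite -GE.
Qed.

Lemma stabilizer_span_blocks :
  isomorphic (stabilizer G (span_pair P)) (blocks S Z).
Proof.
have [P' [fP' P'P PP']] := framesV cP tP fP.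
have [iP _ _] := fP.
have stabP g : stabilizer G (span_pair P) g ->
    exists u v, [/\ is_iso u, is_iso v & g *m P = P *m block_mx u 0 0 v].
  move=> [Gg]; rewrite act_span => e; apply: span_eq_diag => //.
  by apply: is_isoM => //; move: Gg; rewrite GE => -[].
apply/isomorphicP.
exists (fun g => (ulsubmx (P' *m g *m P), drsubmx (P' *m g *m P))).
have E g u v : g *m P = P *m block_mx u 0 0 v ->
    ((ulsubmx (P' *m g *m P), drsubmx (P' *m g *m P)) = (u, v) :> ('M_a * 'M_b)%type).
  by move=> e; rewrite -mulmxA e mulmxA P'P mul1mx block_mxKul block_mxKdr.
split.
- move=> g Sg; have [u [v [iu iv e]]] := stabP g Sg; rewrite (E _ _ _ e) /blocks /=.
  have -> : block_mx u 0 0 v = P' *m (g *m P) by rewrite e mulmxA P'P mul1mx.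
  by apply: framesM fP' _ => //; apply: framesM fP => //; rewrite -GE; case: Sg.
- move=> g h /stabP[u [v [_ _ e]]] /stabP[u' [v' [_ _ e']]].
  rewrite (E _ _ _ e) (E _ _ _ e') => -[eu ev].
  rewrite -(mulmx1 g) -(mulmx1 h) -PP'.
  by rewrite !mulmxA e e' eu ev.
- move=> [u v] /= fuv; have [iuv _ _] := fuv.
  have [iu iv] := (is_iso_block_diag u v).1 iuv.
  exists (P *m block_mx u 0 0 v *m P').
    split; first by rewrite GE; apply: framesM fP' => //; exact: framesM fuv.
    by rewrite act_span -mulmxA P'P mulmx1 span_mul_diag.
  by apply: E; rewrite -mulmxA P'P mulmx1.
- move=> g h /stabP[u [v [_ _ e]]] /stabP[u' [v' [_ _ e']]].
  rewrite (E _ _ _ e) (E _ _ _ e') (E (g * h) (u *m u') (v *m v')) //.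
  rewrite -[(g * h)%R]/(g *m h) -mulmxA e' mulmxA e -mulmxA mulmx_block.
  by rewrite !(mulmx0, mul0mx, addr0, add0r).
Qed.

Lemma symmetric_span : sgn_adapted S Z ->
  exists2 s, involutive_automorphism G s &
    stabilizer G (span_pair P) = [set g | ug_set G g /\ s g = g].
Proof.
move=> sa; have [P' [fP' P'P PP']] := framesV cP tP fP.
have [iP _ _] := fP.
set I := Ipq K a b.
have II m (X : 'M_(_, m)) : I *m (I *m X) = X by rewrite mulmxA IpqK mul1mx.
have P'PX m (X : 'M_(_, m)) : P' *m (P *m X) = X by rewrite mulmxA P'P mul1mx.
have PP'X m (X : 'M_(_, m)) : P *m (P' *m X) = X by rewrite mulmxA PP' mul1mx.
have inG g : frames c t M J M J g -> frames c t S Z S Z (P' *m (g *m P)).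
  by move=> fg; apply: framesM fP' _ => //; exact: framesM fP.
pose s (g : 'M_N) := P *m (I *m (P' *m (g *m P)) *m I) *m P'.
have sG g : ug_set G g -> ug_set G (s g).
  rewrite GE => fg; apply: framesM fP' => //; apply: framesM fP _ => //.
  exact: frames_sgn (inG _ fg).
have sK : involutive s.
  by move=> g; rewrite /s -!mulmxA !P'PX !II PP' mulmx1 PP'X.
exists s.
  split=> //; last first.
    move=> x y _ _; rewrite /s -[RHS]/(_ *m _) -[(x * y)%R]/(x *m y) -!mulmxA.
    by rewrite !P'PX II PP'X.
  split=> [g|g h _ _ /(can_inj sK)//|g Gg]; first exact: sG.
  by exists (s g); [exact: sG|exact: sK].
have IE (A : 'M_a) B C (D : 'M_b) :
    I *m block_mx A B C D *m I = block_mx A (- B) (- C) D.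
  rewrite /I /Ipq !mulmx_block !(mulmx0, mul0mx, addr0, add0r).
  by rewrite !mul1mx !mulmx1 !mulNmx !mulmxN !mul1mx !mulmx1 opprK.
apply/seteqP; split=> g [Gg e]; split=> //; move: e; rewrite ?act_span => e.
  have ig : is_iso (g *m P) by apply: is_isoM => //; move: Gg; rewrite GE => -[].
  have [u [v [_ _ e']]] := span_eq_diag iP ig (esym e).
  by rewrite /s e' P'PX IE !oppr0 -e' -mulmxA PP' mulmx1.
have gP : P *m (P' *m (g *m P)) = g *m P by rewrite PP'X.
have hh : I *m (P' *m (g *m P)) *m I = P' *m (g *m P).
  by rewrite -[in RHS]e /s -!mulmxA P'P mulmx1 !P'PX.
have ih : is_iso (P' *m (g *m P)).
  by apply: is_isoM; [case: fP'|apply: is_isoM => //; move: Gg; rewrite GE => -[]].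
rewrite -gP; move: ih hh; rewrite -(submxK (P' *m (g *m P))) IE.
move=> ih /eq_block_mx[_ eB eC _].
(* Conjugation by diag(1, -1) negates the off-diagonal blocks, so a fixed element has blocks equal
   to their opposites; these vanish in the absence of 2-torsion, and the element preserves both
   halves. *)
have N0 m n (X : 'M[K]_(m, n)) : - X = X -> X = 0.
  move=> /matrixP NX; apply/matrixP => i j; rewrite mxE; apply: K2.
  by rewrite -{1}NX mxE addNr.
move: ih; rewrite (N0 _ _ _ eB) (N0 _ _ _ eC) => ih.
have [iu iv] := (is_iso_block_diag _ _).1 ih.
by rewrite span_mul_diag.
Qed.

End OneOrbit.

Section Family.
Variables (X : set (set 'cV[K]_N * set 'cV[K]_N)) (I : finType) (a b : I -> nat).
Variables (S Z : forall i, 'M[K]_(a i + b i)).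
Hypothesis X_span : forall x, X x <->
  exists i P, frames c t M J (S i) (Z i) P /\ x = span_pair P.
Hypothesis sa : forall i, sgn_adapted (S i) (Z i).

Lemma frames_symmetric_space : symmetric_space G X.
Proof. by move=> _ /X_span[i [P [fP ->]]]; exact: symmetric_span fP (sa i). Qed.

Lemma frames_orbits_family (R1 : pzRingType) (R2 : I -> pzRingType)
    (G0 : ugroup R1) (H : forall i, ugroup (R2 i)) :
  isomorphic G G0 ->
  (forall i, exists P, frames c t M J (S i) (Z i) P) ->
  (forall i j P P', frames c t M J (S i) (Z i) P -> frames c t M J (S j) (Z j) P' ->
     span_pair P = span_pair P' -> i = j) ->
  (forall i, isomorphic (blocks (S i) (Z i)) (H i)) ->
  orbits_family G X G0 H.
Proof.
move=> GG0 ne disj bH; split=> //; last exact: frames_symmetric_space.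
exists (fun i => [set span_pair P | P in frames c t M J (S i) (Z i)]).
split.
- by move=> i; have [P fP] := ne i; exists (span_pair P); exact: orbit_span.
- move=> i j _ _ [x [[P fP <-] [P' fP' e]]]; exact: disj fP fP' (esym e).
- apply/seteqP; split=> [x /X_span[i [P [fP ->]]]|x [i _ [P fP <-]]].
    by exists i => //; exists P.
  by apply/X_span; exists i, P.
- move=> i; have [P fP] := ne i; rewrite (orbit_span fP).
  apply: orbit_homogeneous; apply: isomorphic_trans (bH i).
  exact: stabilizer_span_blocks.
Qed.

(** The covering of the G-set by frames is phrased with an index type throughout; transitivity is
    the case of a single index. *)
Lemma frames_transitive_family (R1 R2 : pzRingType) (G0 : ugroup R1) (H : ugroup R2) i0 :
  (forall i, i = i0) ->
  isomorphic G G0 ->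
  (exists P, frames c t M J (S i0) (Z i0) P) ->
  isomorphic (blocks (S i0) (Z i0)) H ->
  transitive_family G X G0 H.
Proof.
move=> I1 GG0 [P fP] bH.
have XE : X = Defs.orbit G (span_pair P).
  rewrite -(orbit_span fP); apply/seteqP; split=> [x|_ [Q fQ <-]].
    by move=> /X_span[i [Q [fQ ->]]]; move: Q fQ; rewrite (I1 i) => Q fQ; exists Q.
  by apply/X_span; exists i0, Q.
have stab Q : frames c t M J (S i0) (Z i0) Q -> isomorphic (stabilizer G (span_pair Q)) H.
  by move=> fQ; apply: isomorphic_trans bH; exact: stabilizer_span_blocks.
split=> //.
- by exists (span_pair P) => //; apply/X_span; exists i0, P.
- move=> x /X_span[i [Q [fQ ->]]]; move: Q fQ; rewrite (I1 i) => Q fQ.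
  exact: stab.
- by rewrite XE; apply: orbit_homogeneous; exact: stab.
- exact: frames_symmetric_space.
Qed.

End Family.
End FrameOrbits.

(** * Classification of forms *)

Definition Spmx (K : nzRingType) n : 'M[K]_(n + n) := block_mx 0 (- 1%:M) 1%:M 0.

(** A sum of norms [c x * x] vanishes only trivially. This holds for the identity on R and for
    conjugation on C and H, and fails for the identity on C; it is what makes a signature an
    invariant. *)
Definition definite (K : nzRingType) (c : K -> K) :=
  forall n (x : 'cV[K]_n), adj c x *m x = 0 -> x = 0.

Lemma mulmxMzl (K : nzRingType) m n p (A : 'M[K]_(m, n)) (B : 'M_(n, p)) (e : int) :
  (A *~ e) *m B = (A *m B) *~ e.
Proof. exact: (raddfMz (mulmxr B)). Qed.

Lemma mulmxMzr (K : nzRingType) m n p (A : 'M[K]_(m, n)) (B : 'M_(n, p)) (e : int) :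
  A *m (B *~ e) = (A *m B) *~ e.
Proof. exact: (raddfMz (mulmx A)). Qed.

Lemma mxMzE (K : nzRingType) m n (A : 'M[K]_(m, n)) (e : int) i j :
  (A *~ e) i j = A i j *~ e.
Proof.
by case: e => e; rewrite ?NegzE ?mulrNz -!pmulrn ?mxE mulmxnE.
Qed.

Section Forms.
Variables (K : nzRingType) (c : K -> K).
Hypotheses (cP : is_conj c).

Definition formmx (e : int) n (M : 'M[K]_n) := adj c M *~ e = M /\ injmx M.

Definition congr_mx n m (M : 'M[K]_n) (S : 'M[K]_m) :=
  exists2 P : 'M[K]_(n, m), is_iso P & adj c P *m M *m P = S.

Lemma congr_mx_refl n (M : 'M[K]_n) : congr_mx M M.
Proof. by exists 1%:M; [exact: is_iso1|rewrite (adj1 cP) mul1mx mulmx1]. Qed.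

Lemma congr_mx_sym n m (M : 'M[K]_n) (S : 'M[K]_m) : congr_mx M S -> congr_mx S M.
Proof.
move=> [P [P' [P'P PP']] <-]; exists P'; first by exists P.
by rewrite -!mulmxA PP' mulmx1 mulmxA -(adjM cP) PP' (adj1 cP) mul1mx.
Qed.

Lemma congr_mx_trans n m p (M : 'M[K]_n) (S : 'M[K]_m) (T : 'M[K]_p) :
  congr_mx M S -> congr_mx S T -> congr_mx M T.
Proof.
move=> [P iP <-] [Q iQ <-]; exists (P *m Q); first exact: is_isoM.
by rewrite (adjM cP) !mulmxA.
Qed.

Lemma formmx_adj e n (M : 'M[K]_n) : formmx e M -> adj c M = M *~ e.
Proof. by move=> [eM _]; rewrite -{1}eM (adjMz cP) (adjK cP). Qed.

Lemma formmx_congr e n m (M : 'M[K]_n) (S : 'M[K]_m) :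
  congr_mx M S -> formmx e M -> formmx e S.
Proof.
move=> [P iP <-] fM; have [eM iM] := fM; split.
  by rewrite !(adjM cP) (adjK cP) -mulmxMzr -mulmxMzl eM mulmxA.
have iP' := is_iso_inj (adj_iso cP iP).
rewrite -mulmxA; apply: injmxM => //; apply: injmxM => //; exact: is_iso_inj.
Qed.

Lemma congr_mx_scale d n m (M : 'M[K]_n) (S : 'M[K]_m) :
  (forall x, d * x = x * d) -> congr_mx M S -> congr_mx (d *: M) (d *: S).
Proof.
move=> dC [P iP <-]; exists P => //; rewrite scalemxAl; congr (_ *m _).
apply/matrixP => i j; rewrite !mxE big_distrr /=; apply: eq_bigr => k _.
by rewrite !mxE !mulrA dC.
Qed.

Lemma congr_mx_diag n1 n2 m1 m2 (M1 : 'M[K]_n1) (M2 : 'M[K]_n2)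
    (S1 : 'M[K]_m1) (S2 : 'M[K]_m2) :
  congr_mx M1 S1 -> congr_mx M2 S2 ->
  congr_mx (block_mx M1 0 0 M2) (block_mx S1 0 0 S2).
Proof.
move=> [P iP <-] [Q iQ <-]; exists (block_mx P 0 0 Q); first exact/is_iso_block_diag.
by rewrite adj_block !(adj0 cP) !mulmx_block !(mul0mx, mulmx0, addr0, add0r).
Qed.

Lemma congr_mx_shuffle r s r' s' (A : 'M[K]_r) (B : 'M_(r, s)) (C : 'M_(s, r)) (D : 'M_s)
    (A' : 'M[K]_r') (B' : 'M_(r', s')) (C' : 'M_(s', r')) (D' : 'M_s') :
  congr_mx (block_mx (block_mx A B C D) 0 0 (block_mx A' B' C' D'))
    (block_mx (block_mx A 0 0 A') (block_mx B 0 0 B')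
              (block_mx C 0 0 C') (block_mx D 0 0 D')).
Proof.
(* The permutation exchanging the two middle blocks of the basis: the first parts of both summands
   are put together, then the second parts. *)
pose T : 'M[K]_((r + s) + (r' + s'), (r + r') + (s + s')) :=
  block_mx (block_mx 1%:M 0 0 0) (block_mx 0 0 1%:M 0)
           (block_mx 0 1%:M 0 0) (block_mx 0 0 0 1%:M).
have adjT : adj c T = block_mx (block_mx 1%:M 0 0 0) (block_mx 0 0 1%:M 0)
                          (block_mx 0 1%:M 0 0) (block_mx 0 0 0 1%:M).
  by rewrite /T !adj_block !(adj0 cP) !(adj1 cP).
have simpl0 := (mul0mx, mulmx0, addr0, add0r, mul1mx, mulmx1).
exists T; last first.
  by rewrite adjT /T !mulmx_block !simpl0 !mulmx_block !simpl0 !add_block_mx !simpl0.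
exists (adj c T); rewrite adjT /T.
by split; rewrite !mulmx_block !simpl0 ?mulmx_block ?simpl0 ?add_block_mx ?simpl0
  ?block_mx0 -!scalar_mx_block.
Qed.

Lemma scale_Ipq d p q : d *: Ipq K p q = block_mx d%:M 0 0 (- d%:M).
Proof. by rewrite /Ipq scale_block_mx !scaler0 scalerN !scalemx1. Qed.

Lemma scale_Ipq10 d : d *: Ipq K 1 0 = d%:M :> 'M_1.
Proof.
rewrite scale_Ipq; apply/matrixP => i j; rewrite !ord1 !mxE.
by case: splitP => [i' _|[]//]; rewrite mxE; case: splitP => [j' _|[]//]; rewrite !ord1 mxE.
Qed.

Lemma scale_Ipq01 d : d *: Ipq K 0 1 = (- d)%:M :> 'M_1.
Proof.
rewrite scale_Ipq; apply/matrixP => i j; rewrite !ord1 !mxE.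
by case: splitP => [[]//|i' _]; rewrite mxE; case: splitP => [[]//|j' _]; rewrite !ord1 !mxE mulNrn.
Qed.

Lemma congr_mx_Ipq d r s r' s' :
  congr_mx (block_mx (d *: Ipq K r s) 0 0 (d *: Ipq K r' s'))
           (d *: Ipq K (r + r') (s + s')).
Proof.
rewrite !scale_Ipq; apply: congr_mx_trans (congr_mx_shuffle _ _ _ _ _ _ _ _) _.
rewrite -!scalar_mx_block !block_mx0.
have -> : block_mx (- d%:M) 0 0 (- d%:M) = - d%:M :> 'M[K]_(s + s').
  by rewrite [in RHS]scalar_mx_block opp_block_mx !oppr0.
exact: congr_mx_refl.
Qed.

Lemma congr_mx_Sp k l : congr_mx (block_mx (Spmx K k) 0 0 (Spmx K l)) (Spmx K (k + l)).
Proof.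
apply: congr_mx_trans (congr_mx_shuffle _ _ _ _ _ _ _ _) _.
rewrite -!scalar_mx_block !block_mx0.
have -> : block_mx (- 1%:M) 0 0 (- 1%:M) = - 1%:M :> 'M[K]_(k + l).
  by rewrite [in RHS]scalar_mx_block opp_block_mx !oppr0.
exact: congr_mx_refl.
Qed.

Lemma gram_adj e N m n (M : 'M[K]_N) (V : 'M_(N, m)) (P : 'M_(N, n)) :
  formmx e M -> adj c (adj c V *m M *m P) = (adj c P *m M *m V) *~ e.
Proof.
by move=> fM; rewrite !(adjM cP) (adjK cP) (formmx_adj fM) mulmxMzl mulmxMzr mulmxA.
Qed.

Lemma gram_row e N m n (M : 'M[K]_N) (V : 'M_(N, m)) (P : 'M_(N, n)) :
  formmx e M -> adj c P *m M *m V = 0 ->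
  adj c (row_mx V P) *m M *m row_mx V P =
    block_mx (adj c V *m M *m V) 0 0 (adj c P *m M *m P).
Proof.
move=> fM PV; have VP : adj c V *m M *m P = 0.
  by rewrite -[LHS](adjK cP) (gram_adj _ _ fM) PV mul0rz (adj0 cP).
by rewrite adj_row mul_col_mx mul_col_row PV VP.
Qed.

Hypotheses (Kdiv : skewfield K) (K2 : no_2torsion K).

Lemma gram_iso N n (M : 'M[K]_N) (S : 'M[K]_n) (P : 'M_(N, n)) :
  injmx S -> (N <= n)%N -> adj c P *m M *m P = S -> is_iso P.
Proof. by move=> iS Nn e; apply: injmx_iso Nn => //; move: iS; rewrite -e; exact: injmx_mull. Qed.

(** Counting gives a nonzero w orthogonal to the columns of P, and nondegeneracy a basis vector
    pairing nontrivially with it. Scaling w makes the pairing 1; subtracting from the basis vector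
    its projection on the span of P leaves the pairing with w unchanged and yields z. *)
Lemma orthogonal_pair e N n (M : 'M[K]_N) (P : 'M_(N, n)) :
  formmx e M -> injmx (adj c P *m M *m P) -> (n < N)%N ->
  exists w z : 'cV_N, [/\ adj c P *m M *m w = 0, adj c P *m M *m z = 0 &
     adj c z *m M *m w = 1%:M].
Proof.
move=> fM iS nN; have [_ iM] := fM.
have [S' [S'S SS']] := injmx_iso Kdiv iS (leqnn n).
have [w0 w00 Pw0] := wide_kernel Kdiv (adj c P *m M) nN.
have [i Mi] : exists i, (M *m w0) i 0 != 0.
  apply/existsP; apply: contraNT w00; rewrite negb_exists => /forallP h.
  apply/eqP/iM/colP => i; rewrite [RHS]mxE; apply/eqP.
  by move: (h i); rewrite negbK.
have [b [_ Mb]] := Kdiv Mi.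
pose z0 : 'cV[K]_N := delta_mx i 0.
exists (w0 *m b%:M), (z0 - P *m (S' *m (adj c P *m M *m z0))).
have Pw : adj c P *m M *m (w0 *m b%:M) = 0 by rewrite mulmxA Pw0 mul0mx.
split=> //.
  by rewrite mulmxBr (mulmxA _ P) (mulmxA _ S') SS' mul1mx subrr.
rewrite (adjD cP) (adjN cP) (adjM cP P) -mulmxA mulmxBl -(mulmxA _ (adj c P)).
rewrite (mulmxA (adj c P)) Pw mulmx0 subr0.
have -> : adj c z0 = delta_mx 0 i.
  apply/matrixP => k l; rewrite !mxE [in RHS]andbC.
  by case: andP; rewrite ?(conj1 cP) ?(add0 (conjD cP)).
rewrite -rowE; apply/matrixP => k l; rewrite !ord1 mulmxA.
by rewrite mxE mxE big_ord1 [b%:M _ _]mxE mulr1n Mb mxE.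
Qed.

(** If every vector v orthogonal to P had value 0, evaluating at w x + z for an orthogonal pair
    would give c(x) e + x = 0 for all x. Then x = 1 forces e = -1, hence c is the identity, which
    [ns] allows only for e = 1, and 1 = -1 contradicts the absence of 2-torsion. *)
Lemma anisotropic_vector e N n (M : 'M[K]_N) (P : 'M_(N, n)) :
  formmx e M -> injmx (adj c P *m M *m P) -> (n < N)%N ->
  ((forall a, c a = a) -> e = 1) ->
  exists2 v : 'cV_N, adj c P *m M *m v = 0 & adj c v *m M *m v != 0.
Proof.
move=> fM iS nN ns; have [w [z [Pw Pz zw]]] := orthogonal_pair fM iS nN.
apply: contrapT => /forall2NP no.
have {}no (v : 'cV_N) : adj c P *m M *m v = 0 -> adj c v *m M *m v = 0.
  by move=> Pv; case: (no v) => // /negP; rewrite negbK => /eqP.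
have wz : adj c w *m M *m z = 1%:M *~ e.
  by rewrite -[LHS](adjK cP) (gram_adj _ _ fM) zw (adjMz cP) (adj1 cP).
have key x : c x *~ e + x = 0.
  have /no : adj c P *m M *m (w *m x%:M + z) = 0 by rewrite mulmxDr mulmxA Pw Pz mul0mx addr0.
  have -> : adj c (w *m x%:M + z) *m M *m (w *m x%:M + z) =
      (c x)%:M *m (adj c w *m M *m w) *m x%:M + (c x)%:M *m (adj c w *m M *m z)
      + adj c z *m M *m w *m x%:M + adj c z *m M *m z.
    by rewrite (adjD cP) (adjM cP) (adj_scalar cP) !mulmxDl !mulmxDr !mulmxA !addrA.
  rewrite (no _ Pw) (no _ Pz) wz zw mul1mx mulmx0 mul0mx add0r addr0.
  by move/matrixP/(_ 0 0); rewrite mulmxMzr mulmx1 !mxE mxMzE mxE !mulr1n.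
have e1 : (1 : K) *~ e = -1.
  by have /eqP := key 1; rewrite (conj1 cP) addr_eq0 => /eqP.
have cid a : c a = a.
  have := key a; rewrite -[c a]mulr1 -mulrzAr e1 mulrN1 addrC => /eqP.
  by rewrite subr_eq0 mulr1 => /eqP.
have /eqP := e1; rewrite (ns cid) mulr1z -subr_eq0 opprK => /eqP/K2/eqP.
by rewrite oner_eq0.
Qed.

(** * Orthogonal bases for forms that take nonzero values v, v *)

Section Diagonalisation.
Variables (e : int) (d : K).
Hypotheses (d0 : d != 0) (ns : (forall a, c a = a) -> e = 1).
Hypothesis norm : forall h, h != 0 -> c h *~ e = h ->
  exists a, c a * h * a = d \/ c a * h * a = - d.

Lemma scalar_injmx n a : a != 0 -> injmx (a%:M : 'M[K]_n).
Proof.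
move=> a0; have [b [ba ab]] := Kdiv a0; apply: is_iso_inj.
by exists b%:M; rewrite -!scalar_mxM ba ab.
Qed.

Lemma scale_Ipq_injmx p q : injmx (d *: Ipq K p q).
Proof.
have -> : d *: Ipq K p q = d%:M *m Ipq K p q by rewrite mul_scalar_mx.
by apply: injmxM; [exact: scalar_injmx|apply: is_iso_inj; exact: Ipq_iso].
Qed.

Lemma congr_mx_injmx n m (M : 'M[K]_n) (S : 'M[K]_m) :
  congr_mx M S -> injmx S -> injmx M.
Proof.
move=> /congr_mx_sym[P iP <-] iS; rewrite -mulmxA.
apply: injmxM; first by apply: is_iso_inj; exact: adj_iso.
by apply: injmxM => //; exact: is_iso_inj.
Qed.

(** Gram-Schmidt: an orthogonal system in normal form is enlarged by an anisotropic vector of its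
    complement, rescaled by [norm] to value d or -d. The value d is 1 for symmetric and hermitian
    forms, and i for antihermitian ones. *)
Lemma form_diagonal N (M : 'M[K]_N) : formmx e M ->
  exists p q, congr_mx M (d *: Ipq K p q).
Proof.
move=> fM.
(* [k] bounds the number of vectors still missing; the construction starts from the empty system. *)
suff H k : forall n (P : 'M_(N, n)) p q, (N <= n + k)%N ->
    congr_mx (adj c P *m M *m P) (d *: Ipq K p q) ->
    exists p q, congr_mx M (d *: Ipq K p q).
  apply: (H N 0 (0 : 'M_(N, 0)) 0%N 0%N) => //.
  by exists 0; [exists 0; split; apply/matrixP => -[]|apply/matrixP => -[]].
elim: k => [|k IH] n P p q Nn cS; have iS := congr_mx_injmx cS (@scale_Ipq_injmx p q).
  exists p, q; apply: congr_mx_trans cS; exists P => //.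
  by apply: gram_iso iS _ erefl; rewrite addn0 in Nn.
have [Nn'|nN] := leqP N n.
  exists p, q; apply: congr_mx_trans cS; exists P => //; exact: gram_iso iS _ erefl.
have [v Pv vv] := anisotropic_vector fM iS nN ns.
pose h := (adj c v *m M *m v) 0 0.
have hE : adj c v *m M *m v = h%:M by rewrite -mx11_scalar.
have h0 : h != 0 by apply: contra_neq vv => h0; rewrite hE h0 raddf0.
have ch : c h *~ e = h.
  have [eM _] := fM.
  have : adj c (adj c v *m M *m v) *~ e = adj c v *m M *m v.
    by rewrite !(adjM cP) (adjK cP) -mulmxMzr -mulmxMzl eM mulmxA.
  by rewrite hE (adj_scalar cP) => /matrixP/(_ 0 0); rewrite mxMzE !mxE !mulr1n.
have [a ha] := norm h0 ch.
have Pva : adj c P *m M *m (v *m a%:M) = 0 by rewrite mulmxA Pv mul0mx.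
have gva : adj c (v *m a%:M) *m M *m (v *m a%:M) = (c a * h * a)%:M.
  by rewrite !scalar_mxM -hE (adjM cP) (adj_scalar cP) !mulmxA.
have [p1 [q1 c1]] : exists p1 q1, congr_mx ((c a * h * a)%:M : 'M_1) (d *: Ipq K p1 q1).
  case: ha => ->; [exists 1%N, 0%N|exists 0%N, 1%N].
    by rewrite scale_Ipq10; exact: congr_mx_refl.
  by rewrite scale_Ipq01; exact: congr_mx_refl.
apply: (IH _ (row_mx (v *m a%:M) P) (p1 + p)%N (q1 + q)%N).
  by rewrite add1n addSnnS.
rewrite (gram_row fM Pva) gva.
exact: congr_mx_trans (congr_mx_diag c1 cS) (congr_mx_Ipq _ _ _ _ _).
Qed.

(** The scalar b carries the value -d to d, so the signature can be erased. It will be i for d = 1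
    over C, and j for d = i over H. *)
Lemma form_diagonal_scalar N (M : 'M[K]_N) b : c b * - d * b = d ->
  formmx e M -> congr_mx M (d%:M : 'M_N).
Proof.
move=> hb /form_diagonal[p [q cM]].
have [P /(is_iso_dim Kdiv) Npq _] := cM; subst N.
have b0 : b != 0 by apply: contraNneq d0 => b0; rewrite -hb b0 mulr0.
apply: congr_mx_trans cM _; exists (block_mx 1%:M 0 0 b%:M).
  apply/is_iso_block_diag; split; first exact: is_iso1.
  by have [b' [? ?]] := Kdiv b0; exists b'%:M; rewrite -!scalar_mxM; split; congr _%:M.
rewrite scale_Ipq adj_block !(adj0 cP) (adj1 cP) (adj_scalar cP).
rewrite !mulmx_block !(mul0mx, mulmx0, addr0, add0r, mul1mx, mulmx1).
rewrite [in RHS]scalar_mx_block; congr block_mx.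
by rewrite -raddfN -!scalar_mxM; congr _%:M.
Qed.

End Diagonalisation.

(** Every vector is isotropic, so an orthogonal pair (w, z) has Gram matrix [Spmx K 1]; such
    hyperbolic planes are split off one after another. *)
Lemma form_symplectic N (M : 'M[K]_N) : (forall a, c a = a) -> formmx (-1) M ->
  exists k, congr_mx M (Spmx K k).
Proof.
move=> cid fM.
have iSp k : injmx (Spmx K k).
  apply: is_iso_inj; exists (- Spmx K k).
  rewrite mulmxN mulNmx /Spmx mulmx_block !(mulmx0, mul0mx, addr0, add0r) mulmx1 mul1mx.
  by rewrite opp_block_mx !oppr0 opprK -scalar_mx_block.
suff H l : forall n (P : 'M_(N, n)) k, (N <= n + l)%N ->
    congr_mx (adj c P *m M *m P) (Spmx K k) ->
    exists k, congr_mx M (Spmx K k).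
  apply: (H N 0 (0 : 'M_(N, 0)) 0%N) => //.
  by exists 0; [exists 0; split; apply/matrixP => -[]|apply/matrixP => -[]].
elim: l => [|l IH] n P k Nn cS; have iS := congr_mx_injmx cS (iSp k).
  exists k; apply: congr_mx_trans cS; exists P => //.
  by apply: gram_iso iS _ erefl; rewrite addn0 in Nn.
have [Nn'|nN] := leqP N n.
  exists k; apply: congr_mx_trans cS; exists P => //; exact: gram_iso iS _ erefl.
have [w [z [Pw Pz zw]]] := orthogonal_pair fM iS nN.
have skew (u v : 'cV_N) : adj c u *m M *m v = - (adj c v *m M *m u).
  rewrite -[LHS](adjK cP) (gram_adj _ _ fM) mulrN1z (adjN cP); congr (- _).
  by apply/matrixP => i j; rewrite !ord1 !mxE cid.
have alt (u : 'cV_N) : adj c u *m M *m u = 0.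
  apply/matrixP => i j; rewrite [RHS]mxE; apply: K2.
  by rewrite {1}skew mxE addNr.
have PV : adj c P *m M *m row_mx w z = 0 by rewrite mul_mx_row Pw Pz row_mx0.
apply: (IH _ (row_mx (row_mx w z) P) (1 + k)%N).
  by rewrite (leq_trans Nn) // -addSnnS leq_add2r addnC addn2 ltnW.
rewrite (gram_row fM PV).
have -> : adj c (row_mx w z) *m M *m row_mx w z = Spmx K 1.
  by rewrite adj_row mul_col_mx mul_col_row !alt (skew w z) zw.
exact: congr_mx_trans (congr_mx_diag (congr_mx_refl _) cS) (congr_mx_Sp _ _).
Qed.

Lemma congr_mx_scale_inv d n m (M : 'M[K]_n) (S : 'M[K]_m) : d != 0 ->
  (forall x, d * x = x * d) -> congr_mx (d *: M) (d *: S) -> congr_mx M S.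
Proof.
move=> d0 dC; have [b [bd db]] := Kdiv d0.
have bC x : b * x = x * b.
  by rewrite -[LHS]mulr1 -db mulrA -(mulrA b x d) -dC !mulrA bd mul1r.
by move/(congr_mx_scale bC); rewrite !scalerA bd !scale1r.
Qed.

(** * Invariance of the signature *)

Hypothesis cpos : definite c.

(** The first p' columns A of P span a subspace with form 1. Projecting it to the p positive
    coordinates is injective: if the upper half of A x vanishes, the norm of x is minus the norm of
    the lower half of A x, and definiteness makes both zero. *)
Lemma sylvester_leq p q p' q' : congr_mx (Ipq K p q) (Ipq K p' q') -> (p' <= p)%N.
Proof.
move=> [P iP eP]; apply: (@injmx_leq _ Kdiv _ _ (usubmx (lsubmx P))) => x ux.
set A := lsubmx P in ux.
have gA : adj c A *m Ipq K p q *m A = 1%:M.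
  move: eP; rewrite -{1 2}(hsubmxK P) adj_row mul_col_mx mul_col_row /Ipq.
  by move/eq_block_mx => [].
have : adj c (A *m x) *m Ipq K p q *m (A *m x) = adj c x *m x.
  by rewrite (adjM cP) !mulmxA -(mulmxA _ _ (Ipq K p q)) -(mulmxA (adj c x)) gA mulmx1.
rewrite -(vsubmxK A) mul_col_mx ux adj_col (adj0 cP) /Ipq mul_row_block.
rewrite !(mul0mx, mulmx0, addr0, add0r, mulmxN, mulmx1) mul_row_col mul0mx add0r mulNmx.
move=> e; have : col_mx (dsubmx A *m x) x = 0.
  by apply: cpos; rewrite adj_col mul_row_col -e subrr.
by move/eqP; rewrite col_mx_eq0 => /andP[_ /eqP].
Qed.

Lemma sylvester p q p' q' : congr_mx (Ipq K p q) (Ipq K p' q') -> p = p' /\ q = q'.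
Proof.
move=> h; have pp' : p = p'.
  by apply/eqP; rewrite eqn_leq (sylvester_leq h) (sylvester_leq (congr_mx_sym h)).
split=> //; have [P /(is_iso_dim Kdiv) + _] := h.
by rewrite pp' => /addnI.
Qed.

(** On an isotropic subspace the positive and negative coordinates have equal norms, so each of them
    determines the vector. Hence n <= p and n <= q, while p + q = 2n. *)
Lemma split_inertia N n p q (M : 'M[K]_N) (A : 'M_(N, n)) :
  injmx A -> adj c A *m M *m A = 0 -> N = (n + n)%N ->
  congr_mx M (Ipq K p q) -> p = n /\ q = n.
Proof.
move=> iA A0 Nn cM; have [P iP eP] := congr_mx_sym cM.
have {}Npq := is_iso_dim Kdiv iP.
pose B := P *m A; have iB : injmx B by apply: injmxM => //; exact: is_iso_inj.
have B0 : adj c B *m Ipq K p q *m B = 0.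
  by rewrite -A0 -eP (adjM cP) !mulmxA.
have E : adj c (usubmx B) *m usubmx B = adj c (dsubmx B) *m dsubmx B.
  apply/eqP; rewrite -subr_eq0 -B0 -[in X in _ == X](vsubmxK B) adj_col /Ipq mul_row_block.
  by rewrite !(mul0mx, mulmx0, addr0, add0r, mulmxN, mulmx1) mul_row_col mulNmx.
have np : (n <= p)%N.
  apply: (@injmx_leq _ Kdiv _ _ (usubmx B)) => x ux; apply: iB.
  rewrite -(vsubmxK B) mul_col_mx ux; suff -> : dsubmx B *m x = 0 by rewrite col_mx0.
  by apply: cpos; rewrite (adjM cP) mulmxA -(mulmxA (adj c x)) -E -!mulmxA ux !mulmx0.
have nq : (n <= q)%N.
  apply: (@injmx_leq _ Kdiv _ _ (dsubmx B)) => x ux; apply: iB.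
  rewrite -(vsubmxK B) mul_col_mx ux; suff -> : usubmx B *m x = 0 by rewrite col_mx0.
  by apply: cpos; rewrite (adjM cP) mulmxA -(mulmxA (adj c x)) E -!mulmxA ux !mulmx0.
by lia.
Qed.

End Forms.

(** * From forms and semiinvolutions to matrices *)

Lemma is_aut_id (K : nzRingType) : is_aut (id : K -> K).
Proof. by split. Qed.

Lemma map_mx_id (K : nzRingType) m n (A : 'M[K]_(m, n)) : map_mx id A = A.
Proof. by apply/matrixP => i j; rewrite mxE. Qed.

Lemma cv_sum (K : nzRingType) N (v : 'cV[K]_N) :
  v = \sum_j rscale (delta_mx j 0) (v j 0).
Proof.
apply/colP => i; rewrite summxE (bigD1 i) //= rscaleE mxE !eqxx mul1r big1 ?addr0 //.
by move=> j ji; rewrite rscaleE mxE eq_sym (negPf ji) mul0r.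
Qed.

Section Gram.
Variables (K : nzRingType) (c : K -> K).
Hypotheses (cP : is_conj c).

Lemma gram_formE n (M : 'M[K]_n) v w : gram_form c M v w = (adj c w *m M *m v) 0 0.
Proof. by []. Qed.

Lemma gram_form_mul N n (M : 'M[K]_N) (P : 'M_(N, n)) v w :
  gram_form c M (P *m v) (P *m w) = gram_form c (adj c P *m M *m P) v w.
Proof. by rewrite !gram_formE (adjM cP) !mulmxA. Qed.

Lemma gram_formMz N (M : 'M[K]_N) (e : int) v w :
  gram_form c (M *~ e) v w = gram_form c M v w *~ e.
Proof. by rewrite !gram_formE mulmxMzr mulmxMzl mxMzE. Qed.

Lemma gram_form_conj N (M : 'M[K]_N) v w :
  c (gram_form c M w v) = gram_form c (adj c M) v w.
Proof.
rewrite !gram_formE.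
have -> : adj c w *m adj c M *m v = adj c (adj c v *m M *m w).
  by rewrite !(adjM cP) (adjK cP) mulmxA.
by rewrite !mxE.
Qed.

Lemma adj_delta N (i : 'I_N) : adj c (delta_mx i 0 : 'cV_N) = delta_mx 0 i.
Proof.
apply/matrixP => k l; rewrite !mxE [in RHS]andbC.
by case: andP; rewrite ?(conj1 cP) ?(add0 (conjD cP)).
Qed.

Lemma adj_delta_mul m n (X : 'M[K]_(m, n)) i j :
  (adj c (delta_mx i 0 : 'cV_m) *m X *m (delta_mx j 0 : 'cV_n)) 0 0 = X i j.
Proof. by rewrite adj_delta -rowE -colE !mxE. Qed.

Lemma gram_form_inj N (M M' : 'M[K]_N) :
  (forall v w, gram_form c M v w = gram_form c M' v w) -> M = M'.
Proof.
by move=> h; apply/matrixP => i j; have := h (delta_mx j 0) (delta_mx i 0); rewrite !gram_formE !adj_delta_mul.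
Qed.

Lemma gram_form0 N v w : gram_form c (0 : 'M[K]_N) v w = 0.
Proof. by rewrite gram_formE mulmx0 mul0mx mxE. Qed.

Lemma form_matrix eps N B : is_form (FormType c eps) B ->
  exists2 M : 'M[K]_N, B = gram_form c M & formmx c eps M.
Proof.
move=> [BD BZ BC Bn] /=.
pose M : 'M[K]_N := \matrix_(i, j) B (delta_mx j 0) (delta_mx i 0).
have B0 v : B 0 v = 0 /\ B v 0 = 0.
  have [h1 _] := BD 0 0 v; have [_ h2] := BD 0 0 v; split.
    by apply: (addrI (B 0 v)); rewrite -h1 !addr0.
  by apply: (addrI (B v 0)); rewrite -h2 !addr0.
have BM : B = gram_form c M.
  apply/funext => v; apply/funext => w.
  rewrite {1}(cv_sum v) {1}(cv_sum w).
  rewrite (big_morph (fun x => B x _) (fun x y => (BD x y _).1) (B0 _).1).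
  under eq_bigr => j _ do
    rewrite (big_morph (fun x => B _ x) (fun x y => (BD x y _).2) (B0 _).2).
  rewrite gram_formE mxE; apply: eq_bigr => j _.
  rewrite mxE big_distrl; apply: eq_bigr => i _ /=.
  by rewrite (BZ _ _ _).1 (BZ _ _ _).2 !mxE.
exists M => //; split.
  apply: gram_form_inj => v w; rewrite gram_formMz -gram_form_conj -BM.
  by rewrite [RHS]BC.
move=> x Mx; apply: Bn => w.
by rewrite BM gram_formE -mulmxA Mx mulmx0 mxE.
Qed.

Lemma form_gram eps N (M : 'M[K]_N) : formmx c eps M ->
  is_form (FormType c eps) (gram_form c M).
Proof.
move=> [eM iM]; split=> /=.
- move=> u v w; rewrite !gram_formE (adjD cP) mulmxDr !mulmxDl.
  by split; rewrite mxE.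
- move=> v w a; rewrite !gram_formE /rscale (adjM cP) (adj_scalar cP) mulmxA; split.
    by rewrite mxE big_ord1 [a%:M _ _]mxE eqxx mulr1n.
  by rewrite -!mulmxA mul_scalar_mx mxE.
- by move=> v w; rewrite gram_form_conj -gram_formMz eM.
- move=> v h; apply: iM; apply/colP => i; rewrite [RHS]mxE.
  have := h (delta_mx i 0); rewrite gram_formE.
  by rewrite adj_delta -mulmxA -rowE mxE.
Qed.

Lemma GL_setE N (g : 'M[K]_N) : ug_set (GL K N) g <-> is_iso g.
Proof. by split=> -[h [h1 h2]]; exists h. Qed.

Lemma Ugroup_frames N (M : 'M[K]_N) :
  ug_set (Ugroup (gram_form c M)) = frames c id M 1%:M M 1%:M.
Proof.
apply/seteqP; split=> g.
  move=> [/GL_setE ig gB]; split=> //; last by rewrite map_mx_id mul1mx mulmx1.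
  by apply: gram_form_inj => v w; rewrite -gram_form_mul gB.
move=> [ig gM _]; split; first exact/GL_setE.
by move=> v w; rewrite gram_form_mul gM.
Qed.

Lemma GL_frames N : ug_set (GL K N) = frames c id 0 1%:M 0 1%:M.
Proof.
apply/seteqP; split=> g; last by move=> [/GL_setE].
by move=> /GL_setE ig; split=> //; rewrite ?mulmx0 ?mul0mx // map_mx_id mul1mx mulmx1.
Qed.

Lemma congr_mx_Ugroup N n (M : 'M[K]_N) (S : 'M[K]_n) : congr_mx c M S ->
  isomorphic (Ugroup (gram_form c M)) (Ugroup (gram_form c S)).
Proof.
move=> [P iP PS]; rewrite !Ugroup_frames.
apply: (frames_conj_isomorphic cP (is_aut_id K) (P := P)); split=> //.
by rewrite map_mx_id mul1mx mulmx1.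
Qed.

Lemma Ugroup_scale N (M : 'M[K]_N) d : skewfield K ->
  d != 0 -> (forall x, d * x = x * d) ->
  Ugroup (gram_form c (d *: M)) = Ugroup (gram_form c M).
Proof.
move=> Kdiv d0 dC; have [b [bd db]] := Kdiv _ d0.
have E v w : gram_form c (d *: M) v w = d * gram_form c M v w.
  rewrite !gram_formE; have -> : adj c w *m (d *: M) = d *: (adj c w *m M).
    apply/matrixP => i j; rewrite !mxE big_distrr /=; apply: eq_bigr => k _.
    by rewrite !mxE !mulrA dC.
  by rewrite -scalemxAl mxE.
apply: ugroup_eq; apply/seteqP; split=> g [ig gM]; split=> // v w.
  by move: (gM v w); rewrite !E => /(congr1 ( *%R b)); rewrite !mulrA bd !mul1r.
by rewrite !E gM.
Qed.

Variable t : K -> K.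
Hypotheses (tP : is_aut t) (ct : forall x, c (t x) = t (c x)).

Lemma semiinvolution_matrix e N (J : 'cV[K]_N -> 'cV[K]_N) : semiinvolution t e J ->
  exists2 Jm : 'M[K]_N, J = (fun v => Jm *m map_mx t v) &
    Jm *m map_mx t Jm = 1%:M *~ e.
Proof.
move=> [JD JZ JJ].
pose Jm : 'M[K]_N := \matrix_(i, j) J (delta_mx j 0) i 0.
have J0 : J 0 = 0 by apply: (addrI (J 0)); rewrite -JD !addr0.
have JE : J = (fun v => Jm *m map_mx t v).
  apply/funext => v; rewrite {1}(cv_sum v) (big_morph J JD J0).
  apply/colP => i; rewrite summxE mxE; apply: eq_bigr => j _.
  by rewrite JZ rscaleE !mxE.
exists Jm => //; apply: mulmx_ext => x.
rewrite mulmxMzl mul1mx -JJ JE (map_mxMf (autD tP) (autM tP)) mulmxA.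
by congr (_ *m _); apply/matrixP => i j; rewrite !mxE (autI tP).
Qed.

Lemma map_mxK m n (A : 'M[K]_(m, n)) : map_mx t (map_mx t A) = A.
Proof. by apply/matrixP => i j; rewrite !mxE (autI tP). Qed.

Lemma map_adj m n (A : 'M[K]_(m, n)) : map_mx t (adj c A) = adj c (map_mx t A).
Proof. by apply/matrixP => i j; rewrite !mxE ct. Qed.

Lemma gram_form_map N (M : 'M[K]_N) v w :
  t (gram_form c M v w) = gram_form c (map_mx t M) (map_mx t v) (map_mx t w).
Proof.
rewrite !gram_formE -map_adj -!(map_mxMf (autD tP) (autM tP)).
by rewrite [in RHS]mxE.
Qed.

Lemma consistent_matrix mu N (M Jm : 'M[K]_N) :
  consistent t mu (gram_form c M) (fun v => Jm *m map_mx t v) ->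
  adj c Jm *m M *m Jm = map_mx t M *~ mu.
Proof.
move=> h; apply: gram_form_inj => v w.
rewrite gram_formMz -(map_mxK v) -(map_mxK w) -gram_form_map -h.
by rewrite -gram_form_mul !map_mxK.
Qed.

Lemma centralizer_frames N (M Jm : 'M[K]_N) :
  ug_set (centralizer (Ugroup (gram_form c M)) (fun v => Jm *m map_mx t v)) =
    frames c t M Jm M Jm.
Proof.
have tJ (g : 'M_N) : (forall v : 'cV_N, g *m (Jm *m map_mx t v) = Jm *m map_mx t (g *m v)) <->
    Jm *m map_mx t g = g *m Jm.
  split=> [h|h v]; last by rewrite (map_mxMf (autD tP) (autM tP)) !mulmxA h.
  apply: mulmx_ext => x; move: (h (map_mx t x)).
  by rewrite (map_mxMf (autD tP) (autM tP)) map_mxK !mulmxA.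
apply/seteqP; split=> g.
  move=> [[/GL_setE ig gB] /tJ gJ]; split=> //.
  by apply: gram_form_inj => v w; rewrite -gram_form_mul gB.
move=> [ig gM /tJ gJ]; split=> //; split; first exact/GL_setE.
by move=> v w; rewrite gram_form_mul gM.
Qed.

Lemma centralizer_GL_frames N (Jm : 'M[K]_N) :
  ug_set (centralizer (GL K N) (fun v => Jm *m map_mx t v)) = frames c t 0 Jm 0 Jm.
Proof.
rewrite -centralizer_frames; apply/seteqP; split=> g [ig gJ]; split=> //.
  by split=> // v w; rewrite !gram_form0.
by case: ig.
Qed.

End Gram.

(** * The five lists *)

Lemma direct_decompC (K : nzRingType) N (Q1 Q2 : set 'cV[K]_N) :
  direct_decomp Q1 Q2 -> direct_decomp Q2 Q1.
Proof.
move=> [s1 s2 I sp]; split=> //; first by rewrite setIC.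
by move=> v; have [v1 [v2 [? ? ->]]] := sp v; exists v2, v1; rewrite addrC.
Qed.

(** Conjugation by diag(1, -1) fixes block-diagonal matrices and negates block-antidiagonal ones. *)
Lemma sgn_adapted_blocks (K : nzRingType) (a b : nat) (S Z : 'M[K]_(a + b))
    : (ursubmx S = 0 /\ dlsubmx S = 0) \/ (ulsubmx S = 0 /\ drsubmx S = 0) ->
      (ursubmx Z = 0 /\ dlsubmx Z = 0) \/ (ulsubmx Z = 0 /\ drsubmx Z = 0) ->
  sgn_adapted S Z.
Proof.
rewrite -(submxK S) -(submxK Z) !(block_mxKul, block_mxKur, block_mxKdl, block_mxKdr).
move=> hS hZ; split.
  by case: hS => -[-> ->]; rewrite /Ipq !mulmx_block !(mul0mx, mulmx0, addr0, add0r, mul1mx, mulmx1, mulNmx, mulmxN, opprK, oppr0) ?opp_block_mx ?(mul0mx, mulmx0, addr0, add0r, mul1mx, mulmx1, mulNmx, mulmxN, opprK, oppr0);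
    [left|right].
by case: hZ => -[-> ->]; rewrite /Ipq !mulmx_block !(mul0mx, mulmx0, addr0, add0r, mul1mx, mulmx1, mulNmx, mulmxN, opprK, oppr0) ?opp_block_mx ?(mul0mx, mulmx0, addr0, add0r, mul1mx, mulmx1, mulNmx, mulmxN, opprK, oppr0);
    [left|right].
Qed.

Lemma sgn_adapted1 (K : nzRingType) (a b : nat) (S : 'M[K]_(a + b)) :
  (ursubmx S = 0 /\ dlsubmx S = 0) \/ (ulsubmx S = 0 /\ drsubmx S = 0) ->
  sgn_adapted S 1%:M.
Proof.
by move=> hS; apply: sgn_adapted_blocks => //; left; rewrite scalar_mx_block block_mxKur block_mxKdl.
Qed.

(** * Complementary isotropic subspaces *)

Section IsotropicPairs.
Variables (K : nzRingType) (c : K -> K).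
Hypotheses (cP : is_conj c).

Lemma isotropic_range N n (M : 'M[K]_N) (A : 'M_(N, n)) :
  isotropic (gram_form c M) (range_mx A) <-> adj c A *m M *m A = 0.
Proof.
split=> [h|h _ _ [x _ <-] [y _ <-]]; last by rewrite gram_form_mul // h gram_form0.
apply: (gram_form_inj cP) => v w; rewrite gram_form0 -gram_form_mul //.
by apply: h; [exists v|exists w].
Qed.

(** Let v = v1 + v2 lie in an isotropic Q' containing Q1. Then v2 lies in Q', so it is orthogonal to
    Q1, and it is orthogonal to Q2 as a member of Q2; nondegeneracy gives v2 = 0. Maximality is thus
    automatic for complementary isotropic pairs. *)
Lemma complement_max_isotropic eps N (M : 'M[K]_N) Q1 Q2 : formmx c eps M ->
  isotropic (gram_form c M) Q1 -> isotropic (gram_form c M) Q2 ->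
  direct_decomp Q1 Q2 -> max_isotropic (gram_form c M) Q1.
Proof.
move=> /(form_gram cP)[BD _ BC Bn] i1 i2 [s1 s2 I sp]; split=> // Q' sQ' iQ' Q1Q'.
apply/seteqP; split=> // v Q'v; have [v1 [v2 [Qv1 Qv2 e]]] := sp v.
suff v20 : v2 = 0 by rewrite e v20 addr0.
have Q'v2 : Q' v2.
  have -> : v2 = v + (- v1) by rewrite e addrC addKr.
  by case: (sQ') => _ + _; apply => //; apply: subspaceN => //; exact: Q1Q'.
apply: Bn => w; have [w1 [w2 [Qw1 Qw2 ->]]] := sp w.
by rewrite (BD w1 w2 v2).2 (iQ' v2 w1) // ?(i2 v2 w2) ?addr0 //; exact: Q1Q'.
Qed.

(** The Gram matrix of a frame with two isotropic halves: Y is the pairing between them, and the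
    other corner is forced by the symmetry type of the form. *)
Definition adiag eps n (Y : 'M[K]_n) : 'M[K]_(n + n) := block_mx 0 (adj c Y *~ eps) Y 0.

Lemma adiag_injmx eps n (Y : 'M[K]_n) : injmx (adiag eps Y) -> injmx Y.
Proof.
move=> iS x Yx; have : adiag eps Y *m col_mx x 0 = 0.
  by rewrite mul_block_col !(mul0mx, mulmx0, addr0) Yx col_mx0.
by move/iS/eqP; rewrite col_mx_eq0 => /andP[/eqP].
Qed.

(** Invariance reads adj(v) Y u = Y, which determines v from an arbitrary invertible u: the two
    halves are dual to each other. *)
Lemma blocks_adiag eps n (Y : 'M[K]_n) : is_iso Y ->
  isomorphic (blocks c id (adiag eps Y) 1%:M) (GL K n).
Proof.
move=> [Y' [Y'Y YY']]; apply/isomorphicP; exists fst.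
have simpl0 := (mul0mx, mulmx0, addr0, add0r).
have B u v : blocks c id (adiag eps Y) 1%:M (u, v) -> is_iso u /\ adj c v *m Y *m u = Y.
  move=> [/is_iso_block_diag [iu iv]]; rewrite /= /adiag adj_block !(adj0 cP).
  by rewrite !mulmx_block !simpl0 => /eq_block_mx[_ _ e _] _.
have iY : is_iso Y by exists Y'.
split.
- by move=> [u v] /B[/GL_setE].
- move=> [u v] [u' v'] /B[iu e] /B[_ e'] /= uu'; rewrite -uu' in e' *; congr pair.
  rewrite -(adjK cP v) -(adjK cP v'); congr (adj c _).
  have [W [_ YW]] := is_isoM iY iu.
  have E (X : 'M_n) : X *m Y *m u *m W = X by rewrite -!mulmxA (mulmxA Y) YW mulmx1.
  by rewrite -(E (adj c v)) -(E (adj c v')) e e'.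
- move=> u /GL_setE iu; have [u' [u'u uu']] := iu.
  exists (u, adj c (Y *m u' *m Y')) => //.
  have e : adj c (adj c (Y *m u' *m Y')) *m Y *m u = Y.
    by rewrite (adjK cP) -!mulmxA (mulmxA Y') Y'Y mul1mx u'u mulmx1.
  split; rewrite /=; last by rewrite map_mx_id mul1mx mulmx1.
    apply/is_iso_block_diag; split=> //; apply: (adj_iso cP).
    by apply: is_isoM; [apply: is_isoM => //; exists u|exists Y].
  rewrite /adiag adj_block !(adj0 cP) !mulmx_block !simpl0 e; congr block_mx.
  rewrite mulmxMzr mulmxMzl; congr (_ *~ _).
  by rewrite -[in RHS]e [in RHS](adjM cP) [in RHS](adjM cP) (adjK cP) mulmxA.
- by [].
Qed.

End IsotropicPairs.

(** * Pairs exchanged by a semiinvolution: frames (A, J A) *)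

Section Lists1and3.
Variables (K : nzRingType) (c t : K -> K) (e eps mu : int).
Hypotheses (cP : is_conj c) (tP : is_aut t) (ct : forall x, c (t x) = t (c x)).
Hypotheses (Kdiv : skewfield K) (K2 : no_2torsion K).
Hypotheses (mu1 : mu * mu = 1).
Variables (N : nat) (Jm : 'M[K]_N).
Hypothesis JJ : Jm *m map_mx t Jm = 1%:M *~ e.
Hypothesis e1 : e * e = 1.

Definition Jop m (A : 'M[K]_(N, m)) : 'M[K]_(N, m) := Jm *m map_mx t A.

(** The matrix of J in a frame (A, J A): J sends A to J A, and J A to e A. *)
Definition Zmx n : 'M[K]_(n + n) := block_mx 0 (1%:M *~ e) 1%:M 0.

Lemma tMM m n p (A : 'M[K]_(m, n)) (B : 'M_(n, p)) :
  map_mx t (A *m B) = map_mx t A *m map_mx t B.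
Proof. exact: map_mxMf (autD tP) (autM tP) _ _ _ _ _. Qed.

Lemma JopK m (A : 'M_(N, m)) : Jop (Jop A) = A *~ e.
Proof. by rewrite /Jop tMM mulmxA JJ (map_mxK tP) mulmxMzl mul1mx. Qed.

Lemma JopM m n (A : 'M_(N, m)) (U : 'M_(m, n)) : Jop (A *m U) = Jop A *m map_mx t U.
Proof. by rewrite /Jop tMM mulmxA. Qed.

Lemma Jop_frame m (A : 'M_(N, m)) :
  Jm *m map_mx t (row_mx A (Jop A)) = row_mx A (Jop A) *m Zmx m.
Proof.
rewrite map_row_mx mul_mx_row -/(Jop _) -/(Jop (Jop A)) JopK /Zmx mul_row_block.
by rewrite !(mulmx0, add0r, addr0) mulmx1 mulmxMzr mulmx1.
Qed.

Lemma frame_Jop m (P : 'M_(N, m + m)) : Jm *m map_mx t P = P *m Zmx m ->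
  P = row_mx (lsubmx P) (Jop (lsubmx P)).
Proof.
rewrite -{1 2}(hsubmxK P) map_row_mx mul_mx_row /Zmx mul_row_block.
rewrite !(mulmx0, add0r, addr0) !mulmx1 => /eq_row_mx[h _].
by rewrite -{1}(hsubmxK P) -h.
Qed.

Lemma J_range m (A : 'M_(N, m)) :
  [set Jm *m map_mx t v | v in range_mx A] = range_mx (Jop A).
Proof.
apply/seteqP; split=> [_ [_ [x _ <-] <-]|_ [x _ <-]].
  by exists (map_mx t x) => //; rewrite /Jop tMM mulmxA.
exists (A *m map_mx t x); first by exists (map_mx t x).
by rewrite tMM (map_mxK tP) mulmxA.
Qed.

Lemma J_basis Q : direct_decomp Q [set Jm *m map_mx t v | v in Q] ->
  exists m (A : 'M_(N, m)), [/\ Q = range_mx A,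
    [set Jm *m map_mx t v | v in Q] = range_mx (Jop A) &
    is_iso (row_mx A (Jop A))].
Proof.
move=> dd; have [sQ _ _ _] := dd; have [m [A [iA eA]]] := subspace_basis Kdiv sQ.
exists m, A; rewrite eA J_range; split=> //.
apply: direct_decomp_rangeP => //; last by rewrite -J_range -eA.
move=> x; rewrite -(map_mxK tP x) /Jop -mulmxA -tMM => h.
have : A *m map_mx t x = 0.
  rewrite -[LHS]mulr1z -e1 mulrzA -(JopK (A *m _)) /Jop h.
  by rewrite (map_mx0f (autD tP)) mulmx0 mul0rz.
by move=> /iA ->; rewrite (map_mx0f (autD tP)).
Qed.

Variables (M : 'M[K]_N) (c' : K -> K).
Hypothesis fM : adj c M *~ eps = M.
Hypothesis cons : adj c Jm *m M *m Jm = map_mx t M *~ mu.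
Hypothesis c'E : c' = c \o t.
Local Notation Jfun := (fun v : 'cV[K]_N => Jm *m map_mx t v).

Lemma adj_comp m n (A : 'M_(m, n)) : adj c' A = adj c (map_mx t A).
Proof. by rewrite c'E; apply/matrixP => i j; rewrite !mxE. Qed.

Lemma c'P : is_conj c'.
Proof.
rewrite c'E; split=> [x y|x y|x] /=.
- by rewrite (autD tP) (conjD cP).
- by rewrite (autM tP) (conjM cP).
- by rewrite -ct (autI tP) (conjI cP).
Qed.

Lemma hermE m n (V : 'M_(N, m)) (P : 'M_(N, n)) :
  adj c (adj c V *m M *m P) = (adj c P *m M *m V) *~ eps.
Proof.
have eM : adj c M = M *~ eps by rewrite -{1}fM (adjMz cP) (adjK cP).
by rewrite !(adjM cP) (adjK cP) eM mulmxMzl mulmxMzr mulmxA.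
Qed.

Lemma gram_Jop m n (A : 'M_(N, m)) (B : 'M_(N, n)) :
  adj c (Jop A) *m M *m Jop B = map_mx t (adj c A *m M *m B) *~ mu.
Proof.
have -> : adj c (Jop A) *m M *m Jop B =
    adj c (map_mx t A) *m (adj c Jm *m M *m Jm) *m map_mx t B.
  by rewrite /Jop (adjM cP) !mulmxA.
by rewrite cons !tMM (map_adj ct) mulmxMzr mulmxMzl.
Qed.

Lemma gram_JopC m n (A : 'M_(N, m)) (B : 'M_(N, n)) :
  (adj c A *m M *m Jop B) *~ e = map_mx t (adj c (Jop A) *m M *m B) *~ mu.
Proof.
rewrite -gram_Jop JopK (adjMz cP) !mulmxMzl.
by [].
Qed.

(** M0 is the Gram matrix of the managing form on the span of A. With M = 0 and M0 = 0 the same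
    definition describes a semiinvolution alone. *)
Definition jframe m (A : 'M_(N, m)) (M0 : 'M_m) :=
  frames c t M Jm (adiag c eps M0) (Zmx m) (row_mx A (Jop A)).

Lemma jframeP m (A : 'M_(N, m)) M0 : jframe A M0 <->
  [/\ is_iso (row_mx A (Jop A)), adj c A *m M *m A = 0 & adj c (Jop A) *m M *m A = M0].
Proof.
rewrite /jframe; split=> [[iP]|[iP A0 AM]].
  by rewrite adj_row mul_col_mx mul_col_row /adiag => /eq_block_mx[-> _ -> _] _.
split=> //; last exact: Jop_frame.
rewrite adj_row mul_col_mx mul_col_row A0 AM gram_Jop A0.
rewrite (map_mx0f (autD tP)) mul0rz /adiag; congr block_mx.
by rewrite -[LHS](adjK cP) hermE AM (adjMz cP).
Qed.

(** Exchanging the arguments of B costs eps and c; moving J from one argument to the other costs e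
    mu and t. Together this gives the type (c t, eps e mu) of the managing form on the isotropic
    half. *)
Lemma jframe_form m (A : 'M_(N, m)) M0 : eps * eps = 1 -> injmx M -> jframe A M0 ->
  formmx c' (eps * e * mu) M0.
Proof.
move=> eps1 iM jA; split; last first.
  have [iP eP _] := jA; apply: (@adiag_injmx _ c eps).
  rewrite -eP -mulmxA; apply: injmxM; last by apply: injmxM => //; exact: is_iso_inj.
  by apply: is_iso_inj; exact: adj_iso.
have [_ _ AM] := (jframeP A M0).1 jA.
rewrite adj_comp -(map_adj ct) -{1}AM hermE (map_mxMzf (autD tP)).
have -> : map_mx t (adj c A *m M *m Jop A) = M0 *~ (e * mu).
  by rewrite mulrzA -AM -[LHS]mulr1z -mu1 mulrzA -gram_Jop JopK mulmxMzr.
rewrite -!mulrzA -[RHS]mulr1z; congr (_ *~ _).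
transitivity (e * e * (mu * mu) * (eps * eps)); first by ring.
by rewrite e1 mu1 eps1.
Qed.

(** Commuting with J forces the second block to be t(u), and what remains is congruence of managing
    forms. This one equivalence yields both the stabilizers (M0 = M1) and the separation of
    orbits. *)
Lemma jblock m m' (M0 : 'M_m) (M1 : 'M_m') u v :
  frames c t (adiag c eps M0) (Zmx m) (adiag c eps M1) (Zmx m') (block_mx u 0 0 v) <->
  [/\ is_iso u, v = map_mx t u & adj c' u *m M0 *m u = M1].
Proof.
have simpl0 := (mul0mx, mulmx0, addr0, add0r).
rewrite adj_comp; split=> [[/is_iso_block_diag[iu iv]]|[iu -> eu]].
  rewrite /adiag adj_block !(adj0 cP) !mulmx_block !simpl0 => /eq_block_mx[_ _ e2 _].
  rewrite /Zmx map_block_mx !(map_mx0f (autD tP)) !mulmx_block !simpl0.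
  rewrite mul1mx mulmx1 => /eq_block_mx[_ _ e3 _].
  by split=> //; rewrite e3.
have itu : is_iso (map_mx t u) by exact: (map_mx_iso (autD tP) (autM tP) (aut1 tP) iu).
split; first exact/is_iso_block_diag.
  rewrite /adiag adj_block !(adj0 cP) !mulmx_block !simpl0 eu; congr block_mx.
  rewrite mulmxMzr mulmxMzl; congr (_ *~ _).
  by rewrite -eu !(adjM cP) (adjK cP) mulmxA.
rewrite /Zmx map_block_mx !(map_mx0f (autD tP)) (map_mxK tP) !mulmx_block !simpl0.
by rewrite mul1mx mulmx1 mulmxMzl mulmxMzr mul1mx mulmx1.
Qed.

Lemma jframe_mul m m' (A : 'M_(N, m)) M0 (u : 'M_(m, m')) : is_iso u ->
  jframe A M0 -> jframe (A *m u) (adj c' u *m M0 *m u).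
Proof.
move=> iu jA; rewrite /jframe.
have -> : row_mx (A *m u) (Jop (A *m u)) = row_mx A (Jop A) *m block_mx u 0 0 (map_mx t u).
  by rewrite mul_row_block !mulmx0 addr0 add0r JopM.
by apply: framesM jA _ => //; apply/jblock.
Qed.

Lemma jframe_congr m m' (A : 'M_(N, m)) M0 (M1 : 'M_m') :
  jframe A M0 -> congr_mx c' M0 M1 -> exists A', jframe A' M1.
Proof. by move=> jA [u iu <-]; exists (A *m u); exact: jframe_mul. Qed.

(* Replacing some vectors a of an isotropic frame by J a keeps the frame isotropic and
   twists the corresponding block of the managing form: this moves between the orbits
   of the starred families. *)
Lemma jframe_flip m n (a : 'M_(N, m)) (b : 'M_(N, n)) da db :
  jframe (row_mx a b) (block_mx da 0 0 db) ->
  jframe (row_mx a (Jop b)) (block_mx da 0 0 (map_mx t db *~ mu)).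
Proof.
have JR k l (x : 'M_(N, k)) (y : 'M_(N, l)) : Jop (row_mx x y) = row_mx (Jop x) (Jop y).
  by rewrite /Jop map_row_mx mul_mx_row.
move=> /jframeP[iP]; rewrite JR in iP *.
rewrite adj_row mul_col_mx mul_col_row adj_row mul_col_mx mul_col_row.
rewrite -[X in _ = X -> _](@block_mx0 _ m n m n) => /eq_block_mx[aa ab ba bb].
move=> /eq_block_mx[Jaa Jab Jba Jbb].
apply/jframeP; rewrite !JR JopK; split.
- have Nd := is_iso_dim Kdiv iP; apply: injmx_iso => //; last by rewrite Nd.
  move=> x; rewrite -(vsubmxK x) -(vsubmxK (usubmx x)) -(vsubmxK (dsubmx x)).
  set x1 := usubmx (usubmx x); set x2 := dsubmx (usubmx x).
  set x3 := usubmx (dsubmx x); set x4 := dsubmx (dsubmx x).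
  rewrite !mul_row_col => h.
  (* The new frame consists of a, J b, J a and e b. A linear relation in it is therefore one in the
     old frame, with x2 now attached to J b and x4, multiplied by e, attached to b. *)
  have : row_mx (row_mx a b) (row_mx (Jop a) (Jop b)) *m
      col_mx (col_mx x1 (x4 *~ e)) (col_mx x3 x2) = 0.
    rewrite !mul_row_col -[RHS]h mulmxMzr mulmxMzl -!addrA; congr (_ + _).
    by rewrite addrC -!addrA addrC -!addrA; congr (_ + _); rewrite addrC.
  move/(is_iso_inj iP)/eqP; rewrite !col_mx_eq0 => /andP[/andP[/eqP -> /eqP x40] /andP[/eqP -> /eqP ->]].
  by rewrite -[x4]mulr1z -e1 mulrzA x40 mul0rz !col_mx0.
- rewrite adj_row mul_col_mx mul_col_row aa Jba gram_Jop bb (map_mx0f (autD tP)) mul0rz.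
  by rewrite -[adj c a *m M *m Jop b](adjK cP) hermE Jba mul0rz (adj0 cP) block_mx0.
rewrite adj_row mul_col_mx mul_col_row Jaa gram_Jop ab (map_mx0f (autD tP)) mul0rz.
rewrite !(adjMz cP) !mulmxMzl ba mul0rz; congr block_mx.
by rewrite gram_JopC Jbb.
Qed.

Lemma jframe_split Q : isotropic (gram_form c M) Q -> direct_decomp Q (Jfun @` Q) ->
  exists m (A : 'M_(N, m)), [/\ Q = range_mx A, Jfun @` Q = range_mx (Jop A) &
    jframe A (adj c (Jop A) *m M *m A)].
Proof.
move=> iQ dd; have [m [A [eA eJ iP]]] := J_basis dd; exists m, A; split=> //.
by apply/jframeP; split=> //; apply/(isotropic_range cP); rewrite -eA.
Qed.

Lemma split_pair_jframe : split_pair (gram_form c M) Jfun ->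
  exists m (A : 'M_(N, m)) M0, jframe A M0.
Proof. by move=> [Q iQ /(jframe_split iQ)[m [A [_ _ jA]]]]; exists m, A; exact: ex_intro jA. Qed.

Lemma adiag_sgn m (M0 : 'M_m) : sgn_adapted (adiag c eps M0) (Zmx m).
Proof.
by apply: sgn_adapted_blocks; right; rewrite ?/adiag ?/Zmx block_mxKul block_mxKdr.
Qed.

Lemma blocks_jframe m (M0 : 'M_m) :
  isomorphic (blocks c t (adiag c eps M0) (Zmx m)) (Ugroup (gram_form c' M0)).
Proof.
rewrite (Ugroup_frames c'P); apply/isomorphicP; exists fst; split.
- by move=> [u v] /jblock[iu _ eu]; split=> //; rewrite map_mx_id mul1mx mulmx1.
- by move=> [u v] [u' v'] /jblock[_ /= -> _] /jblock[_ /= -> _] ->.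
- by move=> u [iu eu _]; exists (u, map_mx t u) => //; apply/jblock.
- by [].
Qed.

Section Cover.
Variables (I : finType) (m : I -> nat) (Mf : forall i, 'M[K]_(m i)).
Hypothesis classify : forall k (A : 'M_(N, k)) M0, jframe A M0 ->
  exists i, congr_mx c' M0 (Mf i).

Lemma frames_jframe i P : frames c t M Jm (adiag c eps (Mf i)) (Zmx (m i)) P ->
  exists2 A, P = row_mx A (Jop A) & jframe A (Mf i).
Proof.
move=> fP; have [_ _ /frame_Jop e'] := fP.
by exists (lsubmx P) => //; rewrite /jframe -e'.
Qed.

Lemma jframe_cover k (A : 'M_(N, k)) M0 : jframe A M0 ->
  exists i P, frames c t M Jm (adiag c eps (Mf i)) (Zmx (m i)) P /\
    (range_mx A, range_mx (Jop A)) = span_pair P.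
Proof.
move=> jA; have [i [u iu eu]] := classify jA.
have := jframe_mul iu jA; rewrite eu => jA'.
exists i, (row_mx (A *m u) (Jop (A *m u))); split=> //.
rewrite /span_pair row_mxKl row_mxKr JopM (range_mul_iso A) // (range_mul_iso (Jop A)) //.
exact: (map_mx_iso (autD tP) (autM tP) (aut1 tP) iu).
Qed.

Lemma S_BJ_cover : injmx M -> forall x, S_BJ (gram_form c M) Jfun x <->
  exists i P, frames c t M Jm (adiag c eps (Mf i)) (Zmx (m i)) P /\ x = span_pair P.
Proof.
move=> iM [Q1 Q2]; split=> [[/= [_ iQ _] _ dd JQ]|].
  have [|k [A [eA eJ jA]]] := @jframe_split Q1 iQ; first by rewrite JQ.
  by rewrite -JQ eJ eA; exact: jframe_cover jA.
move=> [i [P [/frames_jframe[A -> jA] ->]]]; rewrite /span_pair row_mxKl row_mxKr.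
have [iP A0 AM] := (jframeP A (Mf i)).1 jA.
have dd := range_direct_decomp iP; rewrite row_mxKl row_mxKr in dd.
have is1 : isotropic (gram_form c M) (range_mx A) by apply/(isotropic_range cP).
have is2 : isotropic (gram_form c M) (range_mx (Jop A)).
  by apply/(isotropic_range cP); rewrite gram_Jop A0 (map_mx0f (autD tP)) mul0rz.
have fM' : formmx c eps M by split.
split=> //=; [| |exact: J_range].
  exact: (complement_max_isotropic cP fM' is1 is2 dd).
exact: (complement_max_isotropic cP fM' is2 is1 (direct_decompC dd)).
Qed.

Lemma S_J_cover : M = 0 -> forall x, S_J Jfun x <->
  exists i P, frames c t M Jm (adiag c eps (Mf i)) (Zmx (m i)) P /\ x = span_pair P.
Proof.
move=> M0 [Q1 Q2]; split=> [[/= dd JQ]|].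
  have [||k [A [eA eJ jA]]] := @jframe_split Q1.
  - by move=> v w _ _; rewrite M0 gram_form0.
  - by rewrite JQ.
  by rewrite -JQ eJ eA; exact: jframe_cover jA.
move=> [i [P [/frames_jframe[A -> jA] ->]]]; rewrite /span_pair row_mxKl row_mxKr.
have [iP _ _] := (jframeP A (Mf i)).1 jA.
have dd := range_direct_decomp iP; rewrite row_mxKl row_mxKr in dd.
by split=> //=; exact: J_range.
Qed.

Lemma list1_orbits_family (R1 : pzRingType) (R2 : I -> pzRingType)
    (G0 : ugroup R1) (H : forall i, ugroup (R2 i)) : injmx M ->
  isomorphic (centralizer (Ugroup (gram_form c M)) Jfun) G0 ->
  (forall i, exists A, jframe A (Mf i)) ->
  (forall i j, congr_mx c' (Mf i) (Mf j) -> i = j) ->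
  (forall i, isomorphic (Ugroup (gram_form c' (Mf i))) (H i)) ->
  orbits_family (centralizer (Ugroup (gram_form c M)) Jfun)
    (S_BJ (gram_form c M) Jfun) G0 H.
Proof.
move=> iM GG0 ne uniq UH.
apply: (frames_orbits_family cP tP K2 (centralizer_frames cP tP M Jm) (S_BJ_cover iM)) => //.
- by move=> i; exact: adiag_sgn.
- by move=> i; have [A jA] := ne i; exists (row_mx A (Jop A)).
- move=> i j P P' fP fP' e'.
  have [iP _ _] := fP; have [iP' _ _] := fP'.
  have [u [v [_ _ e2]]] := span_eq_diag iP iP' e'.
  (* Frames with the same span differ by a block-diagonal matrix; composing with the inverse of the
     first frame shows that this matrix is an isomorphism between the two normal forms, so [jblock]
     gives their congruence. *)
  have [W [fW WP _]] := framesV cP tP fP.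
  have := framesM cP tP fW fP'; rewrite e2 mulmxA WP mul1mx => /jblock[iu _ eu].
  by apply: uniq; exists u.
- by move=> i; apply: isomorphic_trans (UH i); exact: blocks_jframe.
Qed.

Lemma list1_transitive_family i0 (R1 R2 : pzRingType) (G0 : ugroup R1) (H : ugroup R2) :
  (forall i, i = i0) -> injmx M -> split_pair (gram_form c M) Jfun ->
  isomorphic (centralizer (Ugroup (gram_form c M)) Jfun) G0 ->
  isomorphic (Ugroup (gram_form c' (Mf i0))) H ->
  transitive_family (centralizer (Ugroup (gram_form c M)) Jfun)
    (S_BJ (gram_form c M) Jfun) G0 H.
Proof.
move=> I1 iM sp GG0 UH.
apply: (frames_transitive_family cP tP K2 (centralizer_frames cP tP M Jm) (S_BJ_cover iM) _ I1) => //.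
- by move=> i; exact: adiag_sgn.
- have [k [A [M0 /jframe_cover[i [P [fP _]]]]]] := split_pair_jframe sp.
  by move: P fP; rewrite (I1 i) => P fP; exists P.
- by apply: isomorphic_trans UH; exact: blocks_jframe.
Qed.

Lemma list3_transitive_family i0 (R1 R2 : pzRingType) (G0 : ugroup R1) (H : ugroup R2) :
  (forall i, i = i0) -> M = 0 -> split_semiinvolution Jfun ->
  isomorphic (centralizer (GL K N) Jfun) G0 ->
  isomorphic (Ugroup (gram_form c' (Mf i0))) H ->
  transitive_family (centralizer (GL K N) Jfun) (S_J Jfun) G0 H.
Proof.
move=> I1 M0 [Q dd] GG0 UH; have cov := S_J_cover M0.
have GE := centralizer_GL_frames cP tP Jm; rewrite -M0 in GE.
apply: (frames_transitive_family cP tP K2 GE cov _ I1) => //.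
- by move=> i; exact: adiag_sgn.
- have [|k [A [_ _ /jframe_cover[i [P [fP _]]]]]] := jframe_split _ dd.
    by move=> v w _ _; rewrite M0 gram_form0.
  by move: P fP; rewrite (I1 i) => P fP; exists P.
- by apply: isomorphic_trans UH; exact: blocks_jframe.
Qed.

End Cover.

Section Star.
Variable d : K.
Hypothesis td : t d *~ mu = - d.

(** Flipping the q vectors of value -d gives them value d, because [td] says exactly that J reverses
    the sign of d. Any frame thus leads to the constant one, from which G is identified and all
    signatures are produced by flipping back. *)
Lemma jframe_positive k (A : 'M_(N, k)) M0 p q : jframe A M0 ->
  congr_mx c' M0 (d *: Ipq K p q) -> exists A' : 'M_(N, k), jframe A' (d%:M : 'M_k).
Proof.
move=> jA cM; have [A' jA'] := jframe_congr jA cM.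
have [P /(is_iso_dim Kdiv) kpq _] := cM; subst k.
move: jA'; rewrite scale_Ipq -{1}(hsubmxK A') => /jframe_flip jA'.
exists (row_mx (lsubmx A') (Jop (rsubmx A'))); move: jA'.
rewrite -raddfN map_mx_scalarf ?(autD tP) //; last exact: (autD tP).
by rewrite (addN (autD tP)) -raddfMz mulNrz td opprK -scalar_mx_block.
Qed.

Lemma jframe_all_signs k (A : 'M_(N, k)) p q : jframe A (d%:M : 'M_k) -> k = (p + q)%N ->
  exists A', jframe A' (d *: Ipq K p q).
Proof.
move=> jA kpq; subst k; move: jA; rewrite scalar_mx_block -(hsubmxK A) => /jframe_flip.
rewrite map_mx_scalarf; last exact: (autD tP).
by rewrite -raddfMz td raddfN -scale_Ipq; eexists; eassumption.
Qed.
End Star.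

End Lists1and3.

Lemma frames_id (K : nzRingType) (c : K -> K) N n (M : 'M[K]_N) (S : 'M_n) P :
  frames c id M 1%:M S 1%:M P <-> is_iso P /\ adj c P *m M *m P = S.
Proof.
split=> [[]//|[iP e]]; split=> //; by rewrite map_mx_id mul1mx mulmx1.
Qed.

Lemma UgroupP (K : nzRingType) (c : K -> K) N (M g : 'M[K]_N) : is_conj c ->
  ug_set (Ugroup (gram_form c M)) g <-> is_iso g /\ adj c g *m M *m g = M.
Proof. by move=> cP; rewrite (Ugroup_frames cP); exact: frames_id. Qed.

(** * Complementary isotropic pairs and orthogonal decompositions *)

Section Lists2and4.
Variables (K : nzRingType) (c : K -> K) (eps : int).
Hypotheses (cP : is_conj c) (Kdiv : skewfield K) (K2 : no_2torsion K).
Variables (N : nat) (M : 'M[K]_N).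
Hypothesis fM : formmx c eps M.

Lemma gram_lsub a b (P : 'M_(N, a + b)) S11 S12 S21 S22 :
  adj c P *m M *m P = block_mx S11 S12 S21 S22 ->
  [/\ adj c (lsubmx P) *m M *m lsubmx P = S11, adj c (lsubmx P) *m M *m rsubmx P = S12,
      adj c (rsubmx P) *m M *m lsubmx P = S21 & adj c (rsubmx P) *m M *m rsubmx P = S22].
Proof.
by rewrite -{1 2}(hsubmxK P) adj_row mul_col_mx mul_col_row => /eq_block_mx[].
Qed.

Lemma block_anti_injmx a b (X : 'M[K]_(a, b)) (Y : 'M_(b, a)) :
  injmx (block_mx 0 X Y 0) -> injmx X /\ injmx Y.
Proof.
move=> iS; split=> x h.
  have /iS/eqP : block_mx 0 X Y 0 *m col_mx 0 x = 0.
    by rewrite mul_block_col !(mulmx0, mul0mx, addr0, add0r) h col_mx0.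
  by rewrite col_mx_eq0 => /andP[_ /eqP].
have /iS/eqP : block_mx 0 X Y 0 *m col_mx x 0 = 0.
  by rewrite mul_block_col !(mulmx0, mul0mx, addr0, add0r) h col_mx0.
by rewrite col_mx_eq0 => /andP[/eqP].
Qed.

Lemma gram_is_injmx n (P : 'M_(N, n)) : is_iso P -> injmx (adj c P *m M *m P).
Proof.
move=> iP; have [_ iM] := fM; rewrite -mulmxA.
apply: injmxM; first by apply: is_iso_inj; exact: adj_iso.
by apply: injmxM => //; exact: is_iso_inj.
Qed.

(** For isotropic halves with bases A and B, nondegeneracy makes the pairing block injective in both
    directions, so both halves have dimension n. Replacing A by A times the inverse of the pairing
    makes the pairing the identity. *)
Lemma S_B_cover n : N = (n + n)%N -> forall x, S_B (gram_form c M) x <->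
  exists (_ : unit) P, frames c id M 1%:M (adiag c eps (1%:M : 'M_n)) 1%:M P /\ x = span_pair P.
Proof.
move=> Nn [Q1 Q2]; split=> [[/= [_ iQ1 _] [_ iQ2 _] dd]|].
  have [a [b [A [B [eA eB iP]]]]] := direct_decomp_basis Kdiv dd.
  rewrite eA eB in iQ1 iQ2 *.
  have /(isotropic_range cP) AA := iQ1; have /(isotropic_range cP) BB := iQ2.
  have := gram_is_injmx iP; rewrite adj_row mul_col_mx mul_col_row AA BB.
  move=> /block_anti_injmx[/(injmx_leq Kdiv) ba iY].
  have ab := injmx_leq Kdiv iY.
  have Nab := is_iso_dim Kdiv iP.
  have an : a = n by lia.
  have bn : b = n by lia.
  subst a b.
  have [Y' [Y'Y YY']] := injmx_iso Kdiv iY ba.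
  exists tt, (row_mx (A *m Y') B); split; last first.
    rewrite /span_pair row_mxKl row_mxKr range_mul_iso //.
    by exists (adj c B *m M *m A).
  apply/frames_id; split.
    have -> : row_mx (A *m Y') B = row_mx A B *m block_mx Y' 0 0 1%:M.
      by rewrite mul_row_block !mulmx0 addr0 add0r mulmx1.
    apply: is_isoM => //; apply/is_iso_block_diag; split; last exact: is_iso1.
    by exists (adj c B *m M *m A).
  have e1 : adj c B *m M *m (A *m Y') = 1%:M by rewrite mulmxA YY'.
  rewrite adj_row mul_col_mx mul_col_row e1 BB /adiag; congr block_mx.
    by rewrite (adjM cP) mulmxA -!(mulmxA (adj c Y')) AA mul0mx mulmx0.
  by rewrite -[LHS](adjK cP) (gram_adj cP _ _ fM) e1 (adjMz cP).
move=> [_ [P [/frames_id[iP eP] ->]]].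
have [AA _ _ BB] := gram_lsub eP; have dd := range_direct_decomp iP.
have is1 : isotropic (gram_form c M) (range_mx (lsubmx P)) by apply/(isotropic_range cP).
have is2 : isotropic (gram_form c M) (range_mx (rsubmx P)) by apply/(isotropic_range cP).
split=> //.
  exact: (complement_max_isotropic cP fM is1 is2 dd).
exact: (complement_max_isotropic cP fM is2 is1 (direct_decompC dd)).
Qed.

Lemma list2_transitive_family n (R1 : pzRingType) (G0 : ugroup R1) :
  congr_mx c M (adiag c eps (1%:M : 'M_n)) ->
  isomorphic (Ugroup (gram_form c M)) G0 ->
  transitive_family (Ugroup (gram_form c M)) (S_B (gram_form c M)) G0 (GL K n).
Proof.
move=> [P iP eP] GG0.
have := S_B_cover (is_iso_dim Kdiv iP) => cov.
apply: (frames_transitive_family cP (is_aut_id K) K2 (Ugroup_frames cP M) cov _ (i0 := tt)) => //.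
- by move=> _; apply: sgn_adapted1; right; rewrite /adiag block_mxKul block_mxKdr.
- by case.
- by exists P; apply/frames_id.
- by apply: blocks_adiag => //; exact: is_iso1.
Qed.

(** Pairing a vector w with the first half only sees the component of w in that half, and M1 is
    injective; so w orthogonal to the first half lies in the second. *)
Lemma orthogonal_complement_range a b (P : 'M_(N, a + b)) M1 M2 : is_iso P ->
  injmx M1 -> adj c P *m M *m P = block_mx M1 0 0 M2 ->
  range_mx (rsubmx P) = orthogonal_complement (gram_form c M) (range_mx (lsubmx P)).
Proof.
move=> iP i1 /gram_lsub[e11 e12 e21 e22].
apply/seteqP; split=> [_ [x _ <-] _ [y _ <-]|w h].
  by rewrite gram_formE (adjM cP) !mulmxA -2!(mulmxA (adj c x)) e21 mulmx0 mul0mx mxE.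
have [P' [P'P PP']] := iP.
have wE : w = lsubmx P *m usubmx (P' *m w) + rsubmx P *m dsubmx (P' *m w).
  by rewrite -mul_row_col hsubmxK vsubmxK mulmxA PP' mul1mx.
move: wE; set x := usubmx _; set y := dsubmx _ => wE.
suff x0 : x = 0 by rewrite wE x0 mulmx0 add0r; exists y.
have ww : adj c w *m M *m lsubmx P = 0.
  apply/rowP => j; have : range_mx (lsubmx P) (lsubmx P *m delta_mx j 0) by eexists.
  by move=> /h; rewrite gram_formE mulmxA -colE mxE => ->; rewrite mxE.
have : adj c (lsubmx P) *m M *m w = 0.
  by rewrite -[LHS](adjK cP) (gram_adj cP _ _ fM) ww mul0rz (adj0 cP).
by rewrite wE mulmxDr !mulmxA e11 e12 mul0mx addr0 => /i1.
Qed.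

Section List4.
Variables (m : nat) (I : finType) (a b : I -> nat).
Variables (M1 : forall i, 'M[K]_(a i)) (M2 : forall i, 'M[K]_(b i)).
Hypothesis am : forall i, a i = m.
Hypothesis iM1 : forall i, injmx (M1 i).
Hypothesis classify : forall k (d1 : 'M[K]_m) (d2 : 'M_k),
  formmx c eps d1 -> formmx c eps d2 -> congr_mx c M (block_mx d1 0 0 d2) ->
  exists i, congr_mx c d1 (M1 i) /\ congr_mx c d2 (M2 i).

Lemma gram_herm n (P : 'M_(N, n)) :
  adj c (adj c P *m M *m P) *~ eps = adj c P *m M *m P.
Proof.
have [eM _] := fM.
by rewrite !(adjM cP) (adjK cP) -mulmxMzr -mulmxMzl eM mulmxA.
Qed.

Lemma block_diag_injmx p q (d1 : 'M[K]_p) (d2 : 'M[K]_q) :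
  injmx (block_mx d1 0 0 d2) -> injmx d1 /\ injmx d2.
Proof.
move=> /(injmx_iso Kdiv)/(_ (leqnn _))/is_iso_block_diag[? ?].
by split; exact: is_iso_inj.
Qed.

Lemma S_D_cover x : S_D (gram_form c M) m x <->
  exists i P, frames c id M 1%:M (block_mx (M1 i) 0 0 (M2 i)) 1%:M P /\ x = span_pair P.
Proof.
case: x => Q1 Q2; split=> [[/= [A iA eA] dd eQ2]|].
  rewrite -/(range_mx A) in eA.
  have [_ sQ2 _ _] := dd.
  have [k [B [iB eB]]] := subspace_basis Kdiv sQ2.
  rewrite eA eB in dd eQ2 *; have iP := direct_decomp_rangeP iA iB dd.
  have BA : adj c B *m M *m A = 0.
    apply/matrixP => i j; rewrite -[LHS](adj_delta_mul cP) [RHS]mxE.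
    have : range_mx B (B *m delta_mx i 0) by eexists.
    rewrite eQ2 => /(_ (A *m delta_mx j 0) (mem_range_mx _ _)).
    by rewrite gram_formE (adjM cP) !mulmxA.
  have AB : adj c A *m M *m B = 0.
    by rewrite -[LHS](adjK cP) (gram_adj cP _ _ fM) BA mul0rz (adj0 cP).
  have eP : adj c (row_mx A B) *m M *m row_mx A B =
      block_mx (adj c A *m M *m A) 0 0 (adj c B *m M *m B).
    by rewrite adj_row mul_col_mx mul_col_row AB BA.
  have := gram_is_injmx iP; rewrite eP => /block_diag_injmx[i1 i2].
  have [|||i [[u iu eu] [v iv ev]]] := @classify k (adj c A *m M *m A) (adj c B *m M *m B).
  - by split=> //; exact: gram_herm.
  - by split=> //; exact: gram_herm.
  - by exists (row_mx A B).
  exists i, (row_mx A B *m block_mx u 0 0 v); split; last first.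
    by rewrite span_mul_diag // /span_pair row_mxKl row_mxKr.
  apply/frames_id; split; first by apply: is_isoM => //; exact/is_iso_block_diag.
  rewrite (adjM cP) -!mulmxA (mulmxA M) (mulmxA (adj c (row_mx A B))) (mulmxA (adj c _) M) eP.
  rewrite adj_block !(adj0 cP) !mulmx_block !(mulmx0, mul0mx, addr0, add0r).
  by rewrite -eu -ev !mulmxA.
move=> [i [P [/frames_id[iP eP] ->]]]; split=> /=.
- have := injmx_lsub (is_iso_inj iP); rewrite /span_pair /=.
  by move: (lsubmx P); rewrite (am i) => A iA; exists A.
- exact: range_direct_decomp.
- exact: orthogonal_complement_range eP.
Qed.

Lemma block_diag_sgn i : sgn_adapted (block_mx (M1 i) 0 0 (M2 i)) 1%:M.
Proof. by apply: sgn_adapted1; left; rewrite block_mxKur block_mxKdl. Qed.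

Lemma blocks_diag i : blocks c id (block_mx (M1 i) 0 0 (M2 i)) 1%:M =
  ug_set (ug_prod (Ugroup (gram_form c (M1 i))) (Ugroup (gram_form c (M2 i)))).
Proof.
have E u v : adj c (block_mx u 0 0 v) *m block_mx (M1 i) 0 0 (M2 i) *m block_mx u 0 0 v =
    block_mx (adj c u *m M1 i *m u) 0 0 (adj c v *m M2 i *m v).
  by rewrite adj_block !(adj0 cP) !mulmx_block !(mulmx0, mul0mx, addr0, add0r).
apply/seteqP; split=> -[u v].
  move=> /frames_id[/is_iso_block_diag[iu iv]]; rewrite E => /eq_block_mx[e1 _ _ e2].
  by split; apply/(UgroupP _ _ cP).
move=> [/= /(UgroupP _ _ cP)[iu eu] /(UgroupP _ _ cP)[iv ev]]; apply/frames_id.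
by rewrite E eu ev; split=> //; exact/is_iso_block_diag.
Qed.

Lemma congr_frames_id i : congr_mx c M (block_mx (M1 i) 0 0 (M2 i)) ->
  exists P, frames c id M 1%:M (block_mx (M1 i) 0 0 (M2 i)) 1%:M P.
Proof. by move=> [P iP eP]; exists P; apply/frames_id. Qed.

Lemma list4_orbits_family (R1 : pzRingType) (R2 : I -> pzRingType)
    (G0 : ugroup R1) (H : forall i, ugroup (R2 i)) :
  isomorphic (Ugroup (gram_form c M)) G0 ->
  (forall i, congr_mx c M (block_mx (M1 i) 0 0 (M2 i))) ->
  (forall i j, congr_mx c (M1 i) (M1 j) -> i = j) ->
  (forall i, isomorphic (ug_prod (Ugroup (gram_form c (M1 i)))
                                 (Ugroup (gram_form c (M2 i)))) (H i)) ->
  orbits_family (Ugroup (gram_form c M)) (S_D (gram_form c M) m) G0 H.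
Proof.
move=> GG0 ne uniq UH.
apply: (frames_orbits_family cP (is_aut_id K) K2 (Ugroup_frames cP M) S_D_cover) => //.
- exact: block_diag_sgn.
- by move=> i; exact: congr_frames_id (ne i).
- move=> i j P P' fP fP' e'.
  have [iP _ _] := fP; have [iP' _ _] := fP'.
  have [u [v [iu _ e2]]] := span_eq_diag iP iP' e'.
  have [W [fW WP _]] := framesV cP (is_aut_id K) fP.
  have := framesM cP (is_aut_id K) fW fP'; rewrite e2 mulmxA WP mul1mx => /frames_id[_].
  rewrite adj_block !(adj0 cP) !mulmx_block !(mulmx0, mul0mx, addr0, add0r).
  by move=> /eq_block_mx[eu _ _ _]; apply: uniq; exists u.
- by move=> i; rewrite blocks_diag; exact: UH.
Qed.

Lemma list4_transitive_family i0 (R1 R2 : pzRingType) (G0 : ugroup R1) (H : ugroup R2) :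
  (forall i, i = i0) ->
  isomorphic (Ugroup (gram_form c M)) G0 ->
  congr_mx c M (block_mx (M1 i0) 0 0 (M2 i0)) ->
  isomorphic (ug_prod (Ugroup (gram_form c (M1 i0))) (Ugroup (gram_form c (M2 i0)))) H ->
  transitive_family (Ugroup (gram_form c M)) (S_D (gram_form c M) m) G0 H.
Proof.
move=> I1 GG0 cM UH.
apply: (frames_transitive_family cP (is_aut_id K) K2 (Ugroup_frames cP M) S_D_cover _ I1) => //.
- exact: block_diag_sgn.
- exact: congr_frames_id.
- by rewrite blocks_diag.
Qed.

End List4.

End Lists2and4.

(** The structure is M = 0 and J = 1, for which frames are all invertible matrices. *)
Lemma list5_transitive (K : nzRingType) (c : K -> K) p q : is_conj c ->
  skewfield K -> no_2torsion K -> list5 K (p + q) p q (GL K (p + q)) (ug_prod (GL K p) (GL K q)).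
Proof.
move=> cP Kdiv K2.
have cov x : S_dims p q x <-> exists (_ : unit) P,
    frames c id (0 : 'M[K]_(p + q)) 1%:M (0 : 'M_(p + q)) 1%:M P /\ x = span_pair P.
  case: x => Q1 Q2; split=> [[/= [A iA eA] [B iB eB] dd]|].
    rewrite -/(range_mx A) in eA; rewrite -/(range_mx B) in eB.
    rewrite eA eB in dd *; have iP := direct_decomp_rangeP iA iB dd.
    exists tt, (row_mx A B); split; last by rewrite /span_pair row_mxKl row_mxKr.
    by apply/frames_id; rewrite mulmx0 mul0mx.
  move=> [_ [P [/frames_id[iP _] ->]]]; split=> /=.
  - by exists (lsubmx P) => //; exact/injmx_lsub/is_iso_inj.
  - by exists (rsubmx P) => //; exact/injmx_rsub/is_iso_inj.
  - exact: range_direct_decomp.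
apply: (frames_transitive_family cP (is_aut_id K) K2 (GL_frames c _) cov _ (i0 := tt)) => //.
- by move=> _; apply: sgn_adapted1; left; split; apply/matrixP => i j; rewrite !mxE.
- by case.
- exact: isomorphic_refl.
- by exists 1%:M; apply/frames_id; rewrite mulmx0 mul0mx; split=> //; exact: is_iso1.
have -> : blocks c id (0 : 'M[K]_(p + q)) 1%:M = ug_set (ug_prod (GL K p) (GL K q)).
  apply/seteqP; split=> [[u v] /frames_id[/is_iso_block_diag[/GL_setE ? /GL_setE ?]]//|].
  move=> [u v] [/= /GL_setE iu /GL_setE iv]; apply/frames_id; rewrite mulmx0 mul0mx; split=> //.
  exact/is_iso_block_diag.
exact: isomorphic_refl.
Qed.

(** * Identification of the groups *)

Lemma mulmx_scalarE (K : nzRingType) m n (A : 'M[K]_(m, n)) z :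
  A *m z%:M = \matrix_(i, j) (A i j * z).
Proof.
apply/matrixP => i j; rewrite !mxE (bigD1 j) //= !mxE eqxx mulr1n big1 ?addr0 //.
by move=> k kj; rewrite mxE (negPf kj) mulr0.
Qed.

Lemma Ugroup0 (K : nzRingType) (c : K -> K) n : is_conj c ->
  Ugroup (gram_form c (0 : 'M[K]_n)) = GL K n.
Proof.
move=> cP; apply: ugroup_eq; apply/seteqP; split=> g.
  by move=> /(UgroupP _ _ cP)[/GL_setE].
by move=> /GL_setE ig; apply/(UgroupP _ _ cP); rewrite mulmx0 mul0mx.
Qed.

(** * The commutant of J as a matrix ring over another ring *)

Section Embedding.
Variables (K L : nzRingType) (c t : K -> K) (c2 : L -> L).
Hypotheses (cP : is_conj c) (tP : is_aut t) (c2P : is_conj c2).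
Variables (N n m : nat) (M Jm : 'M[K]_N) (S Z : 'M[K]_n) (P : 'M[K]_(N, n)).
Hypothesis fP : frames c t M Jm S Z P.
Variables (rho : 'M[L]_m -> 'M[K]_n) (T : 'M[L]_m).
Hypotheses (rhoM : forall X Y, rho (X *m Y) = rho X *m rho Y) (rho1 : rho 1%:M = 1%:M).
Hypothesis rho_inj : injective rho.
Hypothesis rhoZ : forall g, Z *m map_mx t g = g *m Z <-> exists X, g = rho X.
Hypothesis rhoS : forall X,
  adj c (rho X) *m S *m rho X = S <-> adj c2 X *m T *m X = T.

(** By [rhoZ] the map rho identifies matrices over L with the operators commuting with J in the
    given frame, and by [rhoS] it matches the two invariance conditions. *)
Lemma embedding_isomorphic :
  isomorphic (frames c t M Jm M Jm) (Ugroup (gram_form c2 T)).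
Proof.
apply: isomorphic_trans (frames_conj_isomorphic cP tP fP) _.
apply: isomorphic_sym => [g h|]; first exact: ugM.
apply/isomorphicP; exists rho; split=> [X /(UgroupP _ _ c2P)[[X' [X'X XX']] eX]|X Y _ _ /rho_inj//|g fg|X Y _ _]; last exact: rhoM.
  split; [exists (rho X')|exact/rhoS|by apply/rhoZ; exists X].
  by rewrite -!rhoM X'X XX' rho1.
have [[g' [g'g gg']] gS /rhoZ[X e]] := fg; rewrite e in gS g'g gg' *.
exists X => //; apply/(UgroupP _ _ c2P); split; last exact/rhoS.
(* The inverse of an automorphism again commutes with J, hence comes from a matrix over L, which
   inverts X by injectivity of rho. *)
have [g2 [[_ _ /rhoZ[X' e']] g2g gg2]] := framesV cP tP fg.
exists X'; split; apply: rho_inj; rewrite rhoM rho1 -e' -e //.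
Qed.

End Embedding.

Section RealForm.
Variables (K L : nzRingType) (c t : K -> K) (c2 : L -> L) (iota : L -> K).
Hypotheses (cP : is_conj c) (tP : is_aut t) (c2P : is_conj c2).
Hypotheses (iD : {morph iota : x y / x + y}) (iM : {morph iota : x y / x * y})
  (i1 : iota 1 = 1) (iI : injective iota).
Variable z s : K.
Hypothesis z_iota : forall x, z * t x = x * z <-> exists y, x = iota y.
Hypothesis s_cancel : forall x, s * x = 0 -> x = 0.
Hypothesis cs : forall y, c (iota y) * s = s * iota (c2 y).
Variables (N n : nat) (M Jm : 'M[K]_N) (P : 'M[K]_(N, n)).

Lemma map_iota_inj k l : injective (map_mx iota : 'M_(k, l) -> 'M_(k, l)).
Proof.
by move=> X Y /matrixP e; apply/matrixP => i j; apply: iI; move: (e i j); rewrite !mxE.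
Qed.

Lemma adj_iota k l p (X : 'M[L]_(k, l)) (Y : 'M_(k, p)) : adj c (map_mx iota X) *m (s *: map_mx iota Y) =
  s *: map_mx iota (adj c2 X *m Y).
Proof.
apply/matrixP => i j; rewrite !mxE (add_sum iD) big_distrr /=; apply: eq_bigr => k' _.
by rewrite !mxE mulrA cs -mulrA iM.
Qed.

(** When J reads v |-> z t(v), commuting with J is a condition on each matrix entry separately, and
    [z_iota] says that its solutions are the scalars from L. *)
Lemma real_form_isomorphic (T : 'M[L]_n) :
  frames c t M Jm (s *: map_mx iota T) z%:M P ->
  isomorphic (frames c t M Jm M Jm) (Ugroup (gram_form c2 T)).
Proof.
move=> fP; apply: (embedding_isomorphic cP tP c2P fP (rho := map_mx iota)).
- by move=> X Y; exact: map_mxMf.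
- exact: map_mx1f.
- exact: map_iota_inj.
- move=> g; split=> [/matrixP h|[X ->]].
    have /choice[f fE] : forall ij : 'I_n * 'I_n, exists y, g ij.1 ij.2 = iota y.
      move=> [i j] /=; apply/z_iota; have := h i j.
      by rewrite mul_scalar_mx mulmx_scalarE !mxE.
    by exists (\matrix_(i, j) f (i, j)); apply/matrixP => i j; rewrite !mxE -fE.
  apply/matrixP => i j; rewrite mul_scalar_mx mulmx_scalarE !mxE.
  by apply/z_iota; eexists.
- move=> X; rewrite adj_iota -scalemxAl -(map_mxMf iD iM); split=> [/matrixP e|-> //].
  apply: map_iota_inj; apply/matrixP => i j; apply/eqP; rewrite -subr_eq0; apply/eqP/s_cancel.
  by have := e i j; rewrite !mxE mulrBr => ->; rewrite subrr.
Qed.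

Lemma adj_scale_iota k (X : 'M[L]_k) :
  adj c (s *: map_mx iota X) = \matrix_(i, j) (c (iota (X j i)) * c s).
Proof. by apply/matrixP => i j; rewrite !mxE (conjM cP). Qed.

(** Consistency of B with J gives c(z) x z = t(x) mu for every Gram entry x, and the solutions of
    this equation form s times the image of L. Dividing by s multiplies the symmetry sign by sgm,
    where c(s) = sgm s. *)
Lemma real_form_gram mu eps sgm : (forall x, c (t x) = t (c x)) ->
  (forall x, c z * x * z = t x *~ mu -> exists y, x = s * iota y) -> c s = s *~ sgm ->
  adj c Jm *m M *m Jm = map_mx t M *~ mu -> formmx c eps M ->
  is_iso P -> Jm *m map_mx t P = P *m z%:M ->
  exists T, frames c t M Jm (s *: map_mx iota T) z%:M P /\ formmx c2 (sgm * eps) T.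
Proof.
move=> ct zs css cons fM iP PZ; set S := adj c P *m M *m P.
have zSz : (c z)%:M *m S *m z%:M = map_mx t S *~ mu.
  have -> : (c z)%:M *m S *m z%:M = adj c (P *m z%:M) *m M *m (P *m z%:M).
    by rewrite (adjM cP) (adj_scalar cP) !mulmxA.
  rewrite -PZ (adjM cP).
  have -> : adj c (map_mx t P) *m adj c Jm *m M *m (Jm *m map_mx t P) =
      adj c (map_mx t P) *m (adj c Jm *m M *m Jm) *m map_mx t P by rewrite !mulmxA.
  by rewrite cons !(map_mxMf (autD tP) (autM tP)) (map_adj ct) mulmxMzr mulmxMzl.
have /choice[f fE] : forall ij : 'I_n * 'I_n, exists y, S ij.1 ij.2 = s * iota y.
  move=> [i j] /=; apply: zs; have /matrixP/(_ i j) := zSz.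
  by rewrite mul_scalar_mx mulmx_scalarE mxMzE !mxE.
pose T : 'M[L]_n := \matrix_(i, j) f (i, j).
have ST : S = s *: map_mx iota T by apply/matrixP => i j; rewrite (fE (i, j)) !mxE.
have iS := gram_is_injmx cP fM iP; rewrite -/S in iS.
exists T; split; first by split.
split.
  apply/matrixP => i j; have /matrixP/(_ i j) := gram_herm cP fM P.
  rewrite -/S ST adj_scale_iota !mxMzE !mxE css mulrzAr cs -mulrzA -mulrzAr -(addMz iD).
  move=> h; apply: iI; apply/eqP; rewrite -subr_eq0; apply/eqP/s_cancel.
  by rewrite mulrBr h subrr.
move=> x Tx; have : S *m map_mx iota x = 0.
  by rewrite ST -scalemxAl -(map_mxMf iD iM) Tx (map_mx0f iD) scaler0.
move/iS/colP => h; apply/colP => i; apply: iI; rewrite mxE (add0 iD).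
by have := h i; rewrite !mxE.
Qed.

Lemma map_iota_iso k l (Y : 'M[L]_(k, l)) : is_iso Y -> is_iso (map_mx iota Y).
Proof. by move=> iY; exact: (map_mx_iso iD iM i1 iY). Qed.

Lemma real_form_congr k (T : 'M[L]_n) (S0 : 'M[L]_k) :
  frames c t M Jm (s *: map_mx iota T) z%:M P -> congr_mx c2 T S0 ->
  congr_mx c M (s *: map_mx iota S0).
Proof.
move=> [iP eP _] [Y iY <-]; exists (P *m map_mx iota Y).
  by apply: is_isoM => //; exact: map_iota_iso.
rewrite (adjM cP).
have -> : adj c (map_mx iota Y) *m adj c P *m M *m (P *m map_mx iota Y) =
    adj c (map_mx iota Y) *m (adj c P *m M *m P) *m map_mx iota Y by rewrite !mulmxA.
by rewrite eP adj_iota -scalemxAl -(map_mxMf iD iM).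
Qed.

(** In a frame with J = z t, the managing form is c(z) times B. This transfers inertia between D on
    V and the form T over L that defines G. *)
Lemma real_form_managing k (T : 'M[L]_n) (S0 : 'M[L]_k) :
  (forall x, c (t x) = t (c x)) ->
  frames c t M Jm (s *: map_mx iota T) z%:M P -> congr_mx c2 T S0 ->
  congr_mx (c \o t) (adj c Jm *m M) ((c z * s) *: map_mx iota S0).
Proof.
move=> ct [iP eP PZ] [Y iY <-]; exists (P *m map_mx iota Y).
  by apply: is_isoM => //; exact: map_iota_iso.
have -> : adj (c \o t) (P *m map_mx iota Y) = adj c (map_mx t (P *m map_mx iota Y)).
  by apply/matrixP => i j; rewrite ![in RHS]mxE !mxE.
rewrite (mulmxA _ (adj c Jm)) -(adjM cP) (map_mxMf (autD tP) (autM tP)) (mulmxA Jm) PZ.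
have -> : P *m z%:M *m map_mx t (map_mx iota Y) = P *m map_mx iota Y *m z%:M.
  rewrite -!mulmxA; congr (_ *m _); apply/matrixP => i j.
  rewrite mul_scalar_mx mulmx_scalarE !mxE; apply/z_iota; by eexists.
rewrite (adjM cP) (adj_scalar cP) (adjM cP).
have -> : (c z)%:M *m (adj c (map_mx iota Y) *m adj c P) *m M *m (P *m map_mx iota Y) =
    (c z)%:M *m (adj c (map_mx iota Y) *m (adj c P *m M *m P) *m map_mx iota Y).
  by rewrite !mulmxA.
by rewrite eP adj_iota -scalemxAl -(map_mxMf iD iM) mul_scalar_mx scalerA.
Qed.
End RealForm.

Section Structures.
Variables (K : nzRingType) (c t : K -> K) (e : int).
Hypotheses (cP : is_conj c) (tP : is_aut t) (Kdiv : skewfield K) (K2 : no_2torsion K).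
Variables (N m : nat) (Jm : 'M[K]_N).
Hypothesis JJ : Jm *m map_mx t Jm = 1%:M *~ e.
Variable A : 'M[K]_(N, m).
Hypothesis iAJ : is_iso (row_mx A (Jop t Jm A)).

Lemma add_mx0 k l (x : 'M[K]_(k, l)) : x + x = 0 -> x = 0.
Proof. by move=> /matrixP h; apply/matrixP => i j; rewrite mxE; apply: K2; move: (h i j); rewrite !mxE. Qed.

(** With B = J A one has J(A + B a) = A z + B = (A + B a) z, and likewise J(A - B a) = -(A - B a) z.
    The factor b, for which z t(b) = -b z, corrects the sign of the second half. *)
Lemma real_structure a b b' z : a * z = 1 -> z * a = 1 -> b' * b = 1 -> z * t b = - (b * z) ->
  t a *~ e = z -> exists P : 'M[K]_(N, m + m), is_iso P /\ Jm *m map_mx t P = P *m z%:M.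
Proof.
move=> az za bb zb ta; set B := Jop t Jm A.
have JA : Jm *m map_mx t A = B by [].
have JB : Jm *m map_mx t B = A *~ e by exact: JopK.
exists (row_mx (A + B *m a%:M) ((A - B *m a%:M) *m b%:M)); split.
  apply: injmx_iso => //; last by rewrite (is_iso_dim Kdiv iAJ).
  move=> x; rewrite -(vsubmxK x); move: (usubmx x) (dsubmx x) => {}x y.
  rewrite mul_row_col !mulmxDl => h.
  have : row_mx A B *m col_mx (x + b%:M *m y) (a%:M *m (x - b%:M *m y)) = 0.
    rewrite mul_row_col -h !mulmxDr !mulNmx !mulmxN !mulmxA.
    by rewrite addrACA.
  move/(is_iso_inj iAJ)/eqP; rewrite col_mx_eq0 => /andP[/eqP xy /eqP].
  move=> /(congr1 (mulmx z%:M)); rewrite mulmxA -scalar_mxM za mul1mx mulmx0 => /eqP.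
  rewrite subr_eq0 => /eqP exy; move: xy; rewrite -exy => /add_mx0 x0.
  move: exy; rewrite x0 => /(congr1 (mulmx b'%:M)); rewrite mulmx0 mulmxA -scalar_mxM bb mul1mx.
  by move=> <-; rewrite col_mx0.
have tA : map_mx t (a%:M : 'M_m) *~ e = z%:M.
  rewrite (map_mx_scalarf (autD tP)); apply/matrixP => i j; rewrite mxMzE !mxE.
  by case: (i == j); rewrite ?mulr1n // !mulr0n mul0rz.
have E : Jm *m map_mx t (B *m a%:M) = A *m z%:M.
  by rewrite (map_mxMf (autD tP) (autM tP)) mulmxA JB mulmxMzl -mulmxMzr tA.
have tb : (t b)%:M = - (a%:M *m b%:M *m z%:M) :> 'M[K]_m.
  rewrite -!scalar_mxM -raddfN /= -mulrA -mulrN -zb mulrA az mul1r.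
  by [].
have zb' : z%:M *m (t b)%:M = - (b%:M *m z%:M) :> 'M[K]_m by rewrite -!scalar_mxM zb raddfN.
rewrite map_row_mx mul_mx_row scalar_mx_block mul_row_block !mulmx0 addr0 add0r.
have az' : a%:M *m z%:M = 1%:M :> 'M[K]_m by rewrite -scalar_mxM az.
rewrite (map_mxMf (autD tP) (autM tP)) mulmxA !(map_mxDf (autD tP)) (map_mxNf (autD tP)).
rewrite (map_mx_scalarf (autD tP)) !mulmxDr mulmxN JA E; congr row_mx.
  by rewrite mulmxDl -mulmxA az' mulmx1 addrC.
rewrite mulmxBl -[A *m z%:M *m _]mulmxA zb' mulmxN opprK tb mulmxN !mulmxDl mulNmx.
by rewrite !mulNmx !mulmxA addrC.
Qed.

End Structures.

Lemma Ugroup_opp (K : nzRingType) (c : K -> K) n (M : 'M[K]_n) : is_conj c ->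
  Ugroup (gram_form c (- M)) = Ugroup (gram_form c M).
Proof.
move=> cP; apply: ugroup_eq; apply/seteqP; split=> g /(UgroupP _ _ cP)[ig e];
  apply/(UgroupP _ _ cP); split=> //; move: e; rewrite mulmxN mulNmx; first exact: oppr_inj.
by move=> ->.
Qed.

Lemma Ugroup_double (K : nzRingType) (c : K -> K) n (M : 'M[K]_n) : is_conj c ->
  no_2torsion K -> Ugroup (gram_form c (M + M)) = Ugroup (gram_form c M).
Proof.
move=> cP K2; apply: ugroup_eq; apply/seteqP; split=> g /(UgroupP _ _ cP)[ig e];
  apply/(UgroupP _ _ cP); split=> //; move: e; rewrite mulmxDr mulmxDl; last by move=> ->.
move=> e; apply/eqP; rewrite -subr_eq0; apply/eqP/(add_mx0 K2).
by rewrite addrACA e -opprD subrr.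
Qed.

(** * Linear J with J^2 = 1: the two eigenspaces *)

Section SplitLinear.
Variables (K : nzRingType) (c : K -> K) (eps mu : int).
Hypotheses (cP : is_conj c) (Kdiv : skewfield K) (K2 : no_2torsion K).
Variables (N m : nat) (M Jm : 'M[K]_N) (A : 'M[K]_(N, m)) (M0 : 'M[K]_m).
Hypothesis JJ : Jm *m map_mx id Jm = 1%:M *~ 1.
Hypothesis fM : adj c M *~ eps = M.
Hypothesis cons : adj c Jm *m M *m Jm = map_mx id M *~ mu.
Hypothesis jA : jframe c id 1 eps Jm M A M0.

Lemma frames_Ipq_blocks a b (S : 'M[K]_(a + b)) :
  isomorphic (frames c id S (Ipq K a b) S (Ipq K a b)) (blocks c id S 1%:M).
Proof.
have diagP g : frames c id S (Ipq K a b) S (Ipq K a b) g ->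
    exists u v, g = block_mx u 0 0 v.
  move=> [_ _]; rewrite map_mx_id -(submxK g) /Ipq !mulmx_block.
  rewrite !(mulmx0, mul0mx, addr0, add0r, mul1mx, mulmx1, mulNmx, mulmxN).
  move=> /eq_block_mx[_ e1 e2 _]; exists (ulsubmx g), (drsubmx g).
  have X0 k l (X : 'M[K]_(k, l)) : X = - X -> X = 0.
    by move=> e; apply: (add_mx0 K2); rewrite {1}e addNr.
  by rewrite (X0 _ _ _ e1) (X0 _ _ _ (esym e2)).
apply/isomorphicP; exists (fun g => (ulsubmx g, drsubmx g)); split.
- move=> g fg; have [u [v e]] := diagP g fg; rewrite e block_mxKul block_mxKdr.
  by apply/frames_id; case: fg => [ig eg _]; rewrite -e.
- move=> g h /diagP[u [v ->]] /diagP[u' [v' ->]].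
  by rewrite !block_mxKul !block_mxKdr => -[-> ->].
- move=> [u v] /frames_id[/= iuv euv]; exists (block_mx u 0 0 v).
    split=> //; rewrite map_mx_id /Ipq !mulmx_block.
    by rewrite !(mulmx0, mul0mx, addr0, add0r, mul1mx, mulmx1, mulNmx, mulmxN).
  by rewrite block_mxKul block_mxKdr.
- move=> g h /diagP[u [v ->]] /diagP[u' [v' ->]].
  rewrite -[(_ * _)%R]/(block_mx u 0 0 v *m block_mx u' 0 0 v') mulmx_block.
  by rewrite !(mulmx0, mul0mx, addr0, add0r) !block_mxKul !block_mxKdr.
Qed.

Let B := Jop id Jm A.

(** A + J A and A - J A span the eigenspaces of J for 1 and -1. For mu = 1 these are orthogonal with
    Gram matrices 2 M0 and -2 M0, so G is a product; for mu = -1 both are isotropic, so G is a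
    general linear group. *)
Lemma split_linear_frame : frames c id M Jm
  (block_mx (M0 + M0 *~ mu) (M0 - M0 *~ mu) (M0 *~ mu - M0) (- (M0 + M0 *~ mu))) (Ipq K m m)
  (row_mx (A + B) (A - B)).
Proof.
have idA := is_aut_id K.
have [iP A0 AM] := (jframeP cP idA (fun=> erefl) JJ fM cons A M0).1 jA.
have AB : adj c A *m M *m B = M0 *~ mu.
  by have := gram_JopC cP idA (fun=> erefl) JJ cons A A; rewrite mulr1z map_mx_id AM.
have BB : adj c B *m M *m B = 0.
  by rewrite (gram_Jop cP idA (fun=> erefl) cons) A0 map_mx_id mul0rz.
have JB : Jm *m B = A by have := JopK idA JJ A; rewrite /Jop map_mx_id mulr1z.
have JA : Jm *m A = B by rewrite /B /Jop map_mx_id.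
split.
- apply: injmx_iso => //; last by rewrite (is_iso_dim Kdiv iP).
  move=> x; rewrite -(vsubmxK x); move: (usubmx x) (dsubmx x) => {}x y.
  rewrite mul_row_col !mulmxDl mulNmx addrACA -mulmxDr -mulmxBr => h.
  have : row_mx A B *m col_mx (x + y) (x - y) = 0 by rewrite mul_row_col.
  move/(is_iso_inj iP)/eqP; rewrite col_mx_eq0 => /andP[/eqP xy /eqP/eqP].
  by rewrite subr_eq0 => /eqP exy; move: xy; rewrite exy => /(add_mx0 K2) ->; rewrite col_mx0.
- rewrite adj_row mul_col_mx mul_col_row !(adjD cP) (adjN cP) !mulmxDl !mulNmx !mulmxDr !mulmxN.
  rewrite -/B AM AB A0 BB; congr block_mx; rewrite ?add0r ?addr0 ?oppr0 ?subr0 ?add0r ?addr0 //.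
  + by rewrite addrC.
  + by rewrite addrC.
  + by rewrite opprD addrC.
rewrite map_mx_id mul_mx_row mulmxBr mulmxDr JA JB /Ipq mul_row_block.
by rewrite !mulmx0 addr0 add0r mulmx1 mulmxN mulmx1 opprB (addrC B).
Qed.

Lemma split_linear_product : mu = 1 -> isomorphic (frames c id M Jm M Jm)
  (ug_prod (Ugroup (gram_form c M0)) (Ugroup (gram_form c M0))).
Proof.
move=> mu1; have := split_linear_frame; rewrite mu1 mulr1z subrr => fP.
apply: isomorphic_trans (frames_conj_isomorphic cP (is_aut_id K) fP) _.
apply: isomorphic_trans (frames_Ipq_blocks _) _.
rewrite (blocks_diag cP (I := unit) (fun=> M0 + M0) (fun=> - (M0 + M0)) tt).
rewrite (Ugroup_opp _ cP) (Ugroup_double _ cP K2); exact: isomorphic_refl.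
Qed.

Lemma split_linear_GL : mu = -1 -> injmx M0 -> isomorphic (frames c id M Jm M Jm) (GL K m).
Proof.
move=> mu1 i0; have := split_linear_frame; rewrite mu1 mulrN1z subrr opprK oppr0.
set Y := - M0 - M0 => fP.
have idA := is_aut_id K.
have M0a : adj c M0 *~ eps = - M0.
  have [_ _ AM] := (jframeP cP idA (fun=> erefl) JJ fM cons A M0).1 jA.
  have AB := gram_JopC cP idA (fun=> erefl) JJ cons A A.
  rewrite mulr1z map_mx_id AM mu1 mulrN1z in AB; rewrite -AB.
  by have [_ + _] := jA; rewrite adj_row mul_col_mx mul_col_row /adiag => /eq_block_mx[].
have eY : block_mx 0 (M0 + M0) Y 0 = adiag c eps Y.
  rewrite /adiag; congr block_mx; rewrite /Y (adjD cP) !(adjN cP) mulrzBl.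
  by rewrite mulNrz M0a !opprK.
have iY : is_iso Y.
  apply: injmx_iso => // x; rewrite /Y mulmxDl mulNmx -opprD => /eqP.
  by rewrite oppr_eq0 => /eqP/(add_mx0 K2)/i0.
rewrite eY in fP.
apply: isomorphic_trans (frames_conj_isomorphic cP (is_aut_id K) fP) _.
apply: isomorphic_trans (frames_Ipq_blocks _) _.
exact: blocks_adiag.
Qed.

End SplitLinear.

(** * J^2 = -1 with J exchanging the halves: matrices over a quadratic extension L of K *)

Section QuadraticExtension.
Variables (K L : nzRingType) (c t : K -> K) (c2 : L -> L) (re im : L -> K).
Hypotheses (cP : is_conj c) (tP : is_aut t) (c2P : is_conj c2).
Hypotheses (reD : {morph re : x y / x + y}) (imD : {morph im : x y / x + y}).
(* Every element of L is uniquely re + u im, where u ^ 2 = -1 and x u = u (t x) on K. *)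
Hypothesis reM : forall x y, re (x * y) = re x * re y - t (im x) * im y.
Hypothesis imM : forall x y, im (x * y) = im x * re y + t (re x) * im y.
Hypotheses (re1 : re 1 = 1) (im1 : im 1 = 0).
Hypothesis reim_inj : forall x y, re x = re y -> im x = im y -> x = y.
Hypothesis reim_surj : forall a b, exists x, re x = a /\ im x = b.

(** Left multiplication by X on L^m = K^m + u K^m. Right multiplication by u sends a + u b to -t(b)
    + u t(a), which is the semiinvolution with matrix [Zmx K (-1) m]; hence its commutant consists
    of the matrices over L. *)
Definition unfold_mx m (X : 'M[L]_m) : 'M[K]_(m + m) :=
  block_mx (map_mx re X) (- map_mx t (map_mx im X)) (map_mx im X) (map_mx t (map_mx re X)).

Lemma unfold_mxM m (X Y : 'M[L]_m) : unfold_mx (X *m Y) = unfold_mx X *m unfold_mx Y.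
Proof.
have tM' := map_mxMf (autD tP) (autM tP).
have reMx : map_mx re (X *m Y) = map_mx re X *m map_mx re Y
    - map_mx t (map_mx im X) *m map_mx im Y.
  apply/matrixP => i j; rewrite !mxE (add_sum reD) -sumrB; apply: eq_bigr => k _.
  by rewrite reM !mxE.
have imMx : map_mx im (X *m Y) = map_mx im X *m map_mx re Y
    + map_mx t (map_mx re X) *m map_mx im Y.
  apply/matrixP => i j; rewrite !mxE (add_sum imD) -big_split; apply: eq_bigr => k _.
  by rewrite imM !mxE.
rewrite /unfold_mx mulmx_block reMx imMx !(map_mxDf (autD tP)) (map_mxNf (autD tP)) !tM'.
rewrite !(map_mxK tP) !mulNmx !mulmxN opprD [- (_ *m _) + _ as X in block_mx _ X _ _]addrC.
by congr block_mx; rewrite addrC.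
Qed.

Lemma unfold_mx1 m : unfold_mx (1%:M : 'M[L]_m) = 1%:M.
Proof.
rewrite /unfold_mx (map_mx_scalarf reD) (map_mx_scalarf imD) re1 im1 raddf0.
rewrite (map_mx0f (autD tP)) oppr0 (map_mx_scalarf (autD tP)) (aut1 tP).
by rewrite -scalar_mx_block.
Qed.

Lemma unfold_mx_inj m : injective (@unfold_mx m).
Proof.
move=> X Y /eq_block_mx[/matrixP e1 _ /matrixP e2 _]; apply/matrixP => i j.
by apply: reim_inj; [move: (e1 i j)|move: (e2 i j)]; rewrite !mxE.
Qed.

Lemma unfold_mxZ m (g : 'M[K]_(m + m)) :
  Zmx K (-1) m *m map_mx t g = g *m Zmx K (-1) m <-> exists X, g = unfold_mx X.
Proof.
have simpl0 := (mul0mx, mulmx0, addr0, add0r).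
have E A B C D : Zmx K (-1) m *m map_mx t (block_mx A B C D) = block_mx A B C D *m Zmx K (-1) m <->
    B = - map_mx t C /\ D = map_mx t A.
  rewrite map_block_mx /Zmx !mulmx_block !simpl0 !mulmxMzl !mulmxMzr !mulrN1z !mul1mx !mulmx1.
  split=> [/eq_block_mx[<- _ <- _]//|[-> ->]].
  by rewrite (map_mxNf (autD tP)) !(map_mxK tP).
rewrite -{1 2}(submxK g) E; split=> [[eB eD]|[X ->]]; last first.
  by rewrite block_mxKul block_mxKur block_mxKdl block_mxKdr.
have /choice[f fE] : forall ij : 'I_m * 'I_m,
    exists x, re x = ulsubmx g ij.1 ij.2 /\ im x = dlsubmx g ij.1 ij.2.
  by move=> ij; exact: reim_surj.
exists (\matrix_(i, j) f (i, j)).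
have rE : map_mx re (\matrix_(i, j) f (i, j)) = ulsubmx g.
  by apply/matrixP => i j; rewrite !mxE (fE (i, j)).1 !mxE.
have iE : map_mx im (\matrix_(i, j) f (i, j)) = dlsubmx g.
  by apply/matrixP => i j; rewrite !mxE (fE (i, j)).2 !mxE.
by rewrite /unfold_mx rE iE -eB -eD submxK.
Qed.

(** The twist w measures how [adj c] on unfolded matrices differs from the unfolding of [adj c2]. It
    absorbs the difference of types between B over K and the form T over L. *)
Lemma quadratic_isomorphic N m (M Jm : 'M[K]_N) (P : 'M_(N, m + m)) (w : 'M[K]_(m + m)) (T : 'M[L]_m) :
  frames c t M Jm (w *m unfold_mx T) (Zmx K (-1) m) P ->
  is_iso w ->
  (forall X : 'M[L]_m, adj c (unfold_mx X) *m w = w *m unfold_mx (adj c2 X)) ->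
  isomorphic (frames c t M Jm M Jm) (Ugroup (gram_form c2 T)).
Proof.
move=> fP [w' [w'w ww']] hw.
apply: (embedding_isomorphic cP tP c2P fP (rho := @unfold_mx m)).
- exact: unfold_mxM.
- exact: unfold_mx1.
- exact: unfold_mx_inj.
- exact: unfold_mxZ.
move=> X; rewrite (mulmxA (adj c _)) hw -!mulmxA -!unfold_mxM mulmxA; split=> [|-> //].
by move=> /(congr1 (mulmx w')); rewrite !mulmxA w'w !mul1mx => /unfold_mx_inj.
Qed.

End QuadraticExtension.

Lemma isomorphic_GL_cast (K : nzRingType) a b : a = b -> isomorphic (GL K a) (GL K b).
Proof. by move=> ->; exact: isomorphic_refl. Qed.

Lemma has_inertia_congr (K : nzRingType) (c : K -> K) N (M : 'M[K]_N) p q : is_conj c ->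
  has_inertia c (gram_form c M) p q -> congr_mx c M (Ipq K p q).
Proof.
move=> cP [A [B AB BA] h]; exists A; last first.
  by apply: (gram_form_inj cP) => v w; rewrite -gram_form_mul.
have iA : injmx A.
  by move=> x Ax; rewrite -(AB x) Ax -(AB 0) mulmx0.
have [j|U e] := @range_factor _ _ _ _ A 1%:M; first by rewrite -(BA (col j _)); exact: mem_range_mx.
exists U; split=> //; apply/eqP; rewrite -subr_eq0; apply/eqP; apply: (injmx_mx iA).
by rewrite mulmxBr mulmxA -e mulmx1 mul1mx subrr.
Qed.

(** * From the classification of managing forms to the families *)

Section Intro.
Variables (K : nzRingType) (c t : K -> K) (e eps mu : int) (c' : K -> K).
Hypotheses (cP : is_conj c) (tP : is_aut t) (ct : forall x, c (t x) = t (c x)).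
Hypotheses (Kdiv : skewfield K) (K2 : no_2torsion K).
Hypotheses (mu1 : mu * mu = 1) (e1 : e * e = 1) (eps1 : eps * eps = 1).
Hypothesis c'E : c' = c \o t.

Lemma pair_matrices N B J : pair_of_type (FormType c eps) t e mu B J ->
  exists (M Jm : 'M[K]_N), [/\ B = gram_form c M, J = (fun v => Jm *m map_mx t v),
    formmx c eps M, Jm *m map_mx t Jm = 1%:M *~ e &
    adj c Jm *m M *m Jm = map_mx t M *~ mu].
Proof.
move=> [/(form_matrix cP)[M -> fM] /(semiinvolution_matrix tP)[Jm -> JJ] cons _].
by exists M, Jm; split=> //; exact: (consistent_matrix cP tP ct).
Qed.

(** One normal form M0 is enough: in each row some frame of the given pair realises it, by
    congruence or by flips. *)
Definition group_iso N n (M0 : 'M[K]_n) (R1 : pzRingType) (G0 : ugroup R1) :=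
  forall (M Jm : 'M[K]_N) (A : 'M_(N, n)), formmx c eps M ->
    Jm *m map_mx t Jm = 1%:M *~ e -> adj c Jm *m M *m Jm = map_mx t M *~ mu ->
    jframe c t e eps Jm M A M0 -> isomorphic (frames c t M Jm M Jm) G0.

Lemma list1_intro N n (M0 : 'M[K]_n) (R1 R2 : pzRingType) (G0 : ugroup R1) (H : ugroup R2) :
  (forall k (d : 'M_k), N = (k + k)%N -> formmx c' (eps * e * mu) d -> congr_mx c' d M0) ->
  group_iso N M0 G0 -> isomorphic (Ugroup (gram_form c' M0)) H ->
  list1 N (FormType c eps) t e mu G0 H.
Proof.
move=> cl Gi UH B J BJ; have [_ _ _ sp] := BJ.
have [M [Jm [eB eJ fM JJ cons]]] := pair_matrices BJ; have [eM iM] := fM; subst B J.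
have cl' k (A : 'M_(N, k)) d : jframe c t e eps Jm M A d -> congr_mx c' d M0.
  move=> jA; apply: cl; first by have [/(is_iso_dim Kdiv) + _ _] := jA.
  exact: (jframe_form cP tP ct mu1 JJ e1 eM cons c'E eps1 iM jA).
apply: (list1_transitive_family cP tP ct Kdiv K2 JJ e1 eM cons c'E (I := unit)
  (Mf := fun=> M0) _ (i0 := tt)) => //.
- by move=> k A d jA; exists tt; exact: cl' jA.
- by case.
rewrite (centralizer_frames cP tP).
have [k [A [d jA]]] := split_pair_jframe cP tP ct Kdiv JJ e1 eM cons sp.
have [A' jA'] := jframe_congr cP tP c'E jA (cl' _ _ _ jA).
exact: Gi jA'.
Qed.

(** In the frame (A, J A) the managing form has Gram matrix diag(M0, eps e adj(M0)), which here is
    two copies of [Ipq K p q]; this is why the inertia of D on V is doubled. *)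
Lemma jframe_managing N p q (M Jm : 'M[K]_N) (A : 'M_(N, p + q)) :
  eps * e = 1 -> jframe c t e eps Jm M A (Ipq K p q) ->
  congr_mx c' (adj c Jm *m M) (Ipq K (p + p) (q + q)).
Proof.
move=> ee [iP eP PZ]; have c'P := c'P cP tP ct c'E.
apply: congr_mx_trans (_ : congr_mx c' (block_mx (Ipq K p q) 0 0 (Ipq K p q)) _) => //; last first.
  by have := congr_mx_Ipq c'P 1 p q p q; rewrite !scale1r.
exists (row_mx A (Jop t Jm A)) => //.
rewrite (adj_comp c'E) (mulmxA _ (adj c Jm)) -(adjM cP) PZ (adjM cP).
rewrite -mulmxA -mulmxA (mulmxA (adj c _) M) eP /Zmx adj_block !(adj0 cP) (adjMz cP) (adj1 cP).
rewrite /adiag mulmx_block !(mul0mx, mulmx0, addr0, add0r) mul1mx (adj_Ipq cP).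
by rewrite mulmxMzl mul1mx -mulrzA ee mulr1z.
Qed.

Lemma managing_gram N (M Jm : 'M[K]_N) :
  managing_form (gram_form c M) (fun v => Jm *m map_mx t v) = gram_form c' (adj c Jm *m M).
Proof.
apply/funext => v; apply/funext => w; rewrite /managing_form !gram_formE.
by rewrite (adjM cP) (adj_comp c'E) !mulmxA.
Qed.

(** An isotropic half with signature (p', q') makes D of inertia (2p', 2q') on V, and Sylvester's
    law compares this with (2p, 2q). Every half then has the same normal form. *)
Lemma list1_inertia_intro N p q (R1 R2 : pzRingType) (G0 : ugroup R1) (H : ugroup R2) :
  mu = 1 -> eps * e = 1 -> definite c' ->
  (forall k (d : 'M_k), formmx c' 1 d -> exists p q, congr_mx c' d (Ipq K p q)) ->
  (forall (M Jm : 'M[K]_N) A, formmx c eps M ->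
    Jm *m map_mx t Jm = 1%:M *~ e -> adj c Jm *m M *m Jm = map_mx t M *~ mu ->
    jframe c t e eps Jm M A (Ipq K p q) ->
    congr_mx c' (adj c Jm *m M) (Ipq K (2 * p) (2 * q)) ->
    isomorphic (frames c t M Jm M Jm) G0) ->
  isomorphic (Ugroup (gram_form c' (Ipq K p q))) H ->
  list1_inertia N (FormType c eps) t e mu c' p q G0 H.
Proof.
move=> emu ee def cl Gi UH B J BJ; have [_ _ _ sp] := BJ; have c'P := c'P cP tP ct c'E.
have [M [Jm [eB eJ fM JJ cons]]] := pair_matrices BJ; have [eM iM] := fM; subst B J.
rewrite managing_gram => /(has_inertia_congr c'P) cD.
have cl' k (A : 'M_(N, k)) d : jframe c t e eps Jm M A d -> congr_mx c' d (Ipq K p q).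
  move=> jA; have := jframe_form cP tP ct mu1 JJ e1 eM cons c'E eps1 iM jA.
  rewrite ee emu mulr1 => /cl[p' [q' cd]].
  have [A' /(jframe_managing ee) cD'] := jframe_congr cP tP c'E jA cd.
  have [pp qq] := sylvester c'P Kdiv def (congr_mx_trans c'P (congr_mx_sym c'P cD) cD').
  by have [-> ->] : p = p' /\ q = q' by lia.
apply: (list1_transitive_family cP tP ct Kdiv K2 JJ e1 eM cons c'E (I := unit)
  (Mf := fun=> Ipq K p q) _ (i0 := tt)) => //.
- by move=> k A d jA; exists tt; exact: cl' jA.
- by case.
rewrite (centralizer_frames cP tP).
have [k [A [d jA]]] := split_pair_jframe cP tP ct Kdiv JJ e1 eM cons sp.
have [A' jA'] := jframe_congr cP tP c'E jA (cl' _ _ _ jA).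
exact: Gi jA' cD.
Qed.

Lemma list1_star_intro n d (R1 : pzRingType) (R2 : 'I_n.+1 -> pzRingType)
    (G0 : ugroup R1) (H : forall p, ugroup (R2 p)) :
  t d *~ mu = - d -> d != 0 -> (forall x, d * x = x * d) -> definite c' ->
  (forall k (M0 : 'M_k), formmx c' (eps * e * mu) M0 ->
    exists p q, congr_mx c' M0 (d *: Ipq K p q)) ->
  group_iso (2 * n) (d%:M : 'M[K]_n) G0 ->
  (forall p : 'I_n.+1, isomorphic (Ugroup (gram_form c' (Ipq K p (n - p)))) (H p)) ->
  list1_star (2 * n) (FormType c eps) t e mu G0 H.
Proof.
move=> td d0 dC def cl Gi UH B J BJ; have [_ _ _ sp] := BJ; have c'P := c'P cP tP ct c'E.
have [M [Jm [eB eJ fM JJ cons]]] := pair_matrices BJ; have [eM iM] := fM; subst B J.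
have [k [A [M0 jA]]] := split_pair_jframe cP tP ct Kdiv JJ e1 eM cons sp.
have kn k' (A' : 'M_(2 * n, k')) M' : jframe c t e eps Jm M A' M' -> k' = n.
  by move=> [/(is_iso_dim Kdiv) + _ _]; lia.
have cl' k' (A' : 'M_(2 * n, k')) M' : jframe c t e eps Jm M A' M' ->
    exists p : 'I_n.+1, congr_mx c' M' (d *: Ipq K p (n - p)).
  move=> jA'; have k'n := kn _ _ _ jA'.
  have [p' [q' cd]] := cl _ _ (jframe_form cP tP ct mu1 JJ e1 eM cons c'E eps1 iM jA').
  have [_ /(is_iso_dim Kdiv) pq _] := cd.
  have pn : (p' < n.+1)%N by lia.
  by exists (Ordinal pn) => /=; have -> : (n - p' = q')%N by lia.
(* Flips turn the initial frame into one of constant sign; it serves both to identify G and to reach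
   every signature. *)
have [A1 jA1] : exists A' : 'M_(2 * n, k), jframe c t e eps Jm M A' (d%:M : 'M_k).
  have [p cp] := cl' _ _ _ jA.
  exact: (jframe_positive cP tP ct Kdiv JJ e1 eM cons c'E td jA cp).
have ek := kn _ _ _ jA; subst k.
apply: (list1_orbits_family cP tP ct Kdiv K2 JJ e1 eM cons c'E
  (m := fun p : 'I_n.+1 => (p + (n - p))%N) (Mf := fun p => d *: Ipq K p (n - p))) => //.
- by rewrite (centralizer_frames cP tP); exact: Gi jA1.
- move=> p; apply: (jframe_all_signs cP tP ct Kdiv JJ e1 eM cons td jA1).
  by rewrite subnKC // -ltnS.
- move=> p q /(congr_mx_scale_inv Kdiv d0 dC)/(sylvester c'P Kdiv def)[pq _].
  exact: val_inj.
- by move=> p; rewrite Ugroup_scale //.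
Qed.

Lemma list3_intro n (R1 R2 : pzRingType) (G0 : ugroup R1) (H : ugroup R2) :
  (forall (Jm : 'M[K]_(2 * n)) (A : 'M_(2 * n, n)),
    Jm *m map_mx t Jm = 1%:M *~ e -> jframe c t e 1 Jm 0 A 0 ->
    isomorphic (frames c t 0 Jm 0 Jm) G0) ->
  isomorphic (GL K n) H ->
  list3 K (2 * n) t e G0 H.
Proof.
move=> Gi UH J /(semiinvolution_matrix tP)[Jm -> JJ] spJ.
have e0 : adj c (0 : 'M[K]_(2 * n)) *~ 1 = 0 by rewrite (adj0 cP) mul0rz.
have cons0 : adj c Jm *m (0 : 'M[K]_(2 * n)) *m Jm = map_mx t 0 *~ 1.
  by rewrite (map_mx0f (autD tP)) mulmx0 mul0mx mul0rz.
have cl k (A : 'M_(2 * n, k)) d : jframe c t e 1 Jm 0 A d -> k = n /\ d = 0.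
  move=> jA; have [_ _] := (jframeP cP tP ct JJ e0 cons0 A d).1 jA.
  rewrite mulmx0 mul0mx => <-; split=> //.
  by have [/(is_iso_dim Kdiv) + _ _] := jA; lia.
have c'P := c'P cP tP ct c'E.
apply: (list3_transitive_family cP tP ct Kdiv K2 JJ e1 e0 cons0 c'E (I := unit)
  (Mf := fun=> (0 : 'M[K]_n)) _ (i0 := tt)) => //.
- move=> k A d jA; have [ek ->] := cl _ _ _ jA; subst k; exists tt; exact: congr_mx_refl.
- by case.
- rewrite (centralizer_GL_frames cP tP).
  have [Q dd] := spJ.
  have [|k [A [_ _ jA]]] := jframe_split cP tP ct Kdiv JJ e1 e0 cons0 _ dd.
    by move=> v w _ _; rewrite gram_form0.
  have [ek e2] := cl _ _ _ jA; subst k; rewrite e2 in jA; exact: Gi jA.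
- by rewrite (Ugroup0 _ c'P).
Qed.

End Intro.

Section Intro24.
Variables (K : nzRingType) (c : K -> K) (eps : int).
Hypotheses (cP : is_conj c) (Kdiv : skewfield K) (K2 : no_2torsion K).

Lemma formmx_adiag1 n : eps * eps = 1 ->
  formmx c eps (adiag c eps (1%:M : 'M[K]_n)).
Proof.
move=> eps1; rewrite /adiag (adj1 cP); split.
  rewrite adj_block !(adj0 cP) (adjMz cP) (adj1 cP).
  have -> : block_mx 0 1%:M (1%:M *~ eps) 0 *~ eps =
      block_mx 0 (1%:M *~ eps) (1%:M *~ eps *~ eps) 0 :> 'M[K]_(n + n).
    apply/matrixP => i j; rewrite mxMzE !mxE.
    by case: splitP => k _; rewrite !mxE; case: splitP => l _; rewrite ?mxMzE // !mxE mul0rz.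
  by rewrite -mulrzA eps1 mulr1z.
apply: is_iso_inj; exists (block_mx 0 1%:M (1%:M *~ eps) 0).
rewrite !mulmx_block !(mul0mx, mulmx0, addr0, add0r) !mulmxMzl !mulmxMzr !mul1mx.
by rewrite -mulrzA eps1 mulr1z -scalar_mx_block.
Qed.

Lemma list2_intro n n0 (M0 : 'M[K]_n0) (R1 : pzRingType) (G0 : ugroup R1) : eps * eps = 1 ->
  (forall N' (M' : 'M_N') (A : 'M_(N', n)), N' = (n + n)%N -> formmx c eps M' ->
    injmx A -> adj c A *m M' *m A = 0 -> congr_mx c M' M0) ->
  isomorphic (Ugroup (gram_form c M0)) G0 ->
  list2 (2 * n) (FormType c eps) G0 (GL K n).
Proof.
move=> eps1 cl GG0 B /(form_matrix cP)[M -> fM] [Q [m [[A iA eA] iQ m2]]].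
have mn : m = n by lia.
subst m; rewrite -/(range_mx A) in eA; rewrite eA in iQ.
have cM : congr_mx c M M0.
  by apply: cl fM iA _; [lia|exact/(isotropic_range cP)].
apply: (list2_transitive_family cP Kdiv K2 fM); last first.
  by apply: isomorphic_trans GG0; exact: congr_mx_Ugroup.
apply: congr_mx_trans cM _ => //; apply: congr_mx_sym => //.
(* The hyperbolic matrix vanishes on its first coordinate half, so the classification applies to it
   as well and makes it congruent to M. *)
apply: (cl _ _ (col_mx 1%:M 0)) => //; first exact: formmx_adiag1.
  by move=> x; rewrite mul_col_mx mul1mx => /eqP; rewrite col_mx_eq0 => /andP[/eqP].
rewrite adj_col (adj1 cP) (adj0 cP) /adiag mul_row_block mul_row_col.
by rewrite !(mulmx0, mul0mx, addr0).
Qed.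

Lemma list4_intro N m n1 n2 n0 (M1 : 'M[K]_n1) (M2 : 'M[K]_n2) (M0 : 'M[K]_n0)
    (R1 R2 : pzRingType) (G0 : ugroup R1) (H : ugroup R2) :
  n1 = m -> N = (n1 + n2)%N ->
  (forall k (d : 'M_k), k = n1 -> formmx c eps d -> congr_mx c d M1) ->
  (forall k (d : 'M_k), k = n2 -> formmx c eps d -> congr_mx c d M2) ->
  (forall k (d : 'M_k), k = N -> formmx c eps d -> congr_mx c d M0) ->
  formmx c eps (block_mx M1 0 0 M2) ->
  isomorphic (Ugroup (gram_form c M0)) G0 ->
  isomorphic (ug_prod (Ugroup (gram_form c M1)) (Ugroup (gram_form c M2))) H ->
  list4 N (FormType c eps) m G0 H.
Proof.
move=> n1m Nn cl1 cl2 cl0 f12 GG0 UH D /(form_matrix cP)[M -> fM].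
have cM0 := cl0 _ _ erefl fM.
have cM : congr_mx c M (block_mx M1 0 0 M2).
  by apply: congr_mx_trans cM0 _ => //; apply: congr_mx_sym => //; exact: cl0.
have [_ i12] := f12; have [i1 _] := block_diag_injmx Kdiv i12.
apply: (list4_transitive_family cP Kdiv K2 fM (I := unit) (M1 := fun=> M1) (M2 := fun=> M2)
  _ _ _ (i0 := tt)) => //; last first.
- by apply: isomorphic_trans GG0; exact: congr_mx_Ugroup.
- by case.
move=> k d1 d2 f1 f2 [P iP _]; exists tt; split; first by apply: cl1.
by apply: cl2 => //; have := is_iso_dim Kdiv iP; lia.
Qed.

Lemma list4_star_intro p q m (R1 : pzRingType) (R2 : inertia_index p q m -> pzRingType)
    (G0 : ugroup R1) (H : forall x, ugroup (R2 x)) :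
  eps = 1 -> definite c ->
  (forall k (d : 'M_k), formmx c 1 d -> exists p q, congr_mx c d (Ipq K p q)) ->
  isomorphic (Ugroup (gram_form c (Ipq K p q))) G0 ->
  (forall x : inertia_index p q m, isomorphic
    (ug_prod (Ugroup (gram_form c (Ipq K (ii_r x) (ii_s x))))
             (Ugroup (gram_form c (Ipq K (p - ii_r x) (q - ii_s x))))) (H x)) ->
  list4_star (p + q) (FormType c eps) p q m G0 H.
Proof.
move=> e1 def cl GG0 UH D fD iD; have [M eD fM] := form_matrix cP fD; subst D eps.
have cM := has_inertia_congr cP iD.
have I2 r s r' s' : congr_mx c (block_mx (Ipq K r s) 0 0 (Ipq K r' s')) (Ipq K (r + r') (s + s')).
  by have := congr_mx_Ipq cP 1 r s r' s'; rewrite !scale1r.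
have am (x : inertia_index p q m) : (ii_r x + ii_s x)%N = m by apply/eqP; exact: (valP x).
have rp (x : inertia_index p q m) : (ii_r x <= p)%N by rewrite -ltnS; exact: (ltn_ord (val x).1).
have sq (x : inertia_index p q m) : (ii_s x <= q)%N by rewrite -ltnS; exact: (ltn_ord (val x).2).
apply: (list4_orbits_family cP Kdiv K2 fM
  (M1 := fun x : inertia_index p q m => Ipq K (ii_r x) (ii_s x))
  (M2 := fun x : inertia_index p q m => Ipq K (p - ii_r x) (q - ii_s x)) am) => //.
- by move=> x; apply: is_iso_inj; exact: Ipq_iso.
- move=> k d1 d2 /cl[r [s c1]] /cl[r' [s' c2]] c12.
  (* The signatures of the two orthogonal summands add up to (p, q), so the signature of the second
     is determined by that of the first. *)
  have := congr_mx_trans cP (congr_mx_sym cP cM) (congr_mx_trans cP c12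
    (congr_mx_trans cP (congr_mx_diag cP c1 c2) (I2 r s r' s'))).
  move=> /(sylvester cP Kdiv def)[pr qs].
  have [_ /(is_iso_dim Kdiv) mrs _] := c1.
  have hr : (r < p.+1)%N by lia.
  have hs : (s < q.+1)%N by lia.
  have hrs : ((Ordinal hr, Ordinal hs).1 + (Ordinal hr, Ordinal hs).2 == m)%N by rewrite /= mrs.
  exists (exist _ (Ordinal hr, Ordinal hs) hrs); rewrite /ii_r /ii_s /=; split=> //.
  have -> : (p - r = r')%N by lia.
  by have -> : (q - s = s')%N by lia.
- by apply: isomorphic_trans GG0; exact: congr_mx_Ugroup.
- move=> x; apply: congr_mx_trans cM _ => //; apply: congr_mx_sym => //.
  by have := I2 (ii_r x) (ii_s x) (p - ii_r x)%N (q - ii_s x)%N; rewrite !subnKC.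
- move=> x y /(sylvester cP Kdiv def)[e1 e2].
  by apply: val_inj; rewrite [val x]surjective_pairing [val y]surjective_pairing;
    congr pair; exact: val_inj.
Qed.

End Intro24.

(** * Real, complex and quaternionic scalars *)

Lemma is_conj_id (K : comNzRingType) : is_conj (id : K -> K).
Proof. by split=> // x y; rewrite mulrC. Qed.

Lemma skewfield_field (K : fieldType) : skewfield K.
Proof. by move=> x x0; exists x^-1; rewrite mulVf // mulfV. Qed.

Lemma no_2torsion_num (K : numDomainType) : no_2torsion K.
Proof. by move=> x /eqP; rewrite -mulr2n mulrn_eq0 => /eqP. Qed.

Section Scalars.
Variable R : realType.
Local Notation C := R[i].
Local Notation H := (quat R).
Local Open Scope complex_scope.

Lemma is_conj_conjc : is_conj (@conjc R).
Proof.
split; [exact: rmorphD|by move=> x y; rewrite rmorphM mulrC|exact: conjcK].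
Qed.

Lemma is_aut_conjc : is_aut (@conjc R).
Proof. by split; [exact: rmorphD|exact: rmorphM|exact: conjcK]. Qed.

Lemma quat_mulE (a1 b1 c1 d1 a2 b2 c2 d2 : R) :
  Quat a1 b1 c1 d1 * Quat a2 b2 c2 d2 =
  Quat (a1 * a2 - b1 * b2 - c1 * c2 - d1 * d2)
       (a1 * b2 + b1 * a2 + c1 * d2 - d1 * c2)
       (a1 * c2 - b1 * d2 + c1 * a2 + d1 * b2)
       (a1 * d2 + b1 * c2 - c1 * b2 + d1 * a2).
Proof. by []. Qed.

Lemma quat_addE (a1 b1 c1 d1 a2 b2 c2 d2 : R) :
  Quat a1 b1 c1 d1 + Quat a2 b2 c2 d2 = Quat (a1 + a2) (b1 + b2) (c1 + c2) (d1 + d2).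
Proof. by []. Qed.

Lemma quat_oppE (a b c d : R) : - Quat a b c d = Quat (- a) (- b) (- c) (- d).
Proof. by []. Qed.

Lemma quat_0E : (0 : H) = Quat 0 0 0 0. Proof. by []. Qed.
Lemma quat_1E : (1 : H) = Quat 1 0 0 0. Proof. by []. Qed.

Definition quatE := (quat_mulE, quat_addE, quat_oppE, quat_0E, quat_1E).

Definition quat_j : H := Quat 0 0 1 0.

Lemma is_conj_conjq : is_conj (@conjq R).
Proof.
split=> [[????] [????]|[????] [????]|[????]]; rewrite /conjq /= ?quatE /=;
  by congr Quat; ring.
Qed.

Lemma sum_sqr_eq0 (a b : R) : a * a + b * b = 0 -> a = 0 /\ b = 0.
Proof. by move=> h; split; nra. Qed.

Lemma quat_norm_eq0 (x : H) :
  qre x * qre x + qi x * qi x + qj x * qj x + qk x * qk x = 0 -> x = 0.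
Proof.
case: x => a b c d /= h.
have [-> -> -> ->] : [/\ a = 0, b = 0, c = 0 & d = 0] by split; nra.
by [].
Qed.

Lemma skewfield_quat : skewfield H.
Proof.
move=> [a b c d] x0; set n := a * a + b * b + c * c + d * d.
have n0 : n != 0 by apply: contra_neq x0; exact: (@quat_norm_eq0 (Quat a b c d)).
exists (Quat (a / n) (- (b / n)) (- (c / n)) (- (d / n))).
by split; rewrite !quatE; congr Quat; rewrite /n; field.
Qed.

Lemma no_2torsion_quat : no_2torsion H.
Proof. by move=> [a b c d]; rewrite !quatE => -[h1 h2 h3 h4]; congr Quat; lra. Qed.

(** Here f takes the real part: a vanishing sum of nonnegative reals has vanishing terms. *)
Lemma definite_of_norm (K : nzRingType) (c : K -> K) (f : K -> R) : is_conj c ->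
  {morph f : x y / x + y} -> (forall x, 0 <= f (c x * x)) ->
  (forall x, f (c x * x) = 0 -> x = 0) -> definite c.
Proof.
move=> cP fD f_ge0 f_eq0 n x h.
have : f ((adj c x *m x) 0 0) = 0 by rewrite h mxE (add0 fD).
rewrite mxE (add_sum fD) => /eqP; rewrite psumr_eq0; last by move=> i _; rewrite !mxE f_ge0.
move=> /allP h0; apply/colP => i; rewrite [RHS]mxE; apply: f_eq0.
by have := h0 i (mem_index_enum _); rewrite !mxE => /eqP.
Qed.

Lemma definite_id : definite (id : R -> R).
Proof.
apply: (@definite_of_norm _ _ id); [exact: is_conj_id|by []| |].
  by move=> x; rewrite -expr2 sqr_ge0.
by move=> x /eqP; rewrite -expr2 sqrf_eq0 => /eqP.
Qed.

Lemma definite_conjc : definite (@conjc R).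
Proof.
apply: (@definite_of_norm _ _ (@complex.Re R)); first exact: is_conj_conjc.
- by move=> [a b] [a' b'].
- by move=> [a b] /=; nra.
- by move=> [a b] /= h; have [-> ->] : a = 0 /\ b = 0 by apply: sum_sqr_eq0; nra.
Qed.

Lemma definite_conjq : definite (@conjq R).
Proof.
apply: (@definite_of_norm _ _ (@qre R)); first exact: is_conj_conjq.
- by move=> [????] [????].
- by move=> [a b c d] /=; nra.
- by move=> [a b c d] /= h; apply: quat_norm_eq0 => /=; lra.
Qed.

Lemma real_normalise (h : R) : h != 0 -> exists a, a * a * h = 1 \/ a * a * h = -1.
Proof.
move=> h0; exists (Num.sqrt `|h|)^-1.
have n0 : `|h| != 0 by rewrite normr_eq0.
have -> : (Num.sqrt `|h|)^-1 * (Num.sqrt `|h|)^-1 = `|h|^-1.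
  by rewrite -invfM -expr2 sqr_sqrtr.
case: (ltrgtP h 0) h0 => // hh _; [right|left].
  by rewrite ltr0_norm // invrN mulNr mulVf // lt_eqF.
by rewrite gtr0_norm // mulVf // gt_eqF.
Qed.

Lemma form_diagonal_R N (M : 'M[R]_N) : formmx id 1 M ->
  exists p q, congr_mx id M (Ipq R p q).
Proof.
move=> fM.
have [||h h0 _|p [q cM]] := @form_diagonal R id (is_conj_id _) (@skewfield_field _)
  (@no_2torsion_num _) 1 1 _ _ _ _ M fM; rewrite ?oner_neq0 //.
  by have [a ha] := real_normalise h0; exists a; rewrite mulrAC.
by exists p, q; rewrite scale1r in cM.
Qed.

Lemma form_diagonal_C N (M : 'M[C]_N) : formmx (@conjc R) 1 M ->
  exists p q, congr_mx (@conjc R) M (Ipq C p q).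
Proof.
move=> fM.
have [||h h0|p [q cM]] := @form_diagonal C _ is_conj_conjc (@skewfield_field _)
  (@no_2torsion_num _) 1 1 _ _ _ _ M fM; rewrite ?oner_neq0 //.
  case: h h0 => x y h0 /eqP; rewrite mulr1z eq_complex /= eqxx => /eqP yy.
  have y0 : y = 0 by lra.
  have x0 : x != 0 by apply: contra_neq h0 => ->; rewrite y0.
  have [a ha] := real_normalise x0; exists a%:C; rewrite y0.
  have -> : conjc a%:C * (x +i* 0) * a%:C = (a * a * x)%:C.
    by apply/eqP; rewrite eq_complex /=; apply/andP; split; apply/eqP; ring.
  by case: ha => ->; [left|right]; rewrite ?rmorphN rmorph1.
by exists p, q; rewrite scale1r in cM.
Qed.

(** The value of an antihermitian form at (v, v) is purely imaginary, so real rescaling brings it to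
    i or -i. *)
Lemma form_diagonal_Ci N (M : 'M[C]_N) : formmx (@conjc R) (-1) M ->
  exists p q, congr_mx (@conjc R) M ('i *: Ipq C p q).
Proof.
move=> fM; apply: (@form_diagonal C _ is_conj_conjc (@skewfield_field _)
  (@no_2torsion_num _) (-1) 'i _ _ _ _ M fM).
- by apply/eqP => -[] /eqP; rewrite oner_eq0.
- by move=> /(_ 'i%C)[] /eqP h; exfalso; move: h => /eqP h; lra.
move=> h h0; case: h h0 => x y h0 /eqP; rewrite mulrN1z eq_complex /= opprK eqxx andbT => /eqP xx.
have x0 : x = 0 by lra.
have y0 : y != 0 by apply: contra_neq h0 => ->; rewrite x0.
have [a ha] := real_normalise y0; exists a%:C; rewrite x0.
have -> : conjc a%:C * (0 +i* y) * a%:C = (a * a * y)%:C * 'i.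
  by apply/eqP; rewrite eq_complex /=; apply/andP; split; apply/eqP; ring.
by case: ha => ->; [left|right]; rewrite ?rmorphN rmorph1 ?mulN1r ?mul1r.
Qed.

Lemma form_scalar_C N (M : 'M[C]_N) : formmx id 1 M -> congr_mx id M (1%:M : 'M_N).
Proof.
move=> fM; apply: (@form_diagonal_scalar C id (is_conj_id _) (@skewfield_field _)
  (@no_2torsion_num _) 1 1 (oner_neq0 _) _ _ N M 'i _ fM) => //.
  move=> h h0 _; exists (sqrtc h)^-1; left.
  by rewrite mulrAC -invfM -expr2 sqr_sqrtc mulVf.
by rewrite mulrN1 mulNr -expr2 sqr_i opprK.
Qed.

Lemma quat_real_conj (a x y z w : R) : conjq (Quat a 0 0 0) * Quat x y z w * Quat a 0 0 0 =
  Quat (a * a * x) (a * a * y) (a * a * z) (a * a * w).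
Proof. by rewrite /conjq /= !quatE; congr Quat; ring. Qed.

Lemma form_diagonal_H N (M : 'M[H]_N) : formmx (@conjq R) 1 M ->
  exists p q, congr_mx (@conjq R) M (Ipq H p q).
Proof.
move=> fM.
have [||h h0|p [q cM]] := @form_diagonal H _ is_conj_conjq skewfield_quat
  no_2torsion_quat 1 1 _ _ _ _ M fM; rewrite ?oner_neq0 //.
  case: h h0 => x y z w h0; rewrite mulr1z /conjq /= => -[e1 e2 e3].
  have {}e1 : y = 0 by lra.
  have {}e2 : z = 0 by lra.
  have {}e3 : w = 0 by lra.
  subst y z w.
  have x0 : x != 0 by apply: contra_neq h0 => ->.
  have [a ha] := real_normalise x0; exists (Quat a 0 0 0).
  by rewrite quat_real_conj !mulr0; case: ha => ->; [left|right]; rewrite ?quatE ?oppr0.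
by exists p, q; rewrite scale1r in cM.
Qed.

(** Diagonal values are pure quaternions, and any nonzero pure quaternion is carried to i or -i by x
    |-> conj(a) x a. The sign is then removed by j, since conj(j) (-i) j = i. *)
Lemma form_scalar_H N (M : 'M[H]_N) : formmx (@conjq R) (-1) M ->
  congr_mx (@conjq R) M ((quat_i R)%:M : 'M_N).
Proof.
move=> fM; apply: (@form_diagonal_scalar H _ is_conj_conjq skewfield_quat
  no_2torsion_quat (-1) (quat_i R) _ _ _ N M quat_j _ fM).
- by apply/eqP => -[] /eqP; rewrite oner_eq0.
- by move=> /(_ (quat_i R)); rewrite /conjq /quat_i /= => -[h _ _]; exfalso; lra.
- move=> [x b c d] h0; rewrite mulrN1z /conjq /= quatE => -[e1 _ _ _].
  have x0 : x = 0 by lra.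
  subst x.
  (* The general witness below is a multiple of (b + r) i + c j + d k, which may vanish when c = d =
     0; in that case the value is already a real multiple of i. *)
  have [cd|cd] := eqVneq (c * c + d * d) 0.
    have [c0 d0] := sum_sqr_eq0 cd; subst c d.
    have b0 : b != 0 by apply: contra_neq h0 => ->.
    have [a ha] := real_normalise b0; exists (Quat a 0 0 0).
    by rewrite quat_real_conj !mulr0; case: ha => ->; [left|right]; rewrite /quat_i ?quatE ?oppr0.
  pose r := Num.sqrt (b * b + c * c + d * d).
  have rr : r * r = b * b + c * c + d * d.
    by rewrite -expr2 sqr_sqrtr // -!expr2 !addr_ge0 ?sqr_ge0.
  pose n := (b + r) * (b + r) + c * c + d * d.
  have n0 : n * r != 0.
    have cd0 : 0 < c * c + d * d by rewrite lt_def cd -!expr2 addr_ge0 ?sqr_ge0.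
    have b0 : 0 <= b * b by rewrite -expr2 sqr_ge0.
    have br0 : 0 <= (b + r) * (b + r) by rewrite -expr2 sqr_ge0.
    apply: mulf_neq0; first by rewrite gt_eqF // /n; lra.
    by apply/eqP => r0; rewrite r0 mulr0 in rr; lra.
  have [s hs] := real_normalise n0.
  (* For a pure quaternion x of norm r, the element q = x + r i satisfies x q = q (r i), because x^2
     = -r^2. Hence conj(q) x q = n r i with n the squared norm of q, and s normalises n r. *)
  exists (Quat 0 ((b + r) * s) (c * s) (d * s)).
  have key : conjq (Quat 0 ((b + r) * s) (c * s) (d * s)) * Quat 0 b c d *
     Quat 0 ((b + r) * s) (c * s) (d * s) = Quat 0 (s * s * (n * r)) 0 0.
    rewrite -mulrA.
    have -> : Quat 0 b c d * Quat 0 ((b + r) * s) (c * s) (d * s) =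
      Quat 0 ((b + r) * s) (c * s) (d * s) * Quat 0 r 0 0.
      by rewrite !quatE; congr Quat; ring: rr.
    by rewrite mulrA /conjq /= !quatE; congr Quat; rewrite /n; ring.
  by rewrite key; case: hs => ->; [left|right]; rewrite /quat_i ?quatE ?oppr0.
by rewrite /conjq /quat_i /quat_j /= !quatE; congr Quat => /=; ring.
Qed.

Definition iotaC (x : R) : C := x%:C.
Definition iotaH (z : C) : H := Quat (complex.Re z) (complex.Im z) 0 0.
Definition reH (x : H) : C := qre x +i* qi x.
(* x = iotaH (reH x) + quat_j * iotaH (imH x) *)
Definition imH (x : H) : C := qj x -i* qk x.

Lemma complexP (z w : C) : complex.Re z = complex.Re w -> complex.Im z = complex.Im w -> z = w.
Proof. by case: z => ? ?; case: w => ? ? /= -> ->. Qed.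

Lemma complex_mulE (a b c d : R) : (a +i* b) * (c +i* d) = (a * c - b * d) +i* (a * d + b * c).
Proof. by []. Qed.

Lemma complex_addE (a b c d : R) : (a +i* b) + (c +i* d) = (a + c) +i* (b + d).
Proof. by []. Qed.

Lemma complex_oppE (a b : R) : - (a +i* b) = (- a) +i* (- b).
Proof. by []. Qed.

Lemma iotaHD : {morph iotaH : x y / x + y}.
Proof. by move=> [a b] [a' b']; rewrite /iotaH /= quatE !addr0. Qed.

Lemma iotaHM : {morph iotaH : x y / x * y}.
Proof. by move=> [a b] [a' b']; rewrite complex_mulE /iotaH /= quatE; congr Quat; ring. Qed.

Lemma iotaH_inj : injective iotaH.
Proof. by move=> [a b] [a' b'] [-> ->]. Qed.

Lemma reHD : {morph reH : x y / x + y}.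
Proof. by move=> [????] [????]. Qed.

Lemma imHD : {morph imH : x y / x + y}.
Proof. by move=> [????] [????]; rewrite /imH /= complex_addE opprD. Qed.

Lemma reHM x y : reH (x * y) = reH x * reH y - conjc (imH x) * imH y.
Proof.
case: x y => [????] [????]; rewrite quatE /reH /imH /= !complex_mulE complex_oppE complex_addE.
by congr Complex; ring.
Qed.

Lemma imHM x y : imH (x * y) = imH x * reH y + conjc (reH x) * imH y.
Proof.
case: x y => [????] [????]; rewrite quatE /reH /imH /= !complex_mulE complex_addE.
by congr Complex; ring.
Qed.

Lemma reimH_inj x y : reH x = reH y -> imH x = imH y -> x = y.
Proof. by case: x y => [????] [????] [-> ->] [-> /oppr_inj ->]. Qed.

Lemma reimH_surj a b : exists x, reH x = a /\ imH x = b.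
Proof.
case: a b => x y [z w]; exists (Quat x y z (- w)).
by rewrite /reH /imH /= opprK.
Qed.

Lemma reC_D : {morph (@complex.Re R) : x y / x + y}. Proof. by move=> [??] [??]. Qed.
Lemma imC_D : {morph (@complex.Im R) : x y / x + y}. Proof. by move=> [??] [??]. Qed.
Lemma reC_M (x y : C) :
  complex.Re (x * y) = complex.Re x * complex.Re y - id (complex.Im x) * complex.Im y.
Proof. by case: x y => [??] [??]. Qed.
Lemma imC_M (x y : C) :
  complex.Im (x * y) = complex.Im x * complex.Re y + id (complex.Re x) * complex.Im y.
Proof. by case: x y => [??] [??] /=; ring. Qed.
Lemma reimC_surj (a b : R) : exists x : C, complex.Re x = a /\ complex.Im x = b.
Proof. by exists (a +i* b). Qed.

End Scalars.

(** * Real matrices as complex ones, complex matrices as quaternionic ones *)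

Section Groups.
Variable R : realType.
Local Notation C := R[i].
Local Notation H := (quat R).
Local Open Scope complex_scope.

(** Transposition of an unfolded matrix is unfolding of the conjugate transpose, so the twist is 1,
    and the Gram matrix is the unfolding of i M0. *)
Lemma complexify_herm N m (M Jm : 'M[R]_N) (P : 'M[R]_(N, m + m)) M0 :
  frames id id M Jm (block_mx 0 (- M0) M0 0) (Zmx R (-1) m) P ->
  isomorphic (frames id id M Jm M Jm) (Ugroup (gram_form (@conjc R) ('i *: map_mx (@iotaC R) M0))).
Proof.
move=> fP; apply: (@quadratic_isomorphic R C id id (@conjc R) (@complex.Re R) (@complex.Im R)
  (is_conj_id _) (is_aut_id _) (is_conj_conjc R) (@reC_D R) (@imC_D R) (@reC_M R) (@imC_M R)
  erefl erefl (@complexP R) (@reimC_surj R) N m M Jm P 1%:M _ _ (is_iso1 _ _)).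
  rewrite mul1mx; suff -> : unfold_mx id (@complex.Re R) (@complex.Im R) ('i *: map_mx (@iotaC R) M0) =
    block_mx 0 (- M0) M0 0 by [].
  rewrite /unfold_mx !map_mx_id; congr block_mx; [|congr (- _)| |];
    by apply/matrixP => i j; rewrite !mxE /=; ring.
move=> X; rewrite mulmx1 mul1mx /unfold_mx adj_block !map_mx_id.
by congr block_mx; apply/matrixP => i j; rewrite !mxE; case: (X _ _) => a b /=; rewrite ?opprK.
Qed.

(** The twist diag(-1, 1) replaces conjugate transposition by plain transposition. The Gram matrix
    is that twist times the unfolding of i M0, and the scalar i does not change the group. *)
Lemma complexify_bilin N m (M Jm : 'M[R]_N) (P : 'M[R]_(N, m + m)) M0 :
  frames id id M Jm (block_mx 0 M0 M0 0) (Zmx R (-1) m) P ->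
  isomorphic (frames id id M Jm M Jm) (Ugroup (gram_form id (map_mx (@iotaC R) M0))).
Proof.
move=> fP.
rewrite -(@Ugroup_scale C id _ (map_mx (@iotaC R) M0) 'i (@skewfield_field _)); last first.
- by move=> x; rewrite mulrC.
- by apply/eqP => -[] /eqP; rewrite oner_eq0.
apply: (@quadratic_isomorphic R C id id id (@complex.Re R) (@complex.Im R)
  (is_conj_id _) (is_aut_id _) (is_conj_id _) (@reC_D R) (@imC_D R) (@reC_M R) (@imC_M R)
  erefl erefl (@complexP R) (@reimC_surj R) N m M Jm P (- Ipq R m m)).
- suff -> : unfold_mx id (@complex.Re R) (@complex.Im R) ('i *: map_mx (@iotaC R) M0) =
      block_mx 0 (- M0) M0 0.
    rewrite /Ipq mulNmx mulmx_block !(mulmx0, mul0mx, addr0, add0r, mul1mx, mulNmx).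
    by rewrite opp_block_mx !oppr0 !opprK.
  rewrite /unfold_mx !map_mx_id; congr block_mx; [|congr (- _)| |];
    by apply/matrixP => i j; rewrite !mxE /=; ring.
- by exists (- Ipq R m m); rewrite mulNmx mulmxN opprK IpqK.
move=> X; rewrite /unfold_mx adj_block !map_mx_id /Ipq mulmxN mulNmx; congr (- _).
rewrite !mulmx_block !(mulmx0, mul0mx, addr0, add0r, mul1mx, mulmx1, mulNmx, mulmxN, opprK).
by congr block_mx; apply/matrixP => i j; rewrite !mxE ?opprK.
Qed.

Lemma map_conjc_reH m (X : 'M[H]_m) :
  map_mx (@reH R) (adj (@conjq R) X) = adj (@conjc R) (map_mx (@reH R) X).
Proof. by apply/matrixP => i j; rewrite !mxE. Qed.

Lemma map_conjc_imH m (X : 'M[H]_m) :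
  map_mx (@imH R) (adj (@conjq R) X) = - (map_mx (@imH R) X)^T.
Proof. by apply/matrixP => i j; rewrite !mxE. Qed.

Lemma unfold_iotaH m (M0 : 'M[C]_m) :
  unfold_mx (@conjc R) (@reH R) (@imH R) (map_mx (@iotaH R) M0) =
    block_mx M0 0 0 (map_mx (@conjc R) M0).
Proof.
rewrite /unfold_mx; congr block_mx; apply/matrixP => i j; rewrite !mxE; case: (M0 i j) => x y //.
all: by apply: complexP; rewrite /= ?oppr0.
Qed.

Lemma unfold_jiotaH m (M0 : 'M[C]_m) :
  unfold_mx (@conjc R) (@reH R) (@imH R) (quat_j R *: map_mx (@iotaH R) M0) =
    block_mx 0 (- map_mx (@conjc R) M0) M0 0.
Proof.
rewrite /unfold_mx; congr block_mx; apply/matrixP => i j; rewrite !mxE; case: (M0 i j) => x y.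
all: by apply: complexP; rewrite /=; ring.
Qed.

(** Transposing an unfolded quaternionic matrix agrees with unfolding its conjugate transpose after
    the twist by the symplectic matrix: a complex bilinear form becomes a quaternionic sesquilinear
    one. *)
Lemma quaternionify_bilin N m (M Jm : 'M[C]_N) (P : 'M[C]_(N, m + m)) M0 :
  frames id (@conjc R) M Jm (block_mx 0 (- map_mx (@conjc R) M0) M0 0) (Zmx C (-1) m) P ->
  isomorphic (frames id (@conjc R) M Jm M Jm)
    (Ugroup (gram_form (@conjq R) (map_mx (@iotaH R) M0))).
Proof.
move=> fP.
apply: (@quadratic_isomorphic C H id (@conjc R) (@conjq R) (@reH R) (@imH R)
  (is_conj_id _) (is_aut_conjc R) (is_conj_conjq R) (@reHD R) (@imHD R) (@reHM R) (@imHM R)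
  erefl _ (@reimH_inj R) (@reimH_surj R) N m M Jm P (Spmx C m)).
- by rewrite /imH /= oppr0.
- rewrite unfold_iotaH /Spmx mulmx_block.
  by rewrite !(mulmx0, mul0mx, addr0, add0r, mul1mx, mulNmx).
- exists (- Spmx C m); rewrite mulmxN mulNmx /Spmx mulmx_block.
  rewrite !(mulmx0, mul0mx, addr0, add0r) mulmx1 mul1mx.
  by rewrite opp_block_mx !oppr0 opprK -scalar_mx_block.
move=> X; rewrite /unfold_mx adj_block map_conjc_reH map_conjc_imH /Spmx !mulmx_block.
rewrite !(mulmx0, mul0mx, addr0, add0r, mul1mx, mulmx1, mulNmx, mulmxN).
congr block_mx; apply/matrixP => i j; rewrite !mxE ?opprK ?rmorphN //=.
by rewrite /reH opprK.
Qed.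

Lemma adj_unfold_conjq m (X : 'M[H]_m) :
  adj (@conjc R) (unfold_mx (@conjc R) (@reH R) (@imH R) X) =
  unfold_mx (@conjc R) (@reH R) (@imH R) (adj (@conjq R) X).
Proof.
rewrite /unfold_mx adj_block map_conjc_reH map_conjc_imH.
congr block_mx; apply/matrixP => i j; rewrite !mxE ?rmorphN ?conjcK ?opprK //.
by congr (- _); exact: conjcK.
Qed.

Lemma quaternionify_herm N m (M Jm : 'M[C]_N) (P : 'M[C]_(N, m + m)) M0 :
  frames (@conjc R) (@conjc R) M Jm (block_mx 0 (- map_mx (@conjc R) M0) M0 0) (Zmx C (-1) m) P ->
  isomorphic (frames (@conjc R) (@conjc R) M Jm M Jm)
    (Ugroup (gram_form (@conjq R) (quat_j R *: map_mx (@iotaH R) M0))).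
Proof.
move=> fP.
apply: (@quadratic_isomorphic C H (@conjc R) (@conjc R) (@conjq R) (@reH R) (@imH R)
  (is_conj_conjc R) (is_aut_conjc R) (is_conj_conjq R) (@reHD R) (@imHD R) (@reHM R) (@imHM R)
  erefl _ (@reimH_inj R) (@reimH_surj R) N m M Jm P 1%:M _ _ (is_iso1 _ _)).
- by rewrite /imH /= oppr0.
- by rewrite mul1mx unfold_jiotaH.
by move=> X; rewrite mulmx1 mul1mx adj_unfold_conjq.
Qed.

(** The Gram matrix itself has the wrong sign in one corner to be an unfolding; i times it is one.
    Since i is central in complex matrices, the twist by -i leaves the involution unchanged. *)
Lemma quaternionify_antiherm N m (M Jm : 'M[C]_N) (P : 'M[C]_(N, m + m)) M0 :
  frames (@conjc R) (@conjc R) M Jm (block_mx 0 (map_mx (@conjc R) M0) M0 0) (Zmx C (-1) m) P ->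
  isomorphic (frames (@conjc R) (@conjc R) M Jm M Jm)
    (Ugroup (gram_form (@conjq R) (quat_j R *: map_mx (@iotaH R) ('i *: M0)))).
Proof.
move=> fP.
have ii : 'i * 'i = -1 :> C by rewrite -expr2 sqr_i.
apply: (@quadratic_isomorphic C H (@conjc R) (@conjc R) (@conjq R) (@reH R) (@imH R)
  (is_conj_conjc R) (is_aut_conjc R) (is_conj_conjq R) (@reHD R) (@imHD R) (@reHM R) (@imHM R)
  erefl _ (@reimH_inj R) (@reimH_surj R) N m M Jm P (- 'i)%:M).
- by rewrite /imH /= oppr0.
- rewrite unfold_jiotaH mul_scalar_mx scale_block_mx !scaler0.
  rewrite scalerA mulNr ii opprK scale1r.
  suff -> : - 'i *: (- map_mx (@conjc R) ('i *: M0)) = map_mx (@conjc R) M0 by [].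
  by apply/matrixP => i j; rewrite !mxE rmorphM; case: (M0 i j) => x y; apply: complexP => /=; ring.
- by exists ('i%:M); rewrite -!scalar_mxM mulrN mulNr ii opprK.
by move=> X; rewrite adj_unfold_conjq scalar_mxC.
Qed.

End Groups.

(** * Real points of antilinear J, complex points of quaternionic J *)

Section RealStructures.
Variable R : realType.
Local Notation C := R[i].
Local Notation H := (quat R).
Local Open Scope complex_scope.

Lemma map_iotaC_Ipq p q : map_mx (@iotaC R) (Ipq R p q) = Ipq C p q.
Proof.
have iD := rmorphD (real_complex R); have i1 := rmorph1 (real_complex R).
by rewrite /Ipq map_block_mx !(map_mx0f iD) (map_mxNf iD) !(map_mx1f iD i1).
Qed.

Lemma map_iotaC_Sp n : map_mx (@iotaC R) (Spmx R n) = Spmx C n.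
Proof.
have iD := rmorphD (real_complex R); have i1 := rmorph1 (real_complex R).
by rewrite /Spmx map_block_mx !(map_mx0f iD) (map_mxNf iD) !(map_mx1f iD i1).
Qed.

Lemma map_iotaH_Ipq p q : map_mx (@iotaH R) (Ipq C p q) = Ipq H p q.
Proof.
have iD := @iotaHD R.
by rewrite /Ipq map_block_mx !(map_mx0f iD) (map_mxNf iD) !(map_mx1f iD (erefl : iotaH 1 = 1 :> H)).
Qed.

Lemma map_iotaH_Sp n : map_mx (@iotaH R) (Spmx C n) = Spmx H n.
Proof.
have iD := @iotaHD R.
by rewrite /Spmx map_block_mx !(map_mx0f iD) (map_mxNf iD) !(map_mx1f iD (erefl : iotaH 1 = 1 :> H)).
Qed.

Lemma iotaC_fixed (x : C) : 1 * conjc x = x * 1 <-> exists y, x = iotaC y.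
Proof.
rewrite mul1r mulr1; split=> [|[y ->]]; last exact: conjc_real.
by case: x => a b [/eqP]; rewrite eq_sym -addr_eq0 => /eqP/no_2torsion_num ->; exists a.
Qed.

Lemma iotaC_antifixed (x : C) : 1 * x * 1 = conjc x *~ (-1) -> exists y, x = 'i * iotaC y.
Proof.
rewrite mul1r mulr1; case: x => a b; rewrite mulrN1z => -[/eqP].
rewrite -addr_eq0 => /eqP/no_2torsion_num -> _; exists b.
by apply: complexP => /=; ring.
Qed.

Lemma real_complex_structure N m (Jm : 'M[C]_N) (A : 'M[C]_(N, m)) :
  Jm *m map_mx (@conjc R) Jm = 1%:M *~ 1 -> is_iso (row_mx A (Jop (@conjc R) Jm A)) ->
  exists P : 'M[C]_(N, m + m), is_iso P /\ Jm *m map_mx (@conjc R) P = P *m 1%:M.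
Proof.
move=> JJ iA; apply: (real_structure (is_aut_conjc R) (@skewfield_field _) (@no_2torsion_num _)
  JJ iA (a := 1) (b := 'i) (b' := - 'i)); rewrite ?mulr1 ?mulr1z ?conjc1 //.
  by rewrite mulNr -expr2 sqr_i opprK.
by rewrite mul1r; apply: complexP => /=; rewrite ?oppr0.
Qed.

(** For antilinear J with J^2 = 1 the columns of P are fixed vectors, and mu = 1 makes B real on
    them. The map c stands for the identity or for conjugation, which agree on R. *)
Lemma real_points c eps N m (M Jm : 'M[C]_N) (A : 'M[C]_(N, m)) M0 : is_conj c ->
  (forall x, c (conjc x) = conjc (c x)) -> (forall y, c (iotaC y) = iotaC y) ->
  formmx c eps M -> Jm *m map_mx (@conjc R) Jm = 1%:M *~ 1 ->
  adj c Jm *m M *m Jm = map_mx (@conjc R) M *~ 1 ->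
  jframe c (@conjc R) 1 eps Jm M A M0 ->
  exists (P : 'M[C]_(N, m + m)) T, formmx id eps T /\
    frames c (@conjc R) M Jm (1 *: map_mx (@iotaC R) T) 1%:M P.
Proof.
move=> cP ct ci fM JJ cons [iA _ _]; have [P [iP PZ]] := real_complex_structure JJ iA.
have [||||T [fP fT]] := @real_form_gram C R c (@conjc R) id (@iotaC R) cP (is_aut_conjc R)
  (rmorphD _) (rmorphM _) (@complexI R) 1 1 _ _ N _ M Jm P 1 eps 1 ct _ _ cons fM iP PZ.
- by move=> x; rewrite mul1r.
- by move=> y; rewrite ci mul1r mulr1.
- move=> x; rewrite (conj1 cP) mulr1z mulr1 => h; have /iotaC_fixed[y ->] : 1 * conjc x = x * 1.
    by rewrite mul1r mulr1 -h mul1r.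
  by exists y; rewrite mul1r.
- by rewrite (conj1 cP) mulr1z.
by exists P, T; rewrite mul1r in fT.
Qed.

(** With mu = -1 the form takes imaginary values on the fixed vectors of J; dividing by i turns the
    sign eps into -eps. *)
Lemma imaginary_points eps N m (M Jm : 'M[C]_N) (A : 'M[C]_(N, m)) M0 :
  formmx (@conjc R) eps M -> Jm *m map_mx (@conjc R) Jm = 1%:M *~ 1 ->
  adj (@conjc R) Jm *m M *m Jm = map_mx (@conjc R) M *~ (-1) ->
  jframe (@conjc R) (@conjc R) 1 eps Jm M A M0 ->
  exists (P : 'M[C]_(N, m + m)) T, formmx id (- eps) T /\
    frames (@conjc R) (@conjc R) M Jm ('i *: map_mx (@iotaC R) T) 1%:M P.
Proof.
move=> fM JJ cons [iA _ _]; have [P [iP PZ]] := real_complex_structure JJ iA.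
have cP := is_conj_conjc R.
have [||||T [fP fT]] := @real_form_gram C R (@conjc R) (@conjc R) id (@iotaC R) cP (is_aut_conjc R)
  (rmorphD _) (rmorphM _) (@complexI R) 1 'i _ _ N _ M Jm P (-1) eps (-1) (fun=> erefl) _ _ cons fM iP PZ.
- by move=> x /eqP; rewrite mulf_eq0 => /orP[|/eqP //] /eqP[] /eqP; rewrite oner_eq0.
- by move=> y; rewrite conjc_real mulrC.
- by move=> x; rewrite conjc1; exact: iotaC_antifixed.
- by rewrite mulrN1z; apply: complexP => /=; rewrite ?oppr0.
by exists P, T; rewrite mulN1r in fT.
Qed.

Lemma iotaH_comm (x : H) : quat_i R * id x = x * quat_i R <-> exists y, x = iotaH y.
Proof.
split=> [|[[a b] ->]]; last by rewrite /iotaH /quat_i !quatE /=; congr Quat; ring.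
case: x => a b c d; rewrite /quat_i !quatE => -[_ _ h1 h2]; exists (a +i* b).
by rewrite /iotaH /=; congr Quat; lra.
Qed.

Lemma iotaH_commN (x : H) : conjq (quat_i R) * x * quat_i R = id x *~ (-1) ->
  exists y, x = quat_j R * iotaH y.
Proof.
case: x => a b c d; rewrite mulrN1z /quat_i /conjq /= !quatE => -[h1 h2 h3 h4].
exists (c -i* d); rewrite /iotaH /quat_j /= !quatE; congr Quat; lra.
Qed.

(** J becomes left multiplication of coordinates by i, so its commutant consists of the matrices
    with entries commuting with i, that is, complex ones. *)
Lemma complex_quat_structure N m (Jm : 'M[H]_N) (A : 'M[H]_(N, m)) :
  Jm *m map_mx id Jm = 1%:M *~ (-1) -> is_iso (row_mx A (Jop id Jm A)) ->
  exists P : 'M[H]_(N, m + m), is_iso P /\ Jm *m map_mx id P = P *m (quat_i R)%:M.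
Proof.
move=> JJ iA; apply: (real_structure (is_aut_id _) (@skewfield_quat R) (@no_2torsion_quat R)
  JJ iA (a := - quat_i R) (b := quat_j R) (b' := - quat_j R)).
all: rewrite ?mulrN1z /quat_i /quat_j !quatE //=; congr Quat; ring.
Qed.

Lemma complex_points eps N m (M Jm : 'M[H]_N) (A : 'M[H]_(N, m)) M0 :
  formmx (@conjq R) eps M -> Jm *m map_mx id Jm = 1%:M *~ (-1) ->
  adj (@conjq R) Jm *m M *m Jm = map_mx id M *~ 1 ->
  jframe (@conjq R) id (-1) eps Jm M A M0 ->
  exists (P : 'M[H]_(N, m + m)) T, formmx (@conjc R) eps T /\
    frames (@conjq R) id M Jm (1 *: map_mx (@iotaH R) T) (quat_i R)%:M P.
Proof.
move=> fM JJ cons [iA _ _]; have [P [iP PZ]] := complex_quat_structure JJ iA.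
have cP := is_conj_conjq R.
have [||||T [fP fT]] := @real_form_gram H C (@conjq R) id (@conjc R) (@iotaH R) cP (is_aut_id _)
  (@iotaHD R) (@iotaHM R) (@iotaH_inj R) (quat_i R) 1 _ _ N _ M Jm P 1 eps 1 (fun=> erefl) _ _ cons fM iP PZ.
- by move=> x; rewrite mul1r.
- by move=> [a b]; rewrite mul1r mulr1 /conjq /iotaH /= oppr0.
- move=> x; rewrite mulr1z => h; have /iotaH_comm[y ->] : quat_i R * id x = x * quat_i R.
    rewrite -[in LHS]h; case: x {h} => a b c d.
    by rewrite /quat_i /conjq /= !quatE; congr Quat => /=; ring.
  by exists y; rewrite mul1r.
- by rewrite (conj1 cP) mulr1z.
by exists P, T; rewrite mul1r in fT.
Qed.

(** With mu = -1 the Gram entries anticommute with i and lie in j C. As conj(y) j = j y for complex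
    y, quaternionic conjugation acts trivially on C, and the resulting complex form is bilinear. *)
Lemma twisted_complex_points eps N m (M Jm : 'M[H]_N) (A : 'M[H]_(N, m)) M0 :
  formmx (@conjq R) eps M -> Jm *m map_mx id Jm = 1%:M *~ (-1) ->
  adj (@conjq R) Jm *m M *m Jm = map_mx id M *~ (-1) ->
  jframe (@conjq R) id (-1) eps Jm M A M0 ->
  exists (P : 'M[H]_(N, m + m)) T, formmx id (- eps) T /\
    frames (@conjq R) id M Jm (quat_j R *: map_mx (@iotaH R) T) (quat_i R)%:M P.
Proof.
move=> fM JJ cons [iA _ _]; have [P [iP PZ]] := complex_quat_structure JJ iA.
have cP := is_conj_conjq R.
have [||||T [fP fT]] := @real_form_gram H C (@conjq R) id id (@iotaH R) cP (is_aut_id _)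
  (@iotaHD R) (@iotaHM R) (@iotaH_inj R) (quat_i R) (quat_j R) _ _ N _ M Jm P (-1) eps (-1)
  (fun=> erefl) _ _ cons fM iP PZ.
- by move=> [a b c d]; rewrite /quat_j !quatE => -[h1 h2 h3 h4]; congr Quat; lra.
- by move=> [a b]; rewrite /quat_j /conjq /iotaH /= !quatE; congr Quat; ring.
- exact: iotaH_commN.
- by rewrite mulrN1z /conjq /quat_j /= quatE !oppr0.
by exists P, T; rewrite mulN1r in fT.
Qed.

Lemma real_points_isomorphic c N n (M Jm : 'M[C]_N) (P : 'M[C]_(N, n)) (T : 'M[R]_n) :
  is_conj c -> (forall y, c (iotaC y) = iotaC y) ->
  frames c (@conjc R) M Jm (1 *: map_mx (@iotaC R) T) 1%:M P ->
  isomorphic (frames c (@conjc R) M Jm M Jm) (Ugroup (gram_form id T)).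
Proof.
move=> cP ci fP; apply: (@real_form_isomorphic C R c (@conjc R) id (@iotaC R) cP (is_aut_conjc R)
  (is_conj_id _) (rmorphD _) (rmorphM _) (rmorph1 _) (@complexI R) 1 1 _ _ _ N n M Jm P T fP).
- exact: iotaC_fixed.
- by move=> x; rewrite mul1r.
- by move=> y; rewrite ci mul1r mulr1.
Qed.

Lemma imaginary_points_isomorphic N n (M Jm : 'M[C]_N) (P : 'M[C]_(N, n)) (T : 'M[R]_n) :
  frames (@conjc R) (@conjc R) M Jm ('i *: map_mx (@iotaC R) T) 1%:M P ->
  isomorphic (frames (@conjc R) (@conjc R) M Jm M Jm) (Ugroup (gram_form id T)).
Proof.
move=> fP; apply: (@real_form_isomorphic C R (@conjc R) (@conjc R) id (@iotaC R)
  (is_conj_conjc R) (is_aut_conjc R)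
  (is_conj_id _) (rmorphD _) (rmorphM _) (rmorph1 _) (@complexI R) 1 'i _ _ _ N n M Jm P T fP).
- exact: iotaC_fixed.
- by move=> x /eqP; rewrite mulf_eq0 => /orP[|/eqP //] /eqP[] /eqP; rewrite oner_eq0.
- by move=> y; rewrite conjc_real mulrC.
Qed.

Lemma complex_points_isomorphic N n (M Jm : 'M[H]_N) (P : 'M[H]_(N, n)) (T : 'M[C]_n) :
  frames (@conjq R) id M Jm (1 *: map_mx (@iotaH R) T) (quat_i R)%:M P ->
  isomorphic (frames (@conjq R) id M Jm M Jm) (Ugroup (gram_form (@conjc R) T)).
Proof.
move=> fP; apply: (@real_form_isomorphic H C (@conjq R) id (@conjc R) (@iotaH R)
  (is_conj_conjq R) (is_aut_id _) (is_conj_conjc R)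
  (@iotaHD R) (@iotaHM R) erefl (@iotaH_inj R) (quat_i R) 1 _ _ _ N n M Jm P T fP).
- exact: iotaH_comm.
- by move=> x; rewrite mul1r.
- by move=> [a b]; rewrite mul1r mulr1 /conjq /iotaH /= oppr0.
Qed.

Lemma twisted_complex_points_isomorphic N n (M Jm : 'M[H]_N) (P : 'M[H]_(N, n)) (T : 'M[C]_n) :
  frames (@conjq R) id M Jm (quat_j R *: map_mx (@iotaH R) T) (quat_i R)%:M P ->
  isomorphic (frames (@conjq R) id M Jm M Jm) (Ugroup (gram_form id T)).
Proof.
move=> fP; apply: (@real_form_isomorphic H C (@conjq R) id id (@iotaH R)
  (is_conj_conjq R) (is_aut_id _) (is_conj_id _)
  (@iotaHD R) (@iotaHM R) erefl (@iotaH_inj R) (quat_i R) (quat_j R) _ _ _ N n M Jm P T fP).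
- exact: iotaH_comm.
- by move=> [a b c d]; rewrite /quat_j !quatE => -[h1 h2 h3 h4]; congr Quat; lra.
- by move=> [a b]; rewrite /quat_j /conjq /iotaH /= !quatE; congr Quat; ring.
Qed.

End RealStructures.

(** * The 54 families *)

Section GenericRows.
Variables (K : nzRingType) (c : K -> K).
Hypotheses (cP : is_conj c) (Kdiv : skewfield K) (K2 : no_2torsion K).

Lemma form_symplectic_dim k n (d : 'M[K]_k) : (forall a, c a = a) -> k = (n + n)%N ->
  formmx c (-1) d -> congr_mx c d (Spmx K n).
Proof.
move=> cid kn fd; have [l cl] := form_symplectic cP Kdiv K2 cid fd.
have [_ /(is_iso_dim Kdiv) kl _] := cl.
by have -> : n = l by lia.
Qed.

Lemma list1_split_inertia N p q : definite c ->
  (forall k (d : 'M_k), formmx c 1 d -> exists p q, congr_mx c d (Ipq K p q)) ->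
  list1_inertia N (FormType c 1) id 1 1 c p q
    (ug_prod (Ugroup (gram_form c (Ipq K p q))) (Ugroup (gram_form c (Ipq K p q))))
    (Ugroup (gram_form c (Ipq K p q))).
Proof.
move=> def cl; apply: (list1_inertia_intro cP (is_aut_id K) (fun=> erefl) Kdiv K2) => //; last first.
  exact: isomorphic_refl.
by move=> M Jm A [fM _] JJ cons jA _; exact: (split_linear_product cP Kdiv K2 JJ fM cons jA).
Qed.

Lemma list1_split N n (M0 : 'M[K]_n) (eps : int) : eps * eps = 1 ->
  (forall k (d : 'M_k), N = (k + k)%N -> formmx c eps d -> congr_mx c d M0) ->
  list1 N (FormType c eps) id 1 1
    (ug_prod (Ugroup (gram_form c M0)) (Ugroup (gram_form c M0))) (Ugroup (gram_form c M0)).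
Proof.
move=> eps1 cl; apply: (list1_intro cP (is_aut_id K) (fun=> erefl) Kdiv K2 _ _ eps1 (c' := c) _ (M0 := M0)) => //.
- by move=> k d Nk; rewrite !mulr1; exact: cl.
- by move=> M Jm A [fM _] JJ cons jA; exact: (split_linear_product cP Kdiv K2 JJ fM cons jA).
- exact: isomorphic_refl.
Qed.

Lemma group_iso_GL N n (M0 : 'M[K]_n) (eps : int) : eps * eps = 1 ->
  group_iso c id 1 eps (-1) N M0 (GL K n).
Proof.
move=> eps1 M Jm A [fM iM] JJ cons jA.
apply: (split_linear_GL cP Kdiv K2 JJ fM cons jA) => //.
by have [] := jframe_form cP (is_aut_id K) (fun=> erefl) (erefl : -1 * -1 = 1 :> int) JJ erefl fM cons
  (erefl : c = c \o id) eps1 iM jA.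
Qed.

Lemma list1_GL N n (M0 : 'M[K]_n) (eps : int) (R1 : pzRingType) (G0 : ugroup R1) : eps * eps = 1 ->
  (forall k (d : 'M_k), N = (k + k)%N -> formmx c (- eps) d -> congr_mx c d M0) ->
  isomorphic (GL K n) G0 ->
  list1 N (FormType c eps) id 1 (-1) G0 (Ugroup (gram_form c M0)).
Proof.
move=> eps1 cl GG0; apply: (list1_intro cP (is_aut_id K) (fun=> erefl) Kdiv K2 _ _ eps1 (c' := c) _ (M0 := M0)) => //.
- by move=> k d Nk; rewrite mulr1 mulrN1; exact: cl.
- by move=> *; apply: isomorphic_trans GG0; apply: group_iso_GL; eassumption.
- exact: isomorphic_refl.
Qed.

Lemma list1_star_GL n d (eps : int) : eps * eps = 1 -> definite c ->
  d != 0 -> (forall x, d * x = x * d) ->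
  (forall k (M0 : 'M_k), formmx c (- eps) M0 ->
    exists p q, congr_mx c M0 (d *: Ipq K p q)) ->
  list1_star (2 * n) (FormType c eps) id 1 (-1) (GL K n)
    (fun p : 'I_n.+1 => Ugroup (gram_form c (Ipq K p (n - p)))).
Proof.
move=> eps1 def d0 dC cl.
apply: (list1_star_intro cP (is_aut_id K) (fun=> erefl) Kdiv K2 _ _ eps1 (c' := c) _ (d := d)) => //.
- by move=> k M0; rewrite mulr1 mulrN1; exact: cl.
- exact: group_iso_GL.
- by move=> p; exact: isomorphic_refl.
Qed.

Lemma list3_GL n : list3 K (2 * n) id 1 (ug_prod (GL K n) (GL K n)) (GL K n).
Proof.
apply: (@list3_intro K c id 1 1 1 c cP (is_aut_id K) (fun=> erefl) Kdiv K2 erefl erefl erefl erefl);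
  last exact: isomorphic_refl.
move=> Jm A JJ jA.
have := split_linear_product cP Kdiv K2 JJ _ _ jA erefl; rewrite (Ugroup0 _ cP); apply.
  by rewrite (adj0 cP) mul0rz.
by rewrite mulmx0 mul0mx map_mx_id mul0rz.
Qed.

End GenericRows.

Section Rows.
Variable R : realType.
Local Notation C := R[i].
Local Notation H := (quat R).
Local Open Scope complex_scope.

Let sR := @skewfield_field R.
Let sC := @skewfield_field C.
Let sH := @skewfield_quat R.
Let tR := @no_2torsion_num R.
Let tC := @no_2torsion_num C.
Let tH := @no_2torsion_quat R.
Let cR := is_conj_id R.
Let cC := is_conj_id C.
Let ccC := is_conj_conjc R.
Let cH := is_conj_conjq R.

Lemma map_iotaC_1 n : map_mx (@iotaC R) (1%:M : 'M_n) = 1%:M.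
Proof. exact: (map_mx1f (rmorphD (real_complex R)) (rmorph1 (real_complex R))). Qed.

Lemma i_neq0 : 'i != 0 :> C.
Proof. by apply/eqP => -[] /eqP; rewrite oner_eq0. Qed.

Lemma family1 p q : list1_inertia (2 * (p + q)) (sym_form R) id 1 1 id p q
  (Opq R p q \xG Opq R p q) (Opq R p q).
Proof. exact: (list1_split_inertia cR sR tR (@definite_id R) (@form_diagonal_R R)). Qed.

Lemma family2 n : list1 (4 * n) (skew_form R) id 1 1 (Sp R n \xG Sp R n) (Sp R n).
Proof.
apply: (list1_split cR sR tR (M0 := Spmx R n)) => // k d Nk.
by apply: form_symplectic_dim => //; lia.
Qed.

Lemma family3 n : list1_star (2 * n) (skew_form R) id 1 (-1)
  (GL R n) (fun p : 'I_n.+1 => Opq R p (n - p)).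
Proof.
apply: (list1_star_GL cR sR tR (d := 1)) => //; first exact: definite_id.
- by rewrite oner_neq0.
- by move=> x; rewrite mulrC.
by move=> k M0; rewrite opprK => /form_diagonal_R[p [q h]]; exists p, q; rewrite scale1r.
Qed.

Lemma family4 n : list1 (4 * n) (sym_form R) id 1 (-1) (GL R (2 * n)) (Sp R n).
Proof.
apply: (list1_GL cR sR tR (M0 := Spmx R n)) => //; last by apply: isomorphic_GL_cast; lia.
by move=> k d Nk; apply: form_symplectic_dim => //; lia.
Qed.

Lemma family9 n : list1 (2 * n) (sym_form C) id 1 1 (OC R n \xG OC R n) (OC R n).
Proof.
apply: (list1_split cC sC tC (M0 := 1%:M)) => // k d Nk fd.
by have kn : k = n by [lia]; subst k; exact: form_scalar_C.
Qed.

Lemma family10 n : list1 (4 * n) (skew_form C) id 1 1 (Sp C n \xG Sp C n) (Sp C n).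
Proof.
apply: (list1_split cC sC tC (M0 := Spmx C n)) => // k d Nk.
by apply: form_symplectic_dim => //; lia.
Qed.

Lemma family11 p q : list1_inertia (2 * (p + q)) (herm_formC R) id 1 1 (@conjc R) p q
  (Upq R p q \xG Upq R p q) (Upq R p q).
Proof. exact: (list1_split_inertia ccC sC tC (@definite_conjc R) (@form_diagonal_C R)). Qed.

Lemma family12 n : list1 (4 * n) (sym_form C) id 1 (-1) (GL C (2 * n)) (Sp C n).
Proof.
apply: (list1_GL cC sC tC (M0 := Spmx C n)) => //; last by apply: isomorphic_GL_cast; lia.
by move=> k d Nk; apply: form_symplectic_dim => //; lia.
Qed.

Lemma family13 n : list1 (2 * n) (skew_form C) id 1 (-1) (GL C n) (OC R n).
Proof.
apply: (list1_GL cC sC tC (M0 := 1%:M)) => //; last exact: isomorphic_refl.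
move=> k d Nk; rewrite opprK => fd.
by have kn : k = n by [lia]; subst k; exact: form_scalar_C.
Qed.

Lemma family14 n : list1_star (2 * n) (herm_formC R) id 1 (-1)
  (GL C n) (fun p : 'I_n.+1 => Upq R p (n - p)).
Proof.
apply: (list1_star_GL ccC sC tC (d := 'i)) => //; first exact: definite_conjc.
- exact: i_neq0.
- by move=> x; rewrite mulrC.
by move=> k M0 /form_diagonal_Ci.
Qed.

Lemma family23 p q : list1_inertia (2 * (p + q)) (herm_formH R) id 1 1 (@conjq R) p q
  (Sppq R p q \xG Sppq R p q) (Sppq R p q).
Proof. exact: (list1_split_inertia cH sH tH (@definite_conjq R) (@form_diagonal_H R)). Qed.

Lemma family24 n : list1 (2 * n) (antiherm_formH R) id 1 1
  (SOstar R n \xG SOstar R n) (SOstar R n).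
Proof.
apply: (list1_split cH sH tH (M0 := (quat_i R)%:M)) => // k d Nk fd.
by have kn : k = n by [lia]; subst k; exact: form_scalar_H.
Qed.

Lemma family25 n : list1 (2 * n) (herm_formH R) id 1 (-1) (GL H n) (SOstar R n).
Proof.
apply: (list1_GL cH sH tH (M0 := (quat_i R)%:M)) => //; last exact: isomorphic_refl.
move=> k d Nk fd.
by have kn : k = n by [lia]; subst k; exact: form_scalar_H.
Qed.

Lemma family26 n : list1_star (2 * n) (antiherm_formH R) id 1 (-1)
  (GL H n) (fun p : 'I_n.+1 => Sppq R p (n - p)).
Proof.
apply: (list1_star_GL cH sH tH (d := 1)) => //; first exact: definite_conjq.
- by rewrite oner_neq0.
- by move=> x; rewrite mulr1 mul1r.
by move=> k M0; rewrite opprK => /form_diagonal_H[p [q h]]; exists p, q; rewrite scale1r.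
Qed.

Lemma adiag_Sp_sym (K : nzRingType) (c : K -> K) eps n : is_conj c -> eps = 1 ->
  adiag c eps (Spmx K n) = block_mx 0 (- Spmx K n) (Spmx K n) 0.
Proof.
move=> cP ->; rewrite /adiag mulr1z; congr block_mx.
by rewrite /Spmx adj_block !(adj0 cP) (adjN cP) !(adj1 cP) opp_block_mx !oppr0 opprK.
Qed.

Lemma adiag_Sp_skew (K : nzRingType) (c : K -> K) eps n : is_conj c -> eps = -1 ->
  adiag c eps (Spmx K n) = block_mx 0 (Spmx K n) (Spmx K n) 0.
Proof.
move=> cP ->; rewrite /adiag mulrN1z; congr block_mx.
by rewrite /Spmx adj_block !(adj0 cP) (adjN cP) !(adj1 cP) opp_block_mx !oppr0 opprK.
Qed.

Lemma family5 n : list1_star (2 * n) (sym_form R) id (-1) (-1)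
  (OC R n) (fun p : 'I_n.+1 => Opq R p (n - p)).
Proof.
apply: (list1_star_intro cR (is_aut_id R) (fun=> erefl) sR tR _ _ _ (c' := id) _ (d := 1)) => //.
- by rewrite oner_neq0.
- by move=> x; rewrite mulrC.
- exact: definite_id.
- move=> k M0; rewrite (_ : 1 * -1 * -1 = 1 :> int) // => /form_diagonal_R[p [q h]].
  by exists p, q; rewrite scale1r.
- move=> M Jm A fM JJ cons jA; rewrite /jframe /adiag (adj1 cR) mulr1z in jA.
  by have := complexify_bilin jA; rewrite map_iotaC_1; exact.
- by move=> p; exact: isomorphic_refl.
Qed.

Lemma family6 n : list1 (4 * n) (skew_form R) id (-1) (-1) (Sp C n) (Sp R n).
Proof.
apply: (list1_intro cR (is_aut_id R) (fun=> erefl) sR tR _ _ _ (c' := id) _ (M0 := Spmx R n)) => //.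
- by move=> k d Nk; apply: form_symplectic_dim => //; lia.
- move=> M Jm A fM JJ cons; rewrite /jframe (adiag_Sp_skew _ cR) // => jA.
  by have := complexify_bilin jA; rewrite map_iotaC_Sp; exact.
- exact: isomorphic_refl.
Qed.

(** The symplectic matrix and its multiples vanish on the first coordinate half, which forces a
    balanced signature. *)
Lemma split_Sp n (K : nzRingType) (c : K -> K) (d : K) p q : is_conj c -> skewfield K ->
  definite c -> congr_mx c (d *: Spmx K n) (Ipq K p q) -> p = n /\ q = n.
Proof.
move=> cP Kdiv def; apply: (split_inertia cP Kdiv def (A := col_mx 1%:M 0)) => //.
  by move=> x; rewrite mul_col_mx mul1mx => /eqP; rewrite col_mx_eq0 => /andP[/eqP].
rewrite adj_col (adj1 cP) (adj0 cP) /Spmx scale_block_mx !scaler0 mul_row_block mul_row_col.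
by rewrite !(mulmx0, mul0mx, addr0).
Qed.

Lemma injmx_scale (K : nzRingType) n (d : K) (M : 'M[K]_n) : skewfield K -> d != 0 ->
  injmx M -> injmx (d *: M).
Proof.
move=> Kdiv d0 iM; have -> : d *: M = d%:M *m M by rewrite mul_scalar_mx.
by apply: injmxM => //; exact: scalar_injmx.
Qed.

Lemma Sp_iso (K : nzRingType) n : is_iso (Spmx K n).
Proof.
exists (- Spmx K n); rewrite mulNmx mulmxN /Spmx mulmx_block.
rewrite !(mulmx0, mul0mx, addr0, add0r) mulmx1 mul1mx opp_block_mx !oppr0 opprK.
by rewrite -scalar_mx_block.
Qed.

Lemma family7 n : list1 (4 * n) (sym_form R) id (-1) 1 (Upq R n n) (Sp R n).
Proof.
apply: (list1_intro cR (is_aut_id R) (fun=> erefl) sR tR _ _ _ (c' := id) _ (M0 := Spmx R n)) => //.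
- by move=> k d Nk; apply: form_symplectic_dim => //; lia.
- move=> M Jm A fM JJ cons; rewrite /jframe (adiag_Sp_sym _ cR) // => jA.
  have := complexify_herm jA; rewrite map_iotaC_Sp => GH; apply: isomorphic_trans GH _.
  (* The factor i makes the real skew matrix hermitian; its signature is then (n, n) by
     [split_Sp]. *)
  have fT : formmx (@conjc R) 1 ('i *: Spmx C n).
    split; last by apply: injmx_scale => //; [exact: i_neq0|exact/is_iso_inj/Sp_iso].
    rewrite mulr1z /Spmx scale_block_mx !scaler0 scalerN adj_block !(adj0 ccC) (adjN ccC).
    rewrite scalemx1 (adj_scalar ccC) -raddfN; congr block_mx; rewrite -?raddfN; congr _%:M.
      by apply: complexP => /=; rewrite ?oppr0.
    by apply: complexP => /=; rewrite ?oppr0 ?opprK.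
  have [p [q cT]] := form_diagonal_C fT.
  have [ep eq] := split_Sp ccC sC (@definite_conjc R) cT; subst p q.
  exact: congr_mx_Ugroup.
- exact: isomorphic_refl.
Qed.

Lemma family8 p q : list1_inertia (2 * (p + q)) (skew_form R) id (-1) 1 id p q
  (Upq R p q) (Opq R p q).
Proof.
apply: (list1_inertia_intro cR (is_aut_id R) (fun=> erefl) sR tR) => //.
- exact: definite_id.
- exact: form_diagonal_R.
- move=> M Jm A fM JJ cons; rewrite /jframe /adiag (adj_Ipq cR) mulrN1z => jA _.
  have := complexify_herm jA; rewrite map_iotaC_Ipq Ugroup_scale //; last first.
  + by move=> x; rewrite mulrC.
  + exact: i_neq0.
- exact: isomorphic_refl.
Qed.

Lemma family15 n : list1_star (2 * n) (skew_form C) (@conjc R) 1 1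
  (Sp R n) (fun p : 'I_n.+1 => Upq R p (n - p)).
Proof.
apply: (list1_star_intro cC (is_aut_conjc R) (fun=> erefl) sC tC _ _ _ (c' := @conjc R) _ (d := 'i)) => //.
- by rewrite mulr1z; apply: complexP => /=; rewrite ?oppr0.
- exact: i_neq0.
- by move=> x; rewrite mulrC.
- exact: definite_conjc.
- by move=> k M0 /form_diagonal_Ci.
- move=> M Jm A fM JJ cons jA.
  have [P [T [fT fP]]] := real_points cC (fun=> erefl) (fun=> erefl) fM JJ cons jA.
  apply: isomorphic_trans (real_points_isomorphic cC (fun=> erefl) fP) _.
  by apply: congr_mx_Ugroup => //; exact: form_symplectic_dim.
- by move=> p; exact: isomorphic_refl.
Qed.

Lemma conjc_comp : (id : C -> C) = @conjc R \o @conjc R.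
Proof. by apply/funext => x /=; rewrite conjcK. Qed.

(** On real points z = s = 1, so D has the same real Gram matrix T as B; Sylvester's law over C
    reads the signature of T from that of D. *)
Lemma real_inertia c c' N n p q (M Jm : 'M[C]_N) (P : 'M[C]_(N, n)) (T : 'M[R]_n) :
  is_conj c -> (forall x, c (conjc x) = conjc (c x)) -> (forall y, c (iotaC y) = iotaC y) ->
  c' = c \o @conjc R ->
  definite c' -> frames c (@conjc R) M Jm (1 *: map_mx (@iotaC R) T) 1%:M P ->
  congr_mx c' (adj c Jm *m M) (Ipq C p q) -> formmx id 1 T -> congr_mx id T (Ipq R p q).
Proof.
move=> cP ct ci c'E def fP cD fT; have [p' [q' cT]] := form_diagonal_R fT.
have c'P := c'P cP (is_aut_conjc R) ct c'E.
have cs y : c (iotaC y) * 1 = 1 * iotaC (id y) by rewrite ci mul1r mulr1.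
have := real_form_managing cP (is_aut_conjc R) (rmorphD _) (rmorphM _) (rmorph1 _)
  (@iotaC_fixed R) cs ct fP cT.
rewrite (conj1 cP) mulr1 scale1r map_iotaC_Ipq -c'E => cD'.
have [-> ->] := sylvester c'P sC def (congr_mx_trans c'P (congr_mx_sym c'P cD) cD').
exact: cT.
Qed.

Lemma family16 p q : list1_inertia (2 * (p + q)) (sym_form C) (@conjc R) 1 1
  (@conjc R) p q (Opq R (2 * p) (2 * q)) (Upq R p q).
Proof.
apply: (list1_inertia_intro cC (is_aut_conjc R) (fun=> erefl) sC tC) => //.
- exact: definite_conjc.
- exact: form_diagonal_C.
- move=> M Jm A fM JJ cons jA cD.
  have [P [T [fT fP]]] := real_points cC (fun=> erefl) (fun=> erefl) fM JJ cons jA.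
  apply: isomorphic_trans (real_points_isomorphic cC (fun=> erefl) fP) _.
  apply: congr_mx_Ugroup => //.
  exact: (real_inertia cC _ _ _ (@definite_conjc R) fP cD fT).
- exact: isomorphic_refl.
Qed.

Lemma real_form_congrC c N n k (M Jm : 'M[C]_N) (P : 'M[C]_(N, n)) (T : 'M[R]_n) (S : 'M[R]_k) :
  is_conj c -> (forall y, c (iotaC y) = iotaC y) ->
  frames c (@conjc R) M Jm (1 *: map_mx (@iotaC R) T) 1%:M P ->
  congr_mx id T S -> congr_mx c M (map_mx (@iotaC R) S).
Proof.
move=> cP ci fP cT.
have cs y : c (iotaC y) * 1 = 1 * iotaC (id y) by rewrite ci mul1r mulr1.
have := real_form_congr cP (rmorphD _) (rmorphM _) (rmorph1 _) cs fP cT.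
by rewrite scale1r.
Qed.

Lemma family17 n : list1 (2 * n) (herm_formC R) (@conjc R) 1 1 (Opq R n n) (OC R n).
Proof.
apply: (list1_intro ccC (is_aut_conjc R) (fun=> erefl) sC tC _ _ _ conjc_comp (M0 := 1%:M)) => //.
- by move=> k d Nk fd; have kn : k = n by [lia]; subst k; exact: form_scalar_C.
- move=> M Jm A fM JJ cons jA; have [eM _] := fM.
  have [P [T [fT fP]]] := real_points ccC (fun=> erefl) (@conjc_real R) fM JJ cons jA.
  apply: isomorphic_trans (real_points_isomorphic ccC (@conjc_real R) fP) _.
  apply: congr_mx_Ugroup => //; have [p [q cT]] := form_diagonal_R fT.
  have := real_form_congrC ccC (@conjc_real R) fP cT; rewrite map_iotaC_Ipq => cM.
  (* The signature of T over R is also that of the hermitian form M over C, and the isotropic half A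
     forces it to be (n, n). *)
  have [iA A0 _] := (jframeP ccC (is_aut_conjc R) (fun=> erefl) JJ eM cons A _).1 jA.
  have := is_iso_inj iA => /injmx_lsub; rewrite row_mxKl => injA.
  have [ep eq] := split_inertia ccC sC (@definite_conjc R) injA A0 (is_iso_dim sC iA) cM.
  by subst p q.
- exact: isomorphic_refl.
Qed.

Lemma family18 n : list1 (4 * n) (herm_formC R) (@conjc R) 1 (-1) (Sp R (2 * n)) (Sp C n).
Proof.
apply: (list1_intro ccC (is_aut_conjc R) (fun=> erefl) sC tC _ _ _ conjc_comp (M0 := Spmx C n)) => //.
- by move=> k d Nk; apply: form_symplectic_dim => //; lia.
- move=> M Jm A fM JJ cons jA.
  have [P [T [fT fP]]] := imaginary_points fM JJ cons jA.
  apply: isomorphic_trans (imaginary_points_isomorphic fP) _.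
  have -> : (2 * n = n + n)%N by lia.
  by apply: congr_mx_Ugroup => //; exact: form_symplectic_dim.
- exact: isomorphic_refl.
Qed.

Lemma family19 p q : list1_inertia (2 * (p + q)) (skew_form C) (@conjc R) (-1) 1
  (@conjc R) p q (Sppq R p q) (Upq R p q).
Proof.
apply: (list1_inertia_intro cC (is_aut_conjc R) (fun=> erefl) sC tC) => //.
- exact: definite_conjc.
- exact: form_diagonal_C.
- move=> M Jm A fM JJ cons; rewrite /jframe /adiag (adj_Ipq cC) mulrN1z => jA _.
  have := @quaternionify_bilin R _ _ M Jm (row_mx A (Jop (@conjc R) Jm A)) (Ipq C p q).
  by rewrite (map_Ipq (is_aut_conjc R)) map_iotaH_Ipq; apply.
- exact: isomorphic_refl.
Qed.

Lemma map_iotaH_scalar n (z : C) : map_mx (@iotaH R) (z%:M : 'M_n) = (iotaH z)%:M.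
Proof. exact: (map_mx_scalarf (@iotaHD R)). Qed.

Lemma family20 n : list1_star (2 * n) (sym_form C) (@conjc R) (-1) 1
  (SOstar R n) (fun p : 'I_n.+1 => Upq R p (n - p)).
Proof.
apply: (list1_star_intro cC (is_aut_conjc R) (fun=> erefl) sC tC _ _ _ (c' := @conjc R) _ (d := 'i)) => //.
- by rewrite mulr1z; apply: complexP => /=; rewrite ?oppr0.
- exact: i_neq0.
- by move=> x; rewrite mulrC.
- exact: definite_conjc.
- by move=> k M0 /form_diagonal_Ci.
- move=> M Jm A fM JJ cons; rewrite /jframe /adiag (adj_scalar cC) mulr1z => jA.
  have := @quaternionify_bilin R _ _ M Jm (row_mx A (Jop (@conjc R) Jm A)) ('i%:M).
  rewrite (map_mx_scalarf (autD (is_aut_conjc R))) -raddfN map_iotaH_scalar.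
  have -> : - conjc 'i = 'i :> C by apply: complexP => /=; rewrite ?oppr0 ?opprK.
  by apply.
- by move=> p; exact: isomorphic_refl.
Qed.

Lemma family21 n : list1 (4 * n) (herm_formC R) (@conjc R) (-1) 1 (Sppq R n n) (Sp C n).
Proof.
apply: (list1_intro ccC (is_aut_conjc R) (fun=> erefl) sC tC _ _ _ conjc_comp (M0 := Spmx C n)) => //.
- by move=> k d Nk; apply: form_symplectic_dim => //; lia.
- move=> M Jm A fM JJ cons; rewrite /jframe (adiag_Sp_sym _ ccC) // => jA.
  have := @quaternionify_herm R _ _ M Jm (row_mx A (Jop (@conjc R) Jm A)) (Spmx C n).
  have -> : map_mx (@conjc R) (Spmx C n) = Spmx C n.
    have aD := autD (is_aut_conjc R).
    by rewrite /Spmx map_block_mx !(map_mx0f aD) (map_mxNf aD) !(map_mx1f aD (aut1 (is_aut_conjc R))).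
  move=> /(_ jA) GH; apply: isomorphic_trans GH _; rewrite map_iotaH_Sp.
  have fT : formmx (@conjq R) 1 (quat_j R *: Spmx H n).
    split; last first.
      apply: injmx_scale => //; last exact/is_iso_inj/Sp_iso.
      by apply/eqP => -[] /eqP; rewrite oner_eq0.
    rewrite mulr1z /Spmx scale_block_mx !scaler0 scalerN adj_block !(adj0 cH) (adjN cH).
    have cj : conjq (quat_j R) = - quat_j R by rewrite /conjq /quat_j /= quatE !oppr0.
    by rewrite scalemx1 (adj_scalar cH) cj -!raddfN /= opprK.
  have [p [q cT]] := form_diagonal_H fT.
  have [ep eq] := split_Sp cH sH (@definite_conjq R) cT; subst p q.
  exact: congr_mx_Ugroup.
- exact: isomorphic_refl.
Qed.

Lemma family22 n : list1 (2 * n) (herm_formC R) (@conjc R) (-1) (-1) (SOstar R n) (OC R n).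
Proof.
apply: (list1_intro ccC (is_aut_conjc R) (fun=> erefl) sC tC _ _ _ conjc_comp (M0 := 1%:M)) => //.
- by move=> k d Nk fd; have kn : k = n by [lia]; subst k; exact: form_scalar_C.
- move=> M Jm A fM JJ cons; rewrite /jframe /adiag (adj1 ccC) mulr1z => jA.
  have := @quaternionify_antiherm R _ _ M Jm (row_mx A (Jop (@conjc R) Jm A)) 1%:M.
  rewrite (map_mx1f (autD (is_aut_conjc R)) (aut1 (is_aut_conjc R))) => /(_ jA) GH.
  apply: isomorphic_trans GH _; apply: congr_mx_Ugroup => //; apply: form_scalar_H.
  rewrite scalemx1 map_iotaH_scalar scale_scalar_mx; split; last first.
    by apply: scalar_injmx => //; apply/eqP => -[] /eqP; rewrite /quat_j /iotaH /=; lra.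
  rewrite (adj_scalar cH) mulrN1z -raddfN; congr _%:M.
  by rewrite /quat_j /iotaH /= !quatE /conjq /=; congr Quat => /=; ring.
- exact: isomorphic_refl.
Qed.

End Rows.

Section MoreRows.
Variable R : realType.
Local Notation C := R[i].
Local Notation H := (quat R).
Local Open Scope complex_scope.

Let sR := @skewfield_field R.
Let sC := @skewfield_field C.
Let sH := @skewfield_quat R.
Let tR := @no_2torsion_num R.
Let tC := @no_2torsion_num C.
Let tH := @no_2torsion_quat R.
Let cR := is_conj_id R.
Let cC := is_conj_id C.
Let ccC := is_conj_conjc R.
Let cH := is_conj_conjq R.

Lemma quat_i_neq0 : quat_i R != 0.
Proof. by apply/eqP => -[] /eqP; rewrite oner_eq0. Qed.

Lemma cs_iotaH (y : C) : conjq (iotaH y) * 1 = 1 * iotaH (conjc y).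
Proof. by case: y => a b; rewrite mul1r mulr1 /conjq /iotaH /= oppr0. Qed.

Lemma map_iotaH_scale (z : C) m n (X : 'M[C]_(m, n)) :
  map_mx (@iotaH R) (z *: X) = iotaH z *: map_mx (@iotaH R) X.
Proof. by apply/matrixP => i j; rewrite !mxE iotaHM. Qed.

Lemma family27 p q : list1_inertia (2 * (p + q)) (antiherm_formH R) id (-1) 1
  (@conjq R) p q (Upq R (2 * p) (2 * q)) (Sppq R p q).
Proof.
apply: (list1_inertia_intro cH (is_aut_id H) (fun=> erefl) sH tH) => //.
- exact: definite_conjq.
- exact: form_diagonal_H.
- move=> M Jm A fM JJ cons jA cD.
  have [P [T [fT fP]]] := complex_points fM JJ cons jA.
  apply: isomorphic_trans (complex_points_isomorphic fP) _.
  have [p' [q' cT]] := form_diagonal_Ci fT.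
  have := real_form_managing cH (is_aut_id H) (@iotaHD R) (@iotaHM R) erefl
    (@iotaH_comm R) cs_iotaH (fun=> erefl) fP cT.
  rewrite map_iotaH_scale map_iotaH_Ipq scalerA.
  (* The antihermitian complex form is i times [Ipq C p' q'], and D carries the further factor
     conj(i); the product is 1, so (p', q') is the inertia of D, namely (2p, 2q). *)
  have -> : conjq (quat_i R) * 1 * iotaH 'i = 1.
    by rewrite /quat_i /conjq /iotaH /= !quatE /=; congr Quat; ring.
  rewrite scale1r => cD'.
  have [ep eq] := sylvester cH sH (@definite_conjq R) (congr_mx_trans cH (congr_mx_sym cH cD) cD').
  rewrite ep eq /Upq -(@Ugroup_scale C (@conjc R) _ (Ipq C p' q') 'i sC (@i_neq0 R)).
    exact: congr_mx_Ugroup.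
  by move=> x; rewrite mulrC.
- exact: isomorphic_refl.
Qed.

Lemma family28 n : list1 (2 * n) (herm_formH R) id (-1) 1 (Upq R n n) (SOstar R n).
Proof.
apply: (list1_intro cH (is_aut_id H) (fun=> erefl) sH tH _ _ _ (c' := @conjq R) _
  (M0 := (quat_i R)%:M)) => //.
- by move=> k d Nk fd; have kn : k = n by [lia]; subst k; exact: form_scalar_H.
- move=> M Jm A fM JJ cons jA; have [eM _] := fM.
  have [P [T [fT fP]]] := complex_points fM JJ cons jA.
  apply: isomorphic_trans (complex_points_isomorphic fP) _.
  apply: congr_mx_Ugroup => //; have [p [q cT]] := form_diagonal_C fT.
  have := real_form_congr cH (@iotaHD R) (@iotaHM R) erefl cs_iotaH fP cT.
  rewrite scale1r map_iotaH_Ipq => cM.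
  have [iA A0 _] := (jframeP cH (is_aut_id H) (fun=> erefl) JJ eM cons A _).1 jA.
  have := is_iso_inj iA => /injmx_lsub; rewrite row_mxKl => injA.
  have [ep eq] := split_inertia cH sH (@definite_conjq R) injA A0 (is_iso_dim sH iA) cM.
  by subst p q.
- exact: isomorphic_refl.
Qed.

Lemma family29 n : list1 (2 * n) (antiherm_formH R) id (-1) (-1) (OC R (2 * n)) (SOstar R n).
Proof.
apply: (list1_intro cH (is_aut_id H) (fun=> erefl) sH tH _ _ _ (c' := @conjq R) _
  (M0 := (quat_i R)%:M)) => //.
- by move=> k d Nk fd; have kn : k = n by [lia]; subst k; exact: form_scalar_H.
- move=> M Jm A fM JJ cons jA.
  have [P [T [fT fP]]] := twisted_complex_points fM JJ cons jA.
  apply: isomorphic_trans (twisted_complex_points_isomorphic fP) _.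
  have -> : (2 * n = n + n)%N by lia.
  by apply: congr_mx_Ugroup => //; exact: form_scalar_C.
- exact: isomorphic_refl.
Qed.

Lemma family30 n : list1_star (2 * n) (herm_formH R) id (-1) (-1)
  (Sp C n) (fun p : 'I_n.+1 => Sppq R p (n - p)).
Proof.
apply: (list1_star_intro cH (is_aut_id H) (fun=> erefl) sH tH _ _ _ (c' := @conjq R) _ (d := 1)) => //.
- by rewrite oner_neq0.
- by move=> x; rewrite mulr1 mul1r.
- exact: definite_conjq.
- move=> k M0; rewrite (_ : 1 * -1 * -1 = 1 :> int) // => /form_diagonal_H[p [q h]].
  by exists p, q; rewrite scale1r.
- move=> M Jm A fM JJ cons jA.
  have [P [T [fT fP]]] := twisted_complex_points fM JJ cons jA.
  apply: isomorphic_trans (twisted_complex_points_isomorphic fP) _.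
  by apply: congr_mx_Ugroup => //; exact: form_symplectic_dim.
- by move=> p; exact: isomorphic_refl.
Qed.

Lemma list2_herm (K : nzRingType) (c : K -> K) n : is_conj c -> skewfield K -> no_2torsion K ->
  definite c -> (forall k (d : 'M_k), formmx c 1 d -> exists p q, congr_mx c d (Ipq K p q)) ->
  list2 (2 * n) (FormType c 1) (Ugroup (gram_form c (Ipq K n n))) (GL K n).
Proof.
move=> cP Kdiv K2 def cl; apply: (list2_intro cP Kdiv K2 (M0 := Ipq K n n)) => //; last exact: isomorphic_refl.
move=> N' M' A Nn fM iA A0; have [p [q cM]] := cl _ _ fM.
by have [ep eq] := split_inertia cP Kdiv def iA A0 Nn cM; subst p q.
Qed.

Lemma family31 n : list2 (2 * n) (sym_form R) (Opq R n n) (GL R n).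
Proof. exact: (list2_herm cR sR tR (@definite_id R) (@form_diagonal_R R)). Qed.

Lemma list2_skew (K : nzRingType) n : is_conj (id : K -> K) -> skewfield K -> no_2torsion K ->
  list2 (2 * n) (skew_form K) (Sp K n) (GL K n).
Proof.
move=> cP Kdiv K2; apply: (list2_intro cP Kdiv K2 (M0 := Spmx K n)) => //; last exact: isomorphic_refl.
by move=> N' M' A Nn fM _ _; exact: form_symplectic_dim.
Qed.

Lemma family33 n : list2 (2 * n) (sym_form C) (OC R (2 * n)) (GL C n).
Proof.
apply: (list2_intro cC sC tC (M0 := 1%:M)) => //; last exact: isomorphic_refl.
move=> N' M' A Nn fM _ _; have -> : (2 * n = N')%N by lia.
exact: form_scalar_C.
Qed.

Lemma family35 n : list2 (2 * n) (herm_formC R) (Upq R n n) (GL C n).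
Proof. exact: (list2_herm ccC sC tC (@definite_conjc R) (@form_diagonal_C R)). Qed.

Lemma family36 n : list2 (2 * n) (herm_formH R) (Sppq R n n) (GL H n).
Proof. exact: (list2_herm cH sH tH (@definite_conjq R) (@form_diagonal_H R)). Qed.

Lemma family37 n : list2 (2 * n) (antiherm_formH R) (SOstar R (2 * n)) (GL H n).
Proof.
apply: (list2_intro cH sH tH (M0 := (quat_i R)%:M)) => //; last exact: isomorphic_refl.
move=> N' M' A Nn fM _ _; have -> : (2 * n = N')%N by lia.
exact: form_scalar_H.
Qed.

Lemma family39 n : list3 R (2 * n) id (-1) (GL C n) (GL R n).
Proof.
apply: (@list3_intro R id id (-1) 1 1 id cR (is_aut_id R) (fun=> erefl) sR tR erefl erefl erefl erefl);
  last exact: isomorphic_refl.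
(* Writing the zero corner as -0 presents the zero Gram matrix in the shape required by
   [complexify_herm]. *)
move=> Jm A JJ; rewrite /jframe /adiag (adj0 cR) mul0rz -[X in block_mx 0 X]oppr0 => jA.
have := complexify_herm jA.
have -> : 'i *: map_mx (@iotaC R) (0 : 'M_n) = 0 by rewrite (map_mx0f (rmorphD (real_complex R))) scaler0.
by rewrite (Ugroup0 _ ccC).
Qed.

Lemma family41 n : list3 C (2 * n) (@conjc R) 1 (GL R (2 * n)) (GL C n).
Proof.
apply: (@list3_intro C id (@conjc R) 1 1 1 (@conjc R) cC (is_aut_conjc R) (fun=> erefl) sC tC erefl erefl erefl erefl);
  last exact: isomorphic_refl.
move=> Jm A JJ [iA _ _]; have [P [iP PZ]] := real_complex_structure JJ iA.
have fP : frames id (@conjc R) 0 Jm (1 *: map_mx (@iotaC R) (0 : 'M_(n + n))) 1%:M P.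
  split=> //; rewrite mulmx0 mul0mx scale1r.
  by rewrite (map_mx0f (rmorphD (real_complex R))).
have := real_points_isomorphic cC (fun=> erefl) fP; rewrite (Ugroup0 _ cR) => GH.
by apply: isomorphic_trans GH _; apply: isomorphic_GL_cast; lia.
Qed.

Lemma family42 n : list3 C (2 * n) (@conjc R) (-1) (GL H n) (GL C n).
Proof.
apply: (@list3_intro C id (@conjc R) (-1) 1 1 (@conjc R) cC (is_aut_conjc R) (fun=> erefl) sC tC erefl erefl erefl erefl);
  last exact: isomorphic_refl.
move=> Jm A JJ; rewrite /jframe /adiag (adj0 cC) mul0rz => jA.
have := @quaternionify_bilin R _ _ 0 Jm (row_mx A (Jop (@conjc R) Jm A)) 0.
rewrite (map_mx0f (autD (is_aut_conjc R))) oppr0 (map_mx0f (@iotaHD R)) (Ugroup0 _ cH).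
exact.
Qed.

Lemma family44 n : list3 H (2 * n) id (-1) (GL C (2 * n)) (GL H n).
Proof.
apply: (@list3_intro H (@conjq R) id (-1) 1 1 (@conjq R) cH (is_aut_id H) (fun=> erefl) sH tH erefl erefl erefl erefl);
  last exact: isomorphic_refl.
move=> Jm A JJ [iA _ _]; have [P [iP PZ]] := complex_quat_structure JJ iA.
have fP : frames (@conjq R) id 0 Jm (1 *: map_mx (@iotaH R) (0 : 'M_(n + n))) (quat_i R)%:M P.
  by split=> //; rewrite mulmx0 mul0mx scale1r (map_mx0f (@iotaHD R)).
have := complex_points_isomorphic fP; rewrite (Ugroup0 _ ccC) => GH.
by apply: isomorphic_trans GH _; apply: isomorphic_GL_cast; lia.
Qed.

Lemma family45 p q m : list4_star (p + q) (sym_form R) p q m (Opq R p q)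
  (fun x : inertia_index p q m =>
     Opq R (ii_r x) (ii_s x) \xG Opq R (p - ii_r x) (q - ii_s x)).
Proof.
by apply: (list4_star_intro cR sR tR) => //; [exact: definite_id|exact: form_diagonal_R| |];
  move=> *; exact: isomorphic_refl.
Qed.

Lemma family49 p q m : list4_star (p + q) (herm_formC R) p q m (Upq R p q)
  (fun x : inertia_index p q m =>
     Upq R (ii_r x) (ii_s x) \xG Upq R (p - ii_r x) (q - ii_s x)).
Proof.
by apply: (list4_star_intro ccC sC tC) => //; [exact: definite_conjc|exact: form_diagonal_C| |];
  move=> *; exact: isomorphic_refl.
Qed.

Lemma family50 p q m : list4_star (p + q) (herm_formH R) p q m (Sppq R p q)
  (fun x : inertia_index p q m =>
     Sppq R (ii_r x) (ii_s x) \xG Sppq R (p - ii_r x) (q - ii_s x)).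
Proof.
by apply: (list4_star_intro cH sH tH) => //; [exact: definite_conjq|exact: form_diagonal_H| |];
  move=> *; exact: isomorphic_refl.
Qed.

Lemma list4_skew (K : nzRingType) k l : is_conj (id : K -> K) -> skewfield K -> no_2torsion K ->
  list4 (2 * (k + l)) (skew_form K) (2 * k) (Sp K (k + l)) (Sp K k \xG Sp K l).
Proof.
move=> cP Kdiv K2.
have cl n N (d : 'M[K]_N) : N = (n + n)%N -> formmx id (-1) d -> congr_mx id d (Spmx K n).
  by move=> Nn; exact: form_symplectic_dim.
apply: (list4_intro cP Kdiv K2 (M1 := Spmx K k) (M2 := Spmx K l) (M0 := Spmx K (k + l))).
- by lia.
- by lia.
- by move=> n d Nn; exact: cl.
- by move=> n d Nn; exact: cl.
- by move=> n d Nn; apply: cl; lia.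
- apply: formmx_congr (congr_mx_sym cP (congr_mx_Sp cP k l)) _ => //.
  split; last exact/is_iso_inj/Sp_iso.
  rewrite /Spmx adj_block !(adj0 cP) (adjN cP) (adj1 cP) mulrN1z opp_block_mx.
  by rewrite !oppr0 opprK.
- exact: isomorphic_refl.
- exact: isomorphic_refl.
Qed.

Lemma isomorphic_prodC (R1 R2 : pzRingType) (A : ugroup R1) (B : ugroup R2) :
  isomorphic (A \xG B) (B \xG A).
Proof.
apply/isomorphicP; exists (fun x => (x.2, x.1)); split=> //.
- by move=> [x y] [? ?]; split.
- by move=> [x y] [x' y'] _ _ [-> ->].
- by move=> [x y] [? ?]; exists (y, x).
Qed.

Lemma formmx_scalar (K : nzRingType) (c : K -> K) (eps : int) d n : is_conj c -> skewfield K ->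
  d != 0 -> c d *~ eps = d -> formmx c eps (d%:M : 'M_n).
Proof.
move=> cP Kdiv d0 cd; split; last exact: scalar_injmx.
rewrite (adj_scalar cP); apply/matrixP => i j; rewrite mxMzE !mxE.
by case: (i == j); rewrite ?mulr1n ?mulr0n ?mul0rz.
Qed.

Lemma family47 n m : list4 (n + m) (sym_form C) m (OC R (n + m)) (OC R n \xG OC R m).
Proof.
(* The m-dimensional summand comes first in the decomposition but second in the named product, hence
   the final exchange of factors. *)
apply: (list4_intro cC sC tC (M1 := 1%:M : 'M_m) (M2 := 1%:M : 'M_n) (M0 := 1%:M)) => //.
- by rewrite addnC.
- by move=> k d kn; subst k; exact: form_scalar_C.
- by move=> k d kn; subst k; exact: form_scalar_C.
- by move=> k d kn; subst k; exact: form_scalar_C.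
- by rewrite -scalar_mx_block; apply: formmx_scalar => //; rewrite oner_neq0.
- exact: isomorphic_refl.
- exact: isomorphic_prodC.
Qed.

Lemma family51 m n : list4 (m + n) (antiherm_formH R) m
  (SOstar R (m + n)) (SOstar R m \xG SOstar R n).
Proof.
apply: (list4_intro cH sH tH (M1 := (quat_i R)%:M : 'M_m) (M2 := (quat_i R)%:M : 'M_n)
  (M0 := (quat_i R)%:M)) => //.
- by move=> k d kn; subst k; exact: form_scalar_H.
- by move=> k d kn; subst k; exact: form_scalar_H.
- by move=> k d kn; subst k; exact: form_scalar_H.
- rewrite -scalar_mx_block; apply: formmx_scalar => //; first exact: quat_i_neq0.
  by rewrite mulrN1z /conjq /quat_i /= quatE !oppr0 opprK.
- exact: isomorphic_refl.
- exact: isomorphic_refl.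
Qed.

End MoreRows.
Local Close Scope classical_set_scope.

Theorem mainTheorem1 (R : realType) :
  (* List 1 *)
  [/\
  (* 1 *) forall p q, list1_inertia (2 * (p + q)) (sym_form R) id 1 1 id p q
    (Opq R p q \xG Opq R p q) (Opq R p q),
  (* 2 *) forall n, list1 (4 * n) (skew_form R) id 1 1
    (Sp R n \xG Sp R n) (Sp R n),
  (* 3 *) forall n, list1_star (2 * n) (skew_form R) id 1 (-1)
    (GL R n) (fun p : 'I_n.+1 => Opq R p (n - p)),
  (* 4 *) forall n, list1 (4 * n) (sym_form R) id 1 (-1)
    (GL R (2 * n)) (Sp R n) &
  (* 5 *) forall n, list1_star (2 * n) (sym_form R) id (-1) (-1)
    (OC R n) (fun p : 'I_n.+1 => Opq R p (n - p))]
  /\ [/\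
  (* 6 *) forall n, list1 (4 * n) (skew_form R) id (-1) (-1)
    (Sp R[i] n) (Sp R n),
  (* 7 *) forall n, list1 (4 * n) (sym_form R) id (-1) 1
    (Upq R n n) (Sp R n) &
  (* 8 *) forall p q, list1_inertia (2 * (p + q)) (skew_form R) id (-1) 1 id p q
    (Upq R p q) (Opq R p q)]
  /\ [/\
  (* 9 *) forall n, list1 (2 * n) (sym_form R[i]) id 1 1
    (OC R n \xG OC R n) (OC R n),
  (* 10 *) forall n, list1 (4 * n) (skew_form R[i]) id 1 1
    (Sp R[i] n \xG Sp R[i] n) (Sp R[i] n),
  (* 11 *) forall p q, list1_inertia (2 * (p + q)) (herm_formC R) id 1 1
    (@conjc R) p q
    (Upq R p q \xG Upq R p q) (Upq R p q),
  (* 12 *) forall n, list1 (4 * n) (sym_form R[i]) id 1 (-1)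
    (GL R[i] (2 * n)) (Sp R[i] n) &
  (* 13 *) forall n, list1 (2 * n) (skew_form R[i]) id 1 (-1)
    (GL R[i] n) (OC R n)]
  /\ [/\
  (* 14 *) forall n, list1_star (2 * n) (herm_formC R) id 1 (-1)
    (GL R[i] n) (fun p : 'I_n.+1 => Upq R p (n - p)),
  (* 15 *) forall n, list1_star (2 * n) (skew_form R[i]) (@conjc R) 1 1
    (Sp R n) (fun p : 'I_n.+1 => Upq R p (n - p)),
  (* 16 *) forall p q, list1_inertia (2 * (p + q)) (sym_form R[i]) (@conjc R) 1 1
    (@conjc R) p q (Opq R (2 * p) (2 * q)) (Upq R p q),
  (* 17 *) forall n, list1 (2 * n) (herm_formC R) (@conjc R) 1 1
    (Opq R n n) (OC R n) &
  (* 18 *) forall n, list1 (4 * n) (herm_formC R) (@conjc R) 1 (-1)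
    (Sp R (2 * n)) (Sp R[i] n)]
  /\ [/\
  (* 19 *) forall p q, list1_inertia (2 * (p + q)) (skew_form R[i]) (@conjc R) (-1) 1
    (@conjc R) p q (Sppq R p q) (Upq R p q),
  (* 20 *) forall n, list1_star (2 * n) (sym_form R[i]) (@conjc R) (-1) 1
    (SOstar R n) (fun p : 'I_n.+1 => Upq R p (n - p)),
  (* 21 *) forall n, list1 (4 * n) (herm_formC R) (@conjc R) (-1) 1
    (Sppq R n n) (Sp R[i] n) &
  (* 22 *) forall n, list1 (2 * n) (herm_formC R) (@conjc R) (-1) (-1)
    (SOstar R n) (OC R n)]
  /\ [/\
  (* 23 *) forall p q, list1_inertia (2 * (p + q)) (herm_formH R) id 1 1
    (@conjq R) p q (Sppq R p q \xG Sppq R p q) (Sppq R p q),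
  (* 24 *) forall n, list1 (2 * n) (antiherm_formH R) id 1 1
    (SOstar R n \xG SOstar R n) (SOstar R n),
  (* 25 *) forall n, list1 (2 * n) (herm_formH R) id 1 (-1)
    (GL (quat R) n) (SOstar R n) &
  (* 26 *) forall n, list1_star (2 * n) (antiherm_formH R) id 1 (-1)
    (GL (quat R) n) (fun p : 'I_n.+1 => Sppq R p (n - p))]
  /\ [/\
  (* 27 *) forall p q, list1_inertia (2 * (p + q)) (antiherm_formH R) id (-1) 1
    (@conjq R) p q (Upq R (2 * p) (2 * q)) (Sppq R p q),
  (* 28 *) forall n, list1 (2 * n) (herm_formH R) id (-1) 1
    (Upq R n n) (SOstar R n),
  (* 29 *) forall n, list1 (2 * n) (antiherm_formH R) id (-1) (-1)
    (OC R (2 * n)) (SOstar R n) &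
  (* 30 *) forall n, list1_star (2 * n) (herm_formH R) id (-1) (-1)
    (Sp R[i] n) (fun p : 'I_n.+1 => Sppq R p (n - p))]
  (* List 2 *)
  /\ [/\
  (* 31 *) forall n, list2 (2 * n) (sym_form R) (Opq R n n) (GL R n),
  (* 32 *) forall n, list2 (2 * n) (skew_form R) (Sp R n) (GL R n),
  (* 33 *) forall n, list2 (2 * n) (sym_form R[i]) (OC R (2 * n)) (GL R[i] n) &
  (* 34 *) forall n, list2 (2 * n) (skew_form R[i]) (Sp R[i] n) (GL R[i] n)]
  /\ [/\
  (* 35 *) forall n, list2 (2 * n) (herm_formC R) (Upq R n n) (GL R[i] n),
  (* 36 *) forall n, list2 (2 * n) (herm_formH R) (Sppq R n n) (GL (quat R) n) &
  (* 37 *) forall n, list2 (2 * n) (antiherm_formH R) (SOstar R (2 * n)) (GL (quat R) n)]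
  (* List 3 *)
  /\ [/\
  (* 38 *) forall n, list3 R (2 * n) id 1
    (GL R n \xG GL R n) (GL R n),
  (* 39 *) forall n, list3 R (2 * n) id (-1) (GL R[i] n) (GL R n),
  (* 40 *) forall n, list3 R[i] (2 * n) id 1
    (GL R[i] n \xG GL R[i] n) (GL R[i] n) &
  (* 41 *) forall n, list3 R[i] (2 * n) (@conjc R) 1 (GL R (2 * n)) (GL R[i] n)]
  /\ [/\
  (* 42 *) forall n, list3 R[i] (2 * n) (@conjc R) (-1) (GL (quat R) n) (GL R[i] n),
  (* 43 *) forall n, list3 (quat R) (2 * n) id 1
    (GL (quat R) n \xG GL (quat R) n) (GL (quat R) n) &
  (* 44 *) forall n, list3 (quat R) (2 * n) id (-1)
    (GL R[i] (2 * n)) (GL (quat R) n)]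
  (* List 4 *)
  /\ [/\
  (* 45 *) forall p q m, list4_star (p + q) (sym_form R) p q m (Opq R p q)
    (fun x : inertia_index p q m =>
       Opq R (ii_r x) (ii_s x) \xG
       Opq R (p - ii_r x) (q - ii_s x)),
  (* 46 *) forall k l, list4 (2 * (k + l)) (skew_form R) (2 * k)
    (Sp R (k + l)) (Sp R k \xG Sp R l),
  (* 47 *) forall n m, list4 (n + m) (sym_form R[i]) m
    (OC R (n + m)) (OC R n \xG OC R m) &
  (* 48 *) forall k l, list4 (2 * (k + l)) (skew_form R[i]) (2 * k)
    (Sp R[i] (k + l)) (Sp R[i] k \xG Sp R[i] l)]
  /\ [/\
  (* 49 *) forall p q m, list4_star (p + q) (herm_formC R) p q m (Upq R p q)
    (fun x : inertia_index p q m =>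
       Upq R (ii_r x) (ii_s x) \xG
       Upq R (p - ii_r x) (q - ii_s x)),
  (* 50 *) forall p q m, list4_star (p + q) (herm_formH R) p q m (Sppq R p q)
    (fun x : inertia_index p q m =>
       Sppq R (ii_r x) (ii_s x) \xG
       Sppq R (p - ii_r x) (q - ii_s x)) &
  (* 51 *) forall m n, list4 (m + n) (antiherm_formH R) m
    (SOstar R (m + n)) (SOstar R m \xG SOstar R n)]
  (* List 5 *)
  /\ [/\
  (* 52 *) forall p q, list5 R (p + q) p q (GL R (p + q)) (GL R p \xG GL R q),
  (* 53 *) forall p q, list5 R[i] (p + q) p q
    (GL R[i] (p + q)) (GL R[i] p \xG GL R[i] q) &
  (* 54 *) forall p q, list5 (quat R) (p + q) p q
    (GL (quat R) (p + q)) (GL (quat R) p \xG GL (quat R) q)].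
Proof.
have sR := @skewfield_field R; have sC := @skewfield_field R[i]; have sH := @skewfield_quat R.
have tR := @no_2torsion_num R; have tC := @no_2torsion_num R[i]; have tH := @no_2torsion_quat R.
have cR := is_conj_id R; have cC := is_conj_id R[i]; have cH := is_conj_conjq R.
split; first by split; [exact: family1|exact: family2|exact: family3|exact: family4|exact: family5].
split; first by split; [exact: family6|exact: family7|exact: family8].
split; first by split; [exact: family9|exact: family10|exact: family11|exact: family12|exact: family13].
split; first by split; [exact: family14|exact: family15|exact: family16|exact: family17|exact: family18].
split; first by split; [exact: family19|exact: family20|exact: family21|exact: family22].
split; first by split; [exact: family23|exact: family24|exact: family25|exact: family26].
split; first by split; [exact: family27|exact: family28|exact: family29|exact: family30].
split.
  split; [exact: family31|move=> n; exact: (list2_skew cR sR tR)|exact: family33|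
          move=> n; exact: (list2_skew cC sC tC)].
split; first by split; [exact: family35|exact: family36|exact: family37].
split.
  split; [move=> n; exact: (list3_GL cR sR tR)|exact: family39|move=> n; exact: (list3_GL cC sC tC)|exact: family41].
split; first by split; [exact: family42|move=> n; exact: (list3_GL cH sH tH)|exact: family44].
split.
  split; [exact: family45|move=> k l; exact: (list4_skew cR sR tR)|exact: family47|
          move=> k l; exact: (list4_skew cC sC tC)].
split; first by split; [exact: family49|exact: family50|exact: family51].
by split=> p q; [exact: (list5_transitive p q cR sR tR)|exact: (list5_transitive p q cC sC tC)|
  exact: (list5_transitive p q cH sH tH)].
Qed.
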